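(* Let $\Omega=\{0,1\}^{\mathbb Z}$, let $\sigma$ be the shift map, and for $p\in[0,1]$ let $\mathbb P_p$ be the Bernoulli measure with $\mathbb P_p([0])=p$, where $[0]=\{\omega\colon\omega_0=0\}$. Let $\mathcal L_0$, $\mathcal L_1$ be the Perron-Frobenius operators of $T_0(z)=z^2$ and $T_1(z)=\left[(z+\frac14)/(1+\frac z4)\right]^2$ acting on $H^2(A_R)$, where $0<R<1$ satisfies $r_{\mathcal T}(R)<R$. For $\epsilon>0$ let $\mathcal L^{U,\epsilon}_i=\mathcal U_\epsilon\circ\mathcal L_i$ ($i=0,1$) and $\mathcal L^{U,\epsilon}_\omega=\mathcal L^{U,\epsilon}_{\omega_0}$, where $$(\mathcal U_\epsilon f)(z)=\frac12\int_{-1}^1f(ze^{-2\pi i\epsilon t})\,e^{-2\pi i\epsilon t}\,dt .$$ For every $p>0$, there are arbitrarily small values of $\epsilon>0$ for which the perturbed cocycle $(\mathcal L^{U,\epsilon}_\omega)_{\omega\in\Omega}$ over $\sigma$ has $\lambda_1=0$ and $\lambda_j=-\infty$ for all $j>1$.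
   Context: Notation: $C_1$ is the unit circle, $A_R=\{z\colon R<|z|<1/R\}$. For a Blaschke product $T$, $r_T(R)=\max_{|z|=R}|T(z)|$; for the cocycle $\mathcal T=(T_{\omega_0})_{\omega\in\Omega}$, $r_{\mathcal T}(R)=\operatorname{ess\,sup}_\omega r_{T_{\omega_0}}(R)$. $H^2(A_R)$ is the Hardy–Hilbert space of analytic functions on $A_R$ with $L^2$ boundary extension to $\partial A_R$, with inner product $\langle f,g\rangle=\frac1{2\pi}\int_{\partial A_R}f\bar g\,\frac{|dz|}{|z|}$; an orthonormal basis is $\{(R^{2n}+R^{-2n})^{-1/2}z^n\colon n\in\mathbb Z\}$. The Perron-Frobenius operator is $\mathcal L_Tf(z)=\sum_{y\in T^{-1}z}f(y)/T'(y)$ for $z\in C_1$; for $f\in H^2(A_R)$ and $r_T(R)<R$, $\mathcal L_Tf$ is the element of $H^2(A_R)$ given on $C_1$ by this formula, and $\mathcal L_T$ is then a compact operator on $H^2(A_R)$. For a cocycle $(\mathcal A_\omega)$ of operators, $\mathcal A^{(n)}_\omega=\mathcal A_{\sigma^{n-1}\omega}\circ\cdots\circ\mathcal A_\omega$. Lyapunov exponents: for a compact cocycle $(\mathcal A_\omega)$ over an invertible ergodic base with $\lim\frac1n\log\|\mathcal A_\omega^{(n)}\|=\lambda_1>-\infty$, the Multiplicative Ergodic Theorem gives finite exponents $\lambda_1>\lambda_2>\cdots$ (finitely or infinitely many), and for a.e. $\omega$ finite-dimensional equivariant Oseledets spaces $V_i(\omega)$ of a.e. constant dimension $m_i$ (the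 multiplicity) with $\frac1n\log\|\mathcal A^{(n)}_\omega f\|\to\lambda_i$ for $f\in V_i(\omega)\setminus\{0\}$, and for each $j$ a closed equivariant complement $F_j(\omega)$ of $V_1(\omega)\oplus\cdots\oplus V_j(\omega)$ with $\limsup\frac1n\log\|\mathcal A^{(n)}_\omega f\|\le\lambda_{j+1}$ for $f\in F_j(\omega)$ (with $\lambda_{j+1}:=-\infty$ if $\lambda_j$ is the last finite exponent). ''$\lambda_1=0$ and $\lambda_j=-\infty$ for all $j>1$'' means the only finite exponent is $0$, with multiplicity $1$. *)

(* Defs.v *)
From HB Require Import structures.
From mathcomp Require Import all_boot all_order all_algebra.
From mathcomp Require Import all_classical all_reals all_analysis.
From mathcomp Require Import ess_sup_inf.
From mathcomp.real_closed Require Export complex.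

Set Implicit Arguments.
Unset Strict Implicit.
Unset Printing Implicit Defensive.

Import Order.TTheory GRing.Theory Num.Theory.
Import numFieldNormedType.Exports.
Import Normc.

Local Open Scope classical_set_scope.
Local Open Scope ring_scope.
Local Open Scope complex_scope.

Section BernoulliShift.

(* The symbols 0 and 1 are [false] and [true]. *)
Definition cylinders : set (set (int -> bool)) :=
  [set S | exists (i : int) (b : bool), S = [set w | w i = b]].

Definition Omega := g_sigma_algebraType cylinders.

Definition left_shift (w : Omega) : Omega := fun i : int => w (i + 1).

Definition bernoulli_measure (R : realType) (p : R)
    (P : probability Omega R) : Prop :=
  forall (s : seq int) (x : int -> bool), uniq s ->
    P [set w | {in s, forall i, w i = x i}] =
    (\prod_(i <- s) (if x i then 1 - p else p))%:E.

End BernoulliShift.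

Section HardySpace.
Variable R : realType.
Local Notation C := R[i].
Local Notation mu := (@lebesgue_measure R).
Implicit Types (rho eps : R) (f g T : C -> C) (z : C).

Definition expi (t : R) : C := cos t +i* sin t.

Definition Cintegral (D : set R) (h : R -> C) : C :=
  Rintegral mu D (fun t => complex.Re (h t)) +i*
  Rintegral mu D (fun t => complex.Im (h t)).

Definition circle rho : set C := [set z | normc z = rho].

Definition annulus rho : set C := [set z | rho < normc z < rho^-1].

Definition analytic_on (D : set C) f : Prop :=
  forall z, D z -> derivable (f : C^o -> C^o) z 1.

Definition angles : set R := `[0, 2 * pi].

Definition square_integrable (phi : R -> C) : Prop :=
  [/\ measurable_fun angles (fun t => complex.Re (phi t)),
      measurable_fun angles (fun t => complex.Im (phi t)) &
      (\int[mu]_(t in angles) (normc (phi t) ^+ 2)%:E < +oo)%E].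

(* [phi] is the L^2 boundary extension of [f] along the filter [F] of radii:
   the functions [t |-> f (r e^(it))] tend to [phi] in L^2 as [r] follows [F].
   The two components of the boundary of the annulus correspond to
   [F := rho^'+] and [F := rho^-1^'-]. *)
Definition is_boundary_extension (F : set_system R) f (phi : R -> C) : Prop :=
  square_integrable phi /\
  (fun r : R => \int[mu]_(t in angles)
      (normc (f (r%:C * expi t) - phi t) ^+ 2)%:E)%E @ F --> 0%E.

(* An element of the Hardy space is represented by the function on the whole
   plane that extends it by 0 off the annulus, so that equality of elements is
   equality of functions. *)
Definition H2 rho : set (C -> C) :=
  [set f | [/\ analytic_on (annulus rho) f,
               (forall z, ~ annulus rho z -> f z = 0),
               (exists phi, is_boundary_extension rho^'+ f phi) &
               (exists phi, is_boundary_extension rho^-1^'- f phi)]].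

(* Well-defined up to equality almost everywhere. *)
Definition boundary_extension (F : set_system R) f : R -> C :=
  xget (fun=> 0) [set phi | is_boundary_extension F f phi].

(* [|dz|/|z|] is [dt] on each of the two boundary circles. *)
Definition H2norm rho f : R :=
  Num.sqrt ((2 * pi)^-1 *
    (Rintegral mu angles
       (fun t => normc (boundary_extension rho^'+ f t) ^+ 2) +
     Rintegral mu angles
       (fun t => normc (boundary_extension rho^-1^'- f t) ^+ 2))).

Definition PF_sum T f z : C :=
  \sum_(y \in T @^-1` [set z]) f y / derive1 (T : C^o -> C^o) y.

(* The element of the Hardy space given on the unit circle by [PF_sum T f];
   it is unique by the identity theorem. *)
Definition PF_operator rho T f : C -> C :=
  xget (fun=> 0)
    [set g | H2 rho g /\ forall z, circle 1 z -> g z = PF_sum T f z].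

Definition U_operator eps f : C -> C := fun z =>
  (2^-1)%:C * Cintegral `[-1, 1]
    (fun t => f (z * expi (- (2 * pi * eps * t))) * expi (- (2 * pi * eps * t))).

Definition max_modulus T rho : \bar R :=
  ereal_sup [set (normc (T z))%:E | z in circle rho].

(* [false] gives T_0 and [true] gives T_1. *)
Definition T_map (b : bool) : C -> C :=
  if b then fun z => ((z + 4^-1) / (1 + z / 4)) ^+ 2 else fun z => z ^+ 2.

Definition cocycle_max_modulus (P : probability Omega R) rho : \bar R :=
  ess_sup P (fun w => max_modulus (T_map (w 0)) rho).

Definition perturbed_cocycle rho eps (w : Omega) : (C -> C) -> (C -> C) :=
  U_operator eps \o PF_operator rho (T_map (w 0)).

End HardySpace.

(* Lyapunov exponents of a cocycle of operators on the normed space consisting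
   of the subset [H] of [E] with the norm [N]. *)
Section Lyapunov.
Context (R : realType) (d : measure_display) (Om : measurableType d).
Variables (P : {measure set Om -> \bar R}) (sigma : Om -> Om).
Variables (E : lmodType R[i]) (H : set E) (N : E -> R).
Variable A : Om -> E -> E.

Fixpoint cocycle (n : nat) (w : Om) : E -> E :=
  if n is k.+1 then A (iter k sigma w) \o cocycle k w else id.

Definition operator_norm (B : E -> E) : \bar R :=
  ereal_sup [set (N (B f))%:E | f in [set f | H f /\ N f <= 1]].

(* The value is -oo when [x = 0]. *)
Definition log_rate (x : nat -> \bar R) (n : nat) : \bar R :=
  ((n%:R^-1)%:E * lne (x n))%E.

Definition has_dim (V : set E) (n : nat) : Prop :=
  exists b : 'I_n -> E,
    (forall c : 'I_n -> R[i], \sum_i c i *: b i = 0 -> forall i, c i = 0) /\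
    (forall f, V f <-> exists c : 'I_n -> R[i], f = \sum_i c i *: b i).

Definition closed_subspace (F : set E) : Prop :=
  [/\ F `<=` H, F 0,
      (forall (a : R[i]) f g, F f -> F g -> F (a *: f + g)) &
      (forall (u : nat -> E) f, (forall n, F (u n)) -> H f ->
         N (u n - f) @[n --> \oo] --> 0 -> F f)].

(* [lam] lists the finite exponents in decreasing order, followed by -oo for
   ever if there are finitely many of them; indices start at 0.  [m] lists the
   multiplicities (and is irrelevant where [lam] is -oo). *)
Definition lyapunov_spectrum (lam : nat -> \bar R) (m : nat -> nat) : Prop :=
  [/\ lam 0%N \is a fin_num,
      (forall j, lam j \is a fin_num -> (lam j.+1 < lam j)%E),
      (forall j, lam j = -oo%E -> lam j.+1 = -oo%E),
      (forall j, lam j \is a fin_num -> (0 < m j)%N) &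
      exists V F : nat -> Om -> set E,
      {ae P, forall w,
        [/\ log_rate (fun n => operator_norm (cocycle n w)) @ \oo --> lam 0%N,
            (forall i, lam i \is a fin_num ->
               [/\ V i w `<=` H, has_dim (V i w) (m i),
                   A w @` V i w = V i (sigma w) &
                   forall f, V i w f -> f <> 0 ->
                     log_rate (fun n => (N (cocycle n w f))%:E) @ \oo
                       --> lam i]) &
            (forall j, lam j \is a fin_num ->
               [/\ closed_subspace (F j w),
                   A w @` F j w `<=` F j (sigma w),
                   (forall f, H f ->
                      exists! vg : ('I_j.+1 -> E) * E,
                        [/\ forall i : 'I_j.+1, V i w (vg.1 i), F j w vg.2 &
                            f = \sum_i vg.1 i + vg.2]) &
                   forall f, F j w f ->
                     (limn_esup (log_rate (fun n => (N (cocycle n w f))%:E))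
                        <= lam j.+1)%E])]}].

End Lyapunov.

(* Main.v *)
(* Write [a_n] for the Laurent coefficients of [f].  The operator [U_eps]
   multiplies [a_n] by a factor which is 1 for n = -1 and which vanishes, when
   [eps = 1 / 2^(M+1)], for every other n with [2^M | n + 1].  Since the transfer
   operator of [z ^ 2] replaces [a_n] by [a_(2n+1)], that is, doubles [n + 1],
   applying [L_0^(U, eps)] M + 1 times in a row gives exactly [a_(-1) / z].
   Both perturbed operators preserve [a_(-1)], and almost every [w] contains runs
   of M + 1 zeros in the past and in the future, so the cocycle collapses to rank
   one: the Oseledets line is spanned by the image of [1 / z] after a past run, and
   [a_(-1) = 0] defines a complement that is eventually mapped to 0.

   The exponent on the line is 0 because the densities met there are uniformly
   bounded in the Hardy norm.  The operators preserve positivity of [z f(z)] on the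
   unit circle, hence [|a_n| <= 2 a_(-1)], and analyticity of the inverse branches
   upgrades this uniform bound to a uniform geometric decay of the [a_n] by an
   inequality of Lasota-Yorke type.

   The Laurent expansion of functions that are only complex differentiable comes
   from Goursat's theorem by bisection of rectangles in polar coordinates. *)
Require Import Defs.
From HB Require Import structures.
From mathcomp Require Import all_boot all_order all_algebra.
From mathcomp Require Import all_classical all_reals all_analysis.
From mathcomp Require Import measurable_realfun ess_sup_inf.
From mathcomp Require Import ring lra zify.

Set Implicit Arguments.
Unset Strict Implicit.
Unset Printing Implicit Defensive.

Import Order.TTheory GRing.Theory Num.Theory.
Import numFieldNormedType.Exports.
Import Normc.

Local Open Scope classical_set_scope.
Local Open Scope ring_scope.
Local Open Scope complex_scope.

(** Parseval's identity is replaced by two one-sided estimates, since exponents do not see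
    constants: the norm bounds [a_n] by a multiple of [q ^ |n|] for every [q > rho] ([H2_gbound]),
    and decay at a rate [s < rho] bounds the norm ([lsynth_norm]). The operators bridge the gap
    between the two rates: the inverse branches carry an annulus into one strictly smaller than that
    of [rho], and passing from index [2 n + 1] to [n] squares the decay rate. The hypothesis on
    [r_T(rho)] enters at the point [rho]: it puts the Moebius image of [rho] below [sqrt rho], which
    leaves room for both gains. If the second map violates it there, the symbol 1 has probability 0.

    The choice of [eps]: [U_eps] averages over rotations filling [2 eps] of a full turn. For
    [2 eps = 2^-M] the mode [n] is averaged over [(n + 1) / 2^M] periods, hence killed when this
    number is a nonzero integer. After M + 1 steps, [a_n] carries the factors of the indices [k]
    with [k + 1 = 2^i (n + 1)], [0 <= i <= M], and the one with [i = M] vanishes unless [n = -1]. *)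

Section Basics.
Variable R : realType.
Local Notation C := R[i].
Local Notation mu := (@lebesgue_measure R).
Local Notation Re := complex.Re.
Local Notation Im := complex.Im.

(** * Modulus, polar form, and calculus along a real parameter *)

Lemma normc_0 : normc (0 : C) = 0.
Proof. by rewrite /normc /= expr0n/= addr0 sqrtr0. Qed.

Lemma normcX (z : C) n : normc (z ^+ n) = normc z ^+ n.
Proof. by elim: n => [|n IH]; rewrite ?expr0 ?normc1// !exprS normcM IH. Qed.

Lemma normc_ge0 (z : C) : 0 <= normc z.
Proof. by case: z => x y; rewrite /normc sqrtr_ge0. Qed.

Lemma normc_real (x : R) : normc x%:C = `|x|.
Proof. by rewrite /normc /= expr0n /= addr0 sqrtr_sqr. Qed.

Lemma normc_eq0 (z : C) : (normc z == 0) = (z == 0).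
Proof. by apply/eqP/eqP => [/eq0_normc//|->]; rewrite normc0. Qed.

Lemma normc_gt0 (z : C) : (0 < normc z) = (z != 0).
Proof. by rewrite lt_neqAle normc_ge0 andbT eq_sym normc_eq0. Qed.

Lemma Re_le_normc (z : C) : `|Re z| <= normc z.
Proof.
by case: z => x y; rewrite /normc /= -sqrtr_sqr ler_wsqrtr// lerDl sqr_ge0.
Qed.

Lemma Im_le_normc (z : C) : `|Im z| <= normc z.
Proof.
by case: z => x y; rewrite /normc /= -sqrtr_sqr ler_wsqrtr// lerDr sqr_ge0.
Qed.

Lemma normc_le_ReIm (z : C) : normc z <= `|Re z| + `|Im z|.
Proof.
case: z => x y; rewrite /normc /= -[leRHS]ger0_norm ?addr_ge0// -sqrtr_sqr.
rewrite ler_wsqrtr// sqrrD !real_normK ?num_real// lerD2r lerDl.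
by rewrite mulrn_wge0// mulr_ge0.
Qed.

Lemma sqr_normc_ReIm (z : C) : normc z ^+ 2 = Re z ^+ 2 + Im z ^+ 2.
Proof. by case: z => x y; rewrite /normc sqr_sqrtr// addr_ge0 ?sqr_ge0. Qed.

Lemma distcC (z w : C) : normc (z - w) = normc (w - z).
Proof. by rewrite -normcN opprB. Qed.

Lemma le_normcB (z w : C) : normc (z - w) <= normc z + normc w.
Proof. by rewrite -(normcN w) le_normcD. Qed.

Lemma le_distc_normc (z w : C) : `|normc z - normc w| <= normc (z - w).
Proof.
rewrite ler_norml; apply/andP; split.
  by rewrite lerNl opprB lerBlDr distcC -{1}(subrK z w) le_normcD.
by rewrite lerBlDr -{1}(subrK w z) le_normcD.
Qed.

Lemma le_normc_sum I (s : seq I) (P : pred I) (F : I -> C) :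
  normc (\sum_(i <- s | P i) F i) <= \sum_(i <- s | P i) normc (F i).
Proof.
elim/big_ind2 : _ => [|x1 x2 y1 y2 h1 h2|//]; first by rewrite normc0.
exact: le_trans (le_normcD _ _) (lerD h1 h2).
Qed.

Lemma ReZ (a b : C) : Re (a * b) = Re a * Re b - Im a * Im b.
Proof. by case: a b => [? ?] [? ?]. Qed.

Lemma ImZ (a b : C) : Im (a * b) = Re a * Im b + Im a * Re b.
Proof. by case: a b => [? ?] [? ?]. Qed.

Lemma ReD (a b : C) : Re (a + b) = Re a + Re b.
Proof. by case: a b => [? ?] [? ?]. Qed.

Lemma ImD (a b : C) : Im (a + b) = Im a + Im b.
Proof. by case: a b => [? ?] [? ?]. Qed.

Lemma ReN (a : C) : Re (- a) = - Re a. Proof. by case: a. Qed.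
Lemma ImN (a : C) : Im (- a) = - Im a. Proof. by case: a. Qed.

Lemma complex_eqP (a b : C) : Re a = Re b -> Im a = Im b -> a = b.
Proof. by case: a b => [? ?] [? ?] /= -> ->. Qed.

Lemma expi0 : expi (0 : R) = 1.
Proof. by rewrite /expi cos0 sin0. Qed.

Lemma expiD (s t : R) : expi (s + t) = expi s * expi t.
Proof.
by apply: complex_eqP; rewrite ?ReZ ?ImZ /= ?cosD ?sinD//; ring.
Qed.

Lemma normc_expi (t : R) : normc (expi t) = 1.
Proof. by rewrite /normc /expi cos2Dsin2 sqrtr1. Qed.

Lemma expi_neq0 (t : R) : expi t != 0.
Proof. by rewrite -normc_gt0 normc_expi. Qed.

Lemma expiN (t : R) : expi (- t) = (expi t)^-1.
Proof.
apply: (mulIf (expi_neq0 t)); rewrite -expiD addNr expi0 mulVf//.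
exact: expi_neq0.
Qed.

Lemma expiMn (t : R) n : expi (t *+ n) = expi t ^+ n.
Proof. by elim: n => [|n IH]; rewrite ?mulr0n ?expi0// mulrS expiD IH exprS. Qed.

Lemma expiMz (t : R) (n : int) : expi (n%:~R * t) = expi t ^ n.
Proof.
case: n => n; first by rewrite -pmulrn mulr_natl expiMn.
by rewrite NegzE mulrNz mulNr expiN -pmulrn mulr_natl expiMn -exprnN.
Qed.

Lemma expi2pi : expi (2 * pi : R) = 1.
Proof. by rewrite /expi mulr_natl cos2pi sin2pi. Qed.

Lemma polarP (z : C) : exists2 t : R, 0 <= t < 2 * pi & z = (normc z)%:C * expi t.
Proof.
have [->|z0] := eqVneq z 0.
  by exists 0; rewrite ?lexx ?mulr_gt0 ?pi_gt0// ?normc_0 ?mul0r.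
have nz0 : 0 < normc z by rewrite normc_gt0.
set w := z / (normc z)%:C.
have zE : z = (normc z)%:C * w.
  by rewrite mulrC divfK// -normc_eq0 normc_real normr_eq0 gt_eqF.
have w1 : normc w = 1.
  apply: (mulfI (lt0r_neq0 nz0)).
  by rewrite mulr1 -[X in X * _](gtr0_norm nz0) -normc_real -normcM -zE.
suff [t t01 wE] : exists2 t : R, 0 <= t < 2 * pi & w = expi t.
  by exists t => //; rewrite -wE.
move: w1; case: (w) => x y {zE} w1.
have xy1 : x ^+ 2 + y ^+ 2 = 1.
  by have := sqr_normc_ReIm (x +i* y); rewrite w1 expr1n.
have x1 : -1 <= x <= 1.
  by rewrite -ler_norml -(@ler_pXn2r _ 2)// ?nnegrE// expr1n real_normK ?num_real// -xy1 lerDl sqr_ge0.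
have px : x \in `[-1, 1] by [].
have sE : sin (acos x) = `|y|.
  rewrite sin_acos// -sqrtr_sqr; congr (Num.sqrt _).
  by rewrite -xy1; ring.
have pi0 := pi_gt0 R.
have /andP[a0 a1] : 0 <= acos x <= pi by rewrite acos_ge0 ?acos_lepi.
have [y0|y0] := leP 0 y.
  exists (acos x); first by rewrite a0/=; lra.
  by rewrite /expi acosK// sE ger0_norm.
(* The lower half-circle. The angle stays below [2 * pi] because [sin (acos x) = |y|] is nonzero, so
   [acos x] is not 0. *)
exists (2 * pi - acos x).
  have : acos x != 0.
    by apply/eqP => a00; move: sE; rewrite a00 sin0 => /esym/eqP; rewrite normr_eq0 lt_eqF.
  move=> an0; have a2 : 0 < acos x by rewrite lt_neqAle eq_sym an0.
  by apply/andP; split; lra.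
rewrite expiD expi2pi mul1r /expi cosN sinN acosK// sE ltr0_norm// opprK//.
Qed.

(** * Integrals of complex-valued functions of a real variable *)

(** Continuity, and below it differentiability, are taken componentwise because [Cintegral] consists
    of two real integrals: each real theorem is then applied to both components. *)
Definition pcont (h : R -> C) (t : R) : Prop :=
  Re (h s) @[s --> t] --> Re (h t) /\ Im (h s) @[s --> t] --> Im (h t).

Definition pderiv (h : R -> C) (t : R) (d : C) : Prop :=
  is_derive t 1 (fun s => Re (h s)) (Re d) /\ is_derive t 1 (fun s => Im (h s)) (Im d).

Definition pconton a b (h : R -> C) := forall t, a <= t <= b -> pcont h t.

Lemma pcontP (h : R -> C) t : pcont h t <-> forall e, 0 < e ->
  exists2 d, 0 < d & forall s, `|s - t| < d -> normc (h s - h t) < e.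
Proof.
split=> [[c1 c2] e e0|H].
- have e20 : 0 < e / 2 by rewrite divr_gt0.
  move/cvgrPdist_lt : c1 => /(_ _ e20)/nbhs_ballP[d1 /= d10 h1].
  move/cvgrPdist_lt : c2 => /(_ _ e20)/nbhs_ballP[d2 /= d20 h2].
  exists (Num.min d1 d2); first by rewrite lt_min d10.
  move=> s; rewrite lt_min => /andP[s1 s2].
  apply: le_lt_trans (normc_le_ReIm _) _.
  rewrite [e]splitr ReD ImD ReN ImN -normrN -[X in _ + X]normrN !opprB.
  apply: ltrD; [apply: h1|apply: h2]; by rewrite /ball /= distrC.
- split; apply/cvgrPdist_lt => e /H[d d0 hd]; apply/nbhs_ballP; exists d => //= s;
    rewrite /ball /= distrC => /hd; apply: le_lt_trans; rewrite distrC -?ReN -?ImN -?ReD -?ImD.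
    exact: Re_le_normc.
  exact: Im_le_normc.
Qed.

Lemma pcont_cst (c : C) t : pcont (fun=> c) t.
Proof. by split; exact: cst_continuous. Qed.

Lemma pcontD (f g : R -> C) t : pcont f t -> pcont g t -> pcont (fun s => f s + g s) t.
Proof.
move=> [f1 f2] [g1 g2]; split.
  by under eq_cvg do rewrite ReD; rewrite ReD; exact: cvgD.
by under eq_cvg do rewrite ImD; rewrite ImD; exact: cvgD.
Qed.

Lemma pcontM (f g : R -> C) t : pcont f t -> pcont g t -> pcont (fun s => f s * g s) t.
Proof.
move=> [f1 f2] [g1 g2]; split.
  by under eq_cvg do rewrite ReZ; rewrite ReZ; apply: cvgB; exact: cvgM.
by under eq_cvg do rewrite ImZ; rewrite ImZ; apply: cvgD; exact: cvgM.
Qed.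

Lemma pcontN (f : R -> C) t : pcont f t -> pcont (fun s => - f s) t.
Proof.
move=> [f1 f2]; split.
  by under eq_cvg do rewrite ReN; rewrite ReN; exact: cvgN.
by under eq_cvg do rewrite ImN; rewrite ImN; exact: cvgN.
Qed.

Lemma pcontB (f g : R -> C) t : pcont f t -> pcont g t -> pcont (fun s => f s - g s) t.
Proof. by move=> f1 g1; apply: pcontD => //; exact: pcontN. Qed.

Lemma pcont_sum n (f : nat -> R -> C) t : (forall k, pcont (f k) t) ->
  pcont (fun s => \sum_(k < n) f k s) t.
Proof.
move=> H; elim: n => [|n IH].
  by under [fun s => _]eq_fun do rewrite big_ord0; exact: pcont_cst.
by under [fun s => _]eq_fun do rewrite big_ord_recr /=; exact: pcontD.
Qed.

Lemma pcontX (f : R -> C) n t : pcont f t -> pcont (fun s => f s ^+ n) t.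
Proof.
move=> cf; elim: n => [|n IH]; first exact: pcont_cst.
by under [fun s => _]eq_fun do rewrite exprS; exact: pcontM.
Qed.

Lemma pcont_real (g : R -> R) t : {for t, continuous g} -> pcont (fun s => (g s)%:C) t.
Proof. by move=> cg; split=> //=; exact: cst_continuous. Qed.

Lemma pcont_id t : pcont (fun s => s%:C) t.
Proof. by apply: pcont_real; exact: cvg_id. Qed.

Lemma pderiv_cont (h : R -> C) t d : pderiv h t d -> pcont h t.
Proof.
move=> [[d1 _] [d2 _]]; split.
  exact: (differentiable_continuous ((derivable1_diffP _ _).1 d1)).
exact: (differentiable_continuous ((derivable1_diffP _ _).1 d2)).
Qed.

Lemma pderiv_cst (c : C) t : pderiv (fun=> c) t 0.
Proof. by split; exact: is_derive_cst. Qed.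

Lemma pderivD (f g : R -> C) t df dg : pderiv f t df -> pderiv g t dg ->
  pderiv (fun s => f s + g s) t (df + dg).
Proof.
move=> [f1 f2] [g1 g2]; split.
  by rewrite ReD; under [fun s => _]eq_fun do rewrite ReD; exact: is_deriveD.
by rewrite ImD; under [fun s => _]eq_fun do rewrite ImD; exact: is_deriveD.
Qed.

Lemma pderivM (f g : R -> C) t df dg : pderiv f t df -> pderiv g t dg ->
  pderiv (fun s => f s * g s) t (df * g t + f t * dg).
Proof.
move=> [f1 f2] [g1 g2]; split.
  under [fun s => _]eq_fun do rewrite ReZ.
  have := is_deriveB (is_deriveM f1 g1) (is_deriveM f2 g2).
  by move/(@is_derive_eq _ _ _ _ _ _ _ _); apply; rewrite ReD !ReZ /GRing.scale /=; ring.
under [fun s => _]eq_fun do rewrite ImZ.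
have := is_deriveD (is_deriveM f1 g2) (is_deriveM f2 g1).
by move/(@is_derive_eq _ _ _ _ _ _ _ _); apply; rewrite ImD !ImZ /GRing.scale /=; ring.
Qed.

Lemma pderiv_eq (f : R -> C) t d d' : pderiv f t d -> d = d' -> pderiv f t d'.
Proof. by move=> h <-. Qed.

Lemma pderivX (f : R -> C) t df n : pderiv f t df ->
  pderiv (fun s => f s ^+ n.+1) t (n.+1%:R * f t ^+ n * df).
Proof.
move=> hf; elim: n => [|n IH].
  under [fun s => _]eq_fun do rewrite expr1.
  by rewrite expr0 !mul1r.
under [fun s => _]eq_fun do rewrite exprS.
apply: pderiv_eq (pderivM hf IH) _.
by rewrite -[n.+2%:R]natr1 exprS; ring.
Qed.

Lemma ReV (z : C) : Re z^-1 = Re z / (Re z ^+ 2 + Im z ^+ 2).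
Proof. by case: z. Qed.

Lemma ImV (z : C) : Im z^-1 = - (Im z / (Re z ^+ 2 + Im z ^+ 2)).
Proof. by case: z. Qed.

Lemma is_derive_ratio (x n : R -> R) (t dx dn : R) : n t != 0 ->
  is_derive t 1 x dx -> is_derive t 1 n dn ->
  is_derive t 1 (fun s => x s / n s) ((dx * n t - x t * dn) / n t ^+ 2).
Proof.
move=> n0 hx hn; have := is_deriveM hx (is_deriveV n0 hn).
move/(@is_derive_eq _ _ _ _ _ _ _ _); apply; rewrite /GRing.scale /=.
by field.
Qed.

Lemma pderivV (f : R -> C) t df : f t != 0 -> pderiv f t df ->
  pderiv (fun s => (f s)^-1) t (- df / f t ^+ 2).
Proof.
move=> ft0 [f1 f2].
have n0 : Re (f t) ^+ 2 + Im (f t) ^+ 2 != 0.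
  by rewrite -sqr_normc_ReIm sqrf_eq0 normc_eq0.
have hN : is_derive t 1 (fun s => Re (f s) ^+ 2 + Im (f s) ^+ 2)
    (2 * Re (f t) * Re df + 2 * Im (f t) * Im df).
  have := is_deriveD (is_deriveX 2 f1) (is_deriveX 2 f2).
  by move/(@is_derive_eq _ _ _ _ _ _ _ _); apply; rewrite /GRing.scale /= !expr1.
have h1 := @is_derive_ratio (fun s => Re (f s)) _ t _ _ n0 f1 hN.
have h2 := is_deriveN (@is_derive_ratio (fun s => Im (f s)) _ t _ _ n0 f2 hN).
have -> : - df / f t ^+ 2 = - df * ((f t)^-1) ^+ 2 by rewrite exprVn.
split.
  rewrite (_ : (fun s => _) = (fun s => Re (f s) / (Re (f s) ^+ 2 + Im (f s) ^+ 2))); last first.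
    by apply/funext => s; rewrite ReV.
  move: h1; move/(@is_derive_eq _ _ _ _ _ _ _ _); apply.
  rewrite ReZ expr2 ReZ ImZ ReN ImN ReV ImV.
  move: n0; move: (Re (f t)) (Im (f t)) (Re df) (Im df) => a b u v n0; field.
  by rewrite n0.
rewrite (_ : (fun s => _) = (fun s => - (Im (f s) / (Re (f s) ^+ 2 + Im (f s) ^+ 2)))); last first.
  by apply/funext => s; rewrite ImV.
move: h2; move/(@is_derive_eq _ _ _ _ _ _ _ _); apply.
rewrite ImZ expr2 ReZ ImZ ReN ImN ReV ImV.
move: n0; move: (Re (f t)) (Im (f t)) (Re df) (Im df) => a b u v n0; field.
by rewrite n0.
Qed.

Lemma pderiv_id t : pderiv (fun s => s%:C) t 1.
Proof. split; [exact: is_derive_id|exact: is_derive_cst]. Qed.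

Lemma pderiv_expi (k t : R) : pderiv (fun s => expi (k * s)) t (k%:C * 'i * expi (k * t)).
Proof.
have hk : is_derive t 1 (fun s : R => k * s) k.
  have := is_deriveZ k (is_derive_id t (1 : R)).
  by move/(@is_derive_eq _ _ _ _ _ _ _ _); apply; rewrite /GRing.scale /= mulr1.
split.
  have := is_derive1_comp (is_derive_cos (k * t)) hk.
  by move/(@is_derive_eq _ _ _ _ _ _ _ _); apply; rewrite /= !(mul0r,mulr0,mulr1,mul1r,subr0,addr0,add0r); ring.
have := is_derive1_comp (is_derive_sin (k * t)) hk.
by move/(@is_derive_eq _ _ _ _ _ _ _ _); apply; rewrite /= !(mul0r,mulr0,mulr1,mul1r,subr0,addr0,add0r); ring.
Qed.

Lemma pcont_expiM (k t : R) : pcont (fun s => expi (k * s)) t.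
Proof. exact: pderiv_cont (pderiv_expi k t). Qed.

Lemma pcont_expi (t : R) : pcont (@expi R) t.
Proof. by have := pcont_expiM 1 t; under [fun s => _]eq_fun do rewrite mul1r. Qed.

(** * Complex-valued integrals over segments *)

Definition Cint a b (h : R -> C) : C := Cintegral `[a, b] h.

Lemma pconton_within a b h : pconton a b h ->
  {within `[a, b], continuous (fun s => Re (h s))} /\
  {within `[a, b], continuous (fun s => Im (h s))}.
Proof.
move=> H; split; apply: continuous_in_subspaceT => t /set_mem;
  rewrite /= in_itv /= => /H[c1 c2] //.
Qed.

Lemma pconton_integrable a b h : pconton a b h ->
  mu.-integrable `[a, b] (EFin \o (fun s => Re (h s))) /\
  mu.-integrable `[a, b] (EFin \o (fun s => Im (h s))).
Proof.
by move=> /pconton_within[c1 c2]; split; apply: continuous_compact_integrable => //;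
  exact: segment_compact.
Qed.

Lemma eq_Cint a b h h' : (forall t, a <= t <= b -> h t = h' t) -> Cint a b h = Cint a b h'.
Proof.
move=> E; rewrite /Cint /Cintegral.
by congr (_ +i* _); apply: eq_Rintegral => t /set_mem; rewrite /= in_itv /= => /E ->.
Qed.

Lemma CintD a b f g : pconton a b f -> pconton a b g ->
  Cint a b (fun s => f s + g s) = Cint a b f + Cint a b g.
Proof.
move=> /pconton_integrable[f1 f2] /pconton_integrable[g1 g2].
rewrite /Cint /Cintegral; apply: complex_eqP; rewrite ?ReD ?ImD /=.
  by under eq_Rintegral do rewrite ReD; rewrite RintegralD.
by under eq_Rintegral do rewrite ImD; rewrite RintegralD.
Qed.

Lemma CintZ a b (c : C) f : pconton a b f ->
  Cint a b (fun s => c * f s) = c * Cint a b f.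
Proof.
move=> cf; have [f1 f2] := pconton_integrable cf.
have I (x : R) g : mu.-integrable `[a, b] (EFin \o g) -> mu.-integrable `[a, b] (EFin \o (fun s => x * g s)).
  by move=> hg; have := integrableZl (mu := mu) (measurable_itv `[a, b]) x hg; apply: eq_integrable.
rewrite /Cint /Cintegral; apply: complex_eqP; rewrite ?ReZ ?ImZ /=.
  under eq_Rintegral do rewrite ReZ; rewrite RintegralB//; [|exact: I|exact: I].
  by rewrite !RintegralZl.
under eq_Rintegral do rewrite ImZ; rewrite RintegralD//; [|exact: I|exact: I].
by rewrite !RintegralZl.
Qed.

Lemma CintN a b f : pconton a b f -> Cint a b (fun s => - f s) = - Cint a b f.
Proof.
by move=> hf; rewrite -mulN1r -CintZ//; apply: eq_Cint => t _; rewrite mulN1r.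
Qed.

Lemma CintB a b f g : pconton a b f -> pconton a b g ->
  Cint a b (fun s => f s - g s) = Cint a b f - Cint a b g.
Proof.
move=> hf hg; rewrite CintD// ?CintN// => t ht; apply: pcontN; exact: hg.
Qed.

Lemma Cint_sum a b n (f : nat -> R -> C) : (forall k, pconton a b (f k)) ->
  Cint a b (fun s => \sum_(k < n) f k s) = \sum_(k < n) Cint a b (f k).
Proof.
move=> H; elim: n => [|n IH].
  rewrite big_ord0 /Cint /Cintegral.
  under eq_Rintegral do rewrite big_ord0; under [X in _ +i* X]eq_Rintegral do rewrite big_ord0.
  by rewrite /= !Rintegral_cst//= !mul0r.
rewrite big_ord_recr /= -IH -CintD//; last by move=> t ht; apply: pcont_sum => k; exact: H.
by apply: eq_Cint => t _; rewrite big_ord_recr.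
Qed.

Lemma Cint_cst a b (c : C) : a <= b -> Cint a b (fun=> c) = (b - a)%:C * c.
Proof.
move=> ab; rewrite /Cint /Cintegral !Rintegral_cst//= lebesgue_measure_itv/= lte_fin.
have -> : fine (if a < b then (b%:E + (- a)%:E)%E else 0%E) = b - a.
  case: ifPn => //; rewrite -leNgt => ba.
  by have -> : a = b; [apply/eqP; rewrite eq_le ab|rewrite subrr].
by apply: complex_eqP; rewrite ?ReZ ?ImZ /=; ring.
Qed.

Lemma Rint_bound a b (h : R -> R) B : a <= b ->
  mu.-integrable `[a, b] (EFin \o h) -> (forall t, a <= t <= b -> `|h t| <= B) ->
  `|\int[mu]_(t in `[a, b]) h t| <= B * (b - a).
Proof.
move=> ab hi hB; apply: le_trans (le_normr_Rintegral _ hi) _ => //.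
have -> : B * (b - a) = \int[mu]_(t in `[a, b]) B.
  rewrite Rintegral_cst//= lebesgue_measure_itv/= lte_fin.
  case: ifPn => //; rewrite -leNgt => ba.
  by have -> : a = b; [apply/eqP; rewrite eq_le ab|rewrite subrr].
apply: le_Rintegral => //.
- by have := integrable_abse hi; apply: eq_integrable.
- apply: (@continuous_compact_integrable _ (fun=> B)); first exact: segment_compact.
  by move=> x; exact: cst_continuous.
Qed.

(* The factor 2 comes from bounding the two components separately. *)
Lemma Cint_bound a b h B : a <= b -> pconton a b h ->
  (forall t, a <= t <= b -> normc (h t) <= B) -> normc (Cint a b h) <= 2 * B * (b - a).
Proof.
move=> ab hc hB; have [i1 i2] := pconton_integrable hc.
apply: le_trans (normc_le_ReIm _) _; rewrite -mulrA mulr_natl mulr2n /Cint /Cintegral /=.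
by apply: lerD; apply: Rint_bound => // t /hB; apply: le_trans; [exact: Re_le_normc|exact: Im_le_normc].
Qed.

Lemma Rint_split a b c (h : R -> R) : a <= b -> b <= c ->
  mu.-integrable `[a, c] (EFin \o h) ->
  \int[mu]_(t in `[a, c]) h t = \int[mu]_(t in `[a, b]) h t + \int[mu]_(t in `[b, c]) h t.
Proof.
move=> ab bc hi.
have := @Rintegral_itvB R h (BLeft a) (BRight c) b hi.
rewrite !bnd_simp => /(_ ab bc) E.
rewrite -[LHS](subrK (\int[mu]_(t in `[a, b]) h t)) E addrC; congr (_ + _).
apply: Rintegral_itv_obnd_cbnd.
apply: integrableS hi => //; apply: subset_itv; rewrite bnd_simp //.
Qed.

Lemma Cint_split a b c h : a <= b -> b <= c -> pconton a c h ->
  Cint a c h = Cint a b h + Cint b c h.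
Proof.
move=> ab bc /pconton_integrable[i1 i2]; rewrite /Cint /Cintegral.
by rewrite (Rint_split ab bc i1) (Rint_split ab bc i2).
Qed.

Lemma Rint_FTC a b (h F : R -> R) : a <= b ->
  (forall t, a <= t <= b -> {for t, continuous h}) ->
  (forall t, a <= t <= b -> is_derive t 1 F (h t)) ->
  \int[mu]_(t in `[a, b]) h t = F b - F a.
Proof.
rewrite le_eqVlt => /predU1P[<- _ _|ab hc hF].
  by rewrite set_itv1 Rintegral_set1 subrr.
have cF t : a <= t <= b -> {for t, continuous F}.
  by move=> /hF[d _]; apply: differentiable_continuous; exact/derivable1_diffP.
rewrite /Rintegral (@continuous_FTC2 R h F a b)//=.
- by apply: continuous_in_subspaceT => t /set_mem; rewrite /= in_itv /= => /hc.
- split.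
  + by move=> t; rewrite in_itv /= => /andP[/ltW ta /ltW tb]; have [] := hF t; rewrite ?ta.
  + by apply: cvg_at_right_filter; apply: cF; rewrite lexx ltW.
  + by apply: cvg_at_left_filter; apply: cF; rewrite lexx ltW.
- move=> t; rewrite in_itv /= => /andP[/ltW ta /ltW tb]; rewrite derive1E.
  by have [|_ ->] := hF t; rewrite ?ta.
Qed.

Lemma Cint_FTC a b h F : a <= b -> pconton a b h ->
  (forall t, a <= t <= b -> pderiv F t (h t)) -> Cint a b h = F b - F a.
Proof.
move=> ab hc hF; rewrite /Cint /Cintegral; apply: complex_eqP; rewrite ?ReD ?ReN ?ImD ?ImN /=.
  by apply: (@Rint_FTC a b (fun s => Re (h s)) (fun s => Re (F s))) => // t /[dup] /hc[c1 c2] /hF[].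
by apply: (@Rint_FTC a b (fun s => Im (h s)) (fun s => Im (F s))) => // t /[dup] /hc[c1 c2] /hF[].
Qed.

(** This explicit integral yields the Lipschitz bound on [expi], the orthogonality of the powers on
    a circle, and the zeros of the averaging factor [ufactor]. *)
Lemma Cint_expi (k : R) a b : a <= b -> k != 0 ->
  Cint a b (fun s => expi (k * s)) = (expi (k * b) - expi (k * a)) / (k%:C * 'i).
Proof.
move=> ab k0.
have ki : k%:C * 'i != 0 :> C.
  by rewrite -normc_eq0 normcM normc_real /normc /= expr0n /= add0r expr1n sqrtr1 mulr1 normr_eq0.
rewrite (@Cint_FTC _ _ _ (fun s => (k%:C * 'i)^-1 * expi (k * s))) //.
- by rewrite -mulrBr mulrC.
- by move=> t _; exact: pcont_expiM.
- move=> t _; apply: pderiv_eq (pderivM (pderiv_cst _ t) (pderiv_expi k t)) _.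
  by rewrite mul0r add0r mulrA mulVf ?mul1r.
Qed.
End Basics.

(** * Goursat's theorem on polar rectangles *)

Section Goursat.
Variable R : realType.
Local Notation C := R[i].
Local Notation Re := complex.Re.
Local Notation Im := complex.Im.

(** Epsilon-delta forms with real radii. The norm of [C^o] takes its values in [C] itself; [cvgcP]
    and [cdiffP] translate to and from the library notions. *)
Definition ccont (f : C -> C) z := forall e : R, 0 < e ->
  exists2 d : R, 0 < d & forall w, normc (w - z) < d -> normc (f w - f z) < e.

Definition cdiff (f : C -> C) z l := forall e : R, 0 < e ->
  exists2 d : R, 0 < d & forall w, normc (w - z) < d ->
    normc (f w - f z - l * (w - z)) <= e * normc (w - z).

Lemma cdiff_lip f z l : cdiff f z l -> exists2 d : R, 0 < d &
  forall w, normc (w - z) < d -> normc (f w - f z) <= (1 + normc l) * normc (w - z).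
Proof.
move=> /(_ 1 ltr01)[d d0 h]; exists d => // w /h{}h.
rewrite -(subrK (l * (w - z)) (f w - f z)) mulrDl -normcM.
by apply: le_trans (le_normcD _ _) _; rewrite lerD2r.
Qed.

Lemma cdiff_cont f z l : cdiff f z l -> ccont f z.
Proof.
move=> /cdiff_lip[d d0 h] e e0.
have k0 : 0 < 1 + normc l by rewrite ltr_pwDl// normc_ge0.
exists (Num.min d (e / (1 + normc l))); first by rewrite lt_min d0 divr_gt0.
move=> w; rewrite lt_min => /andP[/h wd we]; apply: le_lt_trans wd _.
by rewrite mulrC -ltr_pdivlMr.
Qed.

Lemma pcont_comp f (g : R -> C) t : ccont f (g t) -> pcont g t -> pcont (fun s => f (g s)) t.
Proof.
move=> cf /pcontP cg; apply/pcontP => e /cf[d d0 hd].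
by have [d' d'0 hd'] := cg _ d0; exists d' => // s /hd'/hd.
Qed.

(** The difference is ['i] times the integral of [expi] over the segment; the constant 2 is that of
    [Cint_bound]. *)
Lemma expi_lip (s t : R) : normc (expi s - expi t) <= 2 * `|s - t|.
Proof.
wlog st : s t / t <= s => [hw|].
  by have [/hw//|/ltW/hw] := leP t s; rewrite distcC distrC.
have i0 : 'i != 0 :> C by rewrite -normc_eq0 /normc /= expr0n/= add0r expr1n sqrtr1 oner_neq0.
have := @Cint_expi R 1 t s st (oner_neq0 _); rewrite !mul1r.
move/(congr1 (fun z => z * 'i)); rewrite divfK// => <-.
have -> : normc ((Cint t s (fun u : R => expi (1 * u))) * 'i) = normc (Cint t s (fun u : R => expi (1 * u))).
  by rewrite normcM {2}/normc /= expr0n/= add0r expr1n sqrtr1 mulr1.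
rewrite ger0_norm ?subr_ge0//.
have := @Cint_bound R t s (fun u => expi (1 * u)) 1 st; rewrite mulr1; apply.
  by move=> u _; exact: pcont_expiM.
by move=> u _; rewrite normc_expi.
Qed.

Lemma polar_dist (r s t u : R) : 0 <= s ->
  normc (r%:C * expi t - s%:C * expi u) <= `|r - s| + 2 * s * `|t - u|.
Proof.
move=> s0.
have -> : r%:C * expi t - s%:C * expi u = (r - s)%:C * expi t + s%:C * (expi t - expi u).
  by rewrite rmorphB /=; ring.
apply: le_trans (le_normcD _ _) _.
rewrite !normcM normc_expi mulr1 !normc_real (ger0_norm s0) lerD2l.
by rewrite -mulrA mulrCA ler_wpM2l// expi_lip.
Qed.

(** These are integrals of [f z dz]: [dz] is [expi t dr] on a ray and ['i * r * expi t dt] on an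
    arc. [rectint] runs counterclockwise around the sector with radii in [[a, b]] and angles in
    [[c, d]]. *)
Definition radint f (t a b : R) := Cint a b (fun r : R => f (r%:C * expi t) * expi t).
Definition arcint f (r c d : R) :=
  Cint c d (fun t : R => f (r%:C * expi t) * ('i * (r%:C * expi t))).
Definition rectint f a b c d :=
  radint f c a b + arcint f b c d - radint f d a b - arcint f a c d.

Definition on_sector (P : C -> Prop) (a b c d : R) :=
  forall r t, a <= r <= b -> c <= t <= d -> P (r%:C * expi t).

Lemma pcont_ray (t r : R) : pcont (fun s : R => s%:C * expi t) r.
Proof. apply: pcontM; [exact: pcont_id|exact: pcont_cst]. Qed.

Lemma pcont_arc (t r : R) : pcont (fun s : R => r%:C * expi s) t.
Proof. apply: pcontM; [exact: pcont_cst|exact: pcont_expi]. Qed.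

Lemma radint_cont f t r : ccont f (r%:C * expi t) ->
  pcont (fun r : R => f (r%:C * expi t) * expi t) r.
Proof.
move=> cf; apply: pcontM; last exact: pcont_cst.
by apply: (@pcont_comp f (fun s : R => s%:C * expi t)) => //; exact: pcont_ray.
Qed.

Lemma arcint_cont f t r : ccont f (r%:C * expi t) ->
  pcont (fun t : R => f (r%:C * expi t) * ('i * (r%:C * expi t))) t.
Proof.
move=> cf; apply: pcontM.
  by apply: (@pcont_comp f (fun s : R => r%:C * expi s)) => //; exact: pcont_arc.
by apply: pcontM; [exact: pcont_cst|exact: pcont_arc].
Qed.

Lemma rectint_splitr f a m b c d : a <= m -> m <= b -> c <= d ->
  on_sector (ccont f) a b c d ->
  rectint f a b c d = rectint f a m c d + rectint f m b c d.
Proof.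
move=> am mb cd H; have E t : c <= t <= d -> radint f t a b = radint f t a m + radint f t m b.
  by move=> ht; apply: Cint_split => // r hr; apply: radint_cont; apply: H.
rewrite /rectint !E ?lexx ?cd//.
move: (radint f c a m) (radint f c m b) (radint f d a m) (radint f d m b).
by move: (arcint f a c d) (arcint f m c d) (arcint f b c d) => *; ring.
Qed.

Lemma rectint_splitt f a b c m d : a <= b -> c <= m -> m <= d ->
  on_sector (ccont f) a b c d ->
  rectint f a b c d = rectint f a b c m + rectint f a b m d.
Proof.
move=> ab cm md H; have E r : a <= r <= b -> arcint f r c d = arcint f r c m + arcint f r m d.
  by move=> hr; apply: Cint_split => // t ht; apply: arcint_cont; apply: H.
rewrite /rectint !E ?lexx ?ab//.
move: (radint f c a b) (radint f m a b) (radint f d a b).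
by move: (arcint f a c m) (arcint f a m d) (arcint f b c m) (arcint f b m d) => *; ring.
Qed.

(** The length estimate: two rays of length [b - a], two arcs of length at most [b * (d - c)], and
    the factor 2 of [Cint_bound]. *)
Lemma rectint_bound f a b c d B : 0 <= a -> a <= b -> c <= d ->
  on_sector (ccont f) a b c d -> on_sector (fun z => normc (f z) <= B) a b c d ->
  normc (rectint f a b c d) <= 4 * B * ((b - a) + b * (d - c)).
Proof.
move=> a0 ab cd H hB.
have B0 : 0 <= B by apply: le_trans (normc_ge0 _) (hB a c _ _); rewrite ?lexx ?ab ?cd.
have rb t : c <= t <= d -> normc (radint f t a b) <= 2 * B * (b - a).
  move=> ht; apply: Cint_bound => // r hr; first by apply: radint_cont; exact: H.
  by rewrite normcM normc_expi mulr1; exact: hB.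
have ib : normc ('i : C) = 1 by rewrite /normc /= expr0n/= add0r expr1n sqrtr1.
have ra r : a <= r <= b -> normc (arcint f r c d) <= 2 * (B * b) * (d - c).
  move=> /andP[ar rb']; apply: Cint_bound => // t ht; first by apply: arcint_cont; apply: H; rewrite ?ar.
  rewrite !normcM normc_expi ib mulr1 mul1r normc_real ger0_norm ?(le_trans a0)//.
  apply: ler_pM => //; rewrite ?normc_ge0 ?(le_trans a0)//.
  by apply: hB; rewrite ?ar.
have h1 : normc (radint f c a b) <= 2 * B * (b - a) by apply: rb; rewrite lexx.
have h2 : normc (radint f d a b) <= 2 * B * (b - a) by apply: rb; rewrite lexx cd.
have h3 : normc (arcint f b c d) <= 2 * (B * b) * (d - c) by apply: ra; rewrite lexx ab.
have h4 : normc (arcint f a c d) <= 2 * (B * b) * (d - c) by apply: ra; rewrite lexx ab.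
rewrite /rectint; apply: le_trans (le_normcB _ _) _.
apply: le_trans (lerD (le_trans (le_normcB _ _) (lerD (le_normcD _ _) (lexx _))) (lexx _)) _.
move: (normc _) (normc _) (normc _) (normc _) h1 h2 h3 h4 => x1 x2 x3 x4; lra.
Qed.

Lemma rectintB f g a b c d : a <= b -> c <= d ->
  on_sector (ccont f) a b c d -> on_sector (ccont g) a b c d ->
  rectint (fun z => f z - g z) a b c d = rectint f a b c d - rectint g a b c d.
Proof.
move=> ab cd hf hg.
have rE t : c <= t <= d -> radint (fun z => f z - g z) t a b = radint f t a b - radint g t a b.
  move=> ht; rewrite /radint -CintB.
  - by apply: eq_Cint => r _; rewrite mulrBl.
  - by move=> r hr; apply: radint_cont; exact: hf.
  - by move=> r hr; apply: radint_cont; exact: hg.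
have aE r : a <= r <= b -> arcint (fun z => f z - g z) r c d = arcint f r c d - arcint g r c d.
  move=> hr; rewrite /arcint -CintB.
  - by apply: eq_Cint => t _; rewrite mulrBl.
  - by move=> t ht; apply: arcint_cont; exact: hf.
  - by move=> t ht; apply: arcint_cont; exact: hg.
rewrite /rectint !rE ?lexx ?cd// !aE ?lexx ?ab//.
move: (radint _ _ _ _) (radint _ _ _ _) (radint _ _ _ _) (radint _ _ _ _).
by move: (arcint _ _ _ _) (arcint _ _ _ _) (arcint _ _ _ _) (arcint _ _ _ _) => *; ring.
Qed.

(** An affine function has the primitive [G], whose increments along the four sides cancel. In
    Goursat's argument this disposes of the first-order part of [f]. *)
Lemma rectint_affine (u v : C) a b c d : a <= b -> c <= d ->
  rectint (fun z => u + v * z) a b c d = 0.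
Proof.
move=> ab cd.
pose G (z : C) := u * z + v / 2 * z ^+ 2.
have cc z : ccont (fun z => u + v * z) z.
  move=> e e0; have v0 : 0 < 1 + normc v by rewrite ltr_pwDl// normc_ge0.
  exists (e / (1 + normc v)); first by rewrite divr_gt0.
  move=> w hw; have -> : u + v * w - (u + v * z) = v * (w - z) by ring.
  rewrite normcM; apply: le_lt_trans (_ : (1 + normc v) * normc (w - z) < e).
    by rewrite ler_wpM2r ?normc_ge0// lerDr.
  by rewrite mulrC -ltr_pdivlMr.
have dG (g : R -> C) t dg : pderiv g t dg -> pderiv (fun s => G (g s)) t ((u + v * g t) * dg).
  move=> hg.
  apply: pderiv_eq (pderivD (pderivM (pderiv_cst u t) hg) (pderivM (pderiv_cst (v / 2) t) (pderivX 1 hg))) _.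
  by rewrite expr1; field.
have rE t : radint (fun z => u + v * z) t a b = G (b%:C * expi t) - G (a%:C * expi t).
  rewrite /radint (@Cint_FTC _ _ _ _ (fun r : R => G (r%:C * expi t)))//.
    by move=> r _; exact: (radint_cont (cc _)).
  move=> r _; apply: dG.
  apply: pderiv_eq (pderivM (pderiv_id r) (pderiv_cst _ _)) _.
  by rewrite mulr0 addr0 mul1r.
have aE r : arcint (fun z => u + v * z) r c d = G (r%:C * expi d) - G (r%:C * expi c).
  rewrite /arcint (@Cint_FTC _ _ _ _ (fun t : R => G (r%:C * expi t)))//.
    by move=> t _; exact: (arcint_cont (cc _)).
  move=> t _; apply: dG.
  have := pderiv_expi 1 t; rewrite mul1r.
  under [fun s => _]eq_fun do rewrite mul1r.
  move=> h; apply: pderiv_eq (pderivM (pderiv_cst _ _) h) _.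
  by rewrite mul0r add0r mul1r; ring.
by rewrite /rectint !rE !aE; ring.
Qed.

Lemma pow2_small (x e : R) : 0 < e -> exists N, forall n, (N <= n)%N -> x / 2 ^+ n < e.
Proof.
move=> e0; exists (Num.Def.archi_bound (x / e)) => n hn.
rewrite ltr_pdivrMr ?exprn_gt0// mulrC -ltr_pdivrMr//.
have [x0|x0] := leP (x / e) 0; first by rewrite (le_lt_trans x0)// exprn_gt0.
apply: lt_le_trans (archi_boundP (ltW x0)) _.
apply: le_trans (_ : n%:R <= _); first by rewrite ler_nat.
by rewrite -natrX ler_nat ltnW// ltn_expl.
Qed.

(** Goursat's nested rectangles, detached from complex analysis. If [J] were positive on the whole
    box, one could choose again and again a quarter carrying at least a fourth of the previous
    value; the chosen boxes shrink to a point [(p, q)], where the lower bound [J 0 / 4 ^+ n]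
    contradicts the local upper bound [e / 4 ^+ n]. *)
Lemma bisection (J : nat -> R -> R -> R) (W H a0 c0 : R) : 0 <= W -> 0 <= H ->
  (forall n a c, a0 <= a -> a + W / 2 ^+ n <= a0 + W -> c0 <= c -> c + H / 2 ^+ n <= c0 + H ->
     J n a c <= J n.+1 a c + J n.+1 (a + W / 2 ^+ n.+1) c + J n.+1 a (c + H / 2 ^+ n.+1) +
                J n.+1 (a + W / 2 ^+ n.+1) (c + H / 2 ^+ n.+1)) ->
  (forall p q e, a0 <= p <= a0 + W -> c0 <= q <= c0 + H -> 0 < e ->
     exists n, forall a c, a0 <= a -> a + W / 2 ^+ n <= a0 + W -> c0 <= c -> c + H / 2 ^+ n <= c0 + H ->
        a <= p <= a + W / 2 ^+ n -> c <= q <= c + H / 2 ^+ n -> J n a c <= e / 4 ^+ n) ->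
  J 0%N a0 c0 <= 0.
Proof.
move=> W0 H0 Hs Hl; rewrite leNgt; apply/negP => J0.
(* Selects a quarter that carries at least a fourth of [J]. The last branch is untested: by
   subadditivity the four quarters cannot all fail. *)
pose st n (ac : R * R) : R * R :=
  let a := ac.1 in let c := ac.2 in
  let a' := a + W / 2 ^+ n.+1 in let c' := c + H / 2 ^+ n.+1 in
  if J n a c <= 4 * J n.+1 a c then (a, c) else
  if J n a c <= 4 * J n.+1 a' c then (a', c) else
  if J n a c <= 4 * J n.+1 a c' then (a, c') else (a', c').
pose fix s n := if n is k.+1 then st k (s k) else (a0, c0).
have Wn n : 0 <= W / 2 ^+ n by rewrite divr_ge0// exprn_ge0.
have Hn n : 0 <= H / 2 ^+ n by rewrite divr_ge0// exprn_ge0.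
have half (x : R) n : x / 2 ^+ n = x / 2 ^+ n.+1 + x / 2 ^+ n.+1.
  by rewrite exprS; field; rewrite expf_neq0// pnatr_eq0.
have sE n : s n.+1 = st n (s n) by [].
have stP n : [/\ (s n).1 <= (s n.+1).1, (s n.+1).1 + W / 2 ^+ n.+1 <= (s n).1 + W / 2 ^+ n,
    (s n).2 <= (s n.+1).2 & (s n.+1).2 + H / 2 ^+ n.+1 <= (s n).2 + H / 2 ^+ n].
  rewrite sE (half W n) (half H n) /st.
  have := Wn n.+1; have := Hn n.+1; move: (W / _) (H / _) => w h h0 w0.
  by do 3?case: ifP => _ /=; split; lra.
have mono m n : (m <= n)%N -> [/\ (s m).1 <= (s n).1, (s n).1 + W / 2 ^+ n <= (s m).1 + W / 2 ^+ m,
    (s m).2 <= (s n).2 & (s n).2 + H / 2 ^+ n <= (s m).2 + H / 2 ^+ m].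
  move=> /subnK <-; elim: (n - m)%N => [|k [i1 i2 i3 i4]]; first by split.
  rewrite addSn; have [j1 j2 j3 j4] := stP (k + m)%N.
  split; [exact: le_trans j1|exact: le_trans j2 _|exact: le_trans j3|exact: le_trans j4 _].
have in0 n : [/\ a0 <= (s n).1, (s n).1 + W / 2 ^+ n <= a0 + W, c0 <= (s n).2 & (s n).2 + H / 2 ^+ n <= c0 + H].
  by have := mono 0%N n (leq0n n); rewrite /= expr0 !divr1.
have Jn n : J 0%N a0 c0 <= 4 ^+ n * J n (s n).1 (s n).2.
  elim: n => [|n IH]; first by rewrite expr0 mul1r.
  apply: le_trans IH _; rewrite exprSr -mulrA ler_wpM2l ?exprn_ge0//.
  have [i1 i2 i3 i4] := in0 n; have := Hs n _ _ i1 i2 i3 i4.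
  rewrite sE /st; case: ifP => //= h1; case: ifP => //= h2; case: ifP => //= h3.
  by move/negbT : h1; move/negbT : h2; move/negbT : h3; rewrite -!ltNge; lra.
(* The lower corners increase and the upper corners decrease, so these suprema belong to every
   chosen box. *)
pose p := sup (range (fun n => (s n).1)); pose q := sup (range (fun n => (s n).2)).
have sp1 n : (s n).1 <= p <= (s n).1 + W / 2 ^+ n.
  apply/andP; split.
    apply: ub_le_sup; last by exists n.
    by exists (a0 + W) => _ [m _ <-]; have [_ h _ _] := in0 m; apply: le_trans h; rewrite lerDl.
  apply: ge_sup; first by exists (s 0%N).1, 0%N.
  move=> _ [m _ <-]; have [/mono[h1 h2 _ _]|/ltnW/mono[h1 h2 _ _]] := leqP m n.
    by apply: le_trans h1 _; rewrite lerDl.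
  by apply: le_trans h2; rewrite lerDl.
have sp2 n : (s n).2 <= q <= (s n).2 + H / 2 ^+ n.
  apply/andP; split.
    apply: ub_le_sup; last by exists n.
    by exists (c0 + H) => _ [m _ <-]; have [_ _ _ h] := in0 m; apply: le_trans h; rewrite lerDl.
  apply: ge_sup; first by exists (s 0%N).2, 0%N.
  move=> _ [m _ <-]; have [/mono[_ _ h1 h2]|/ltnW/mono[_ _ h1 h2]] := leqP m n.
    by apply: le_trans h1 _; rewrite lerDl.
  by apply: le_trans h2; rewrite lerDl.
have := sp1 0%N; have := sp2 0%N; rewrite expr0 !divr1 => hq hp.
have [n hn] := Hl p q (J 0%N a0 c0 / 2) hp hq (divr_gt0 J0 (ltr0n _ 2)).
have [i1 i2 i3 i4] := in0 n.
have := hn _ _ i1 i2 i3 i4 (sp1 n) (sp2 n).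
rewrite ler_pdivlMr ?exprn_gt0// mulrC => /(le_trans (Jn n)).
by apply/negP; rewrite -ltNge; lra.
Qed.

Lemma goursat f a b c d : 0 <= a -> a <= b -> c <= d ->
  on_sector (fun z => exists l, cdiff f z l) a b c d -> rectint f a b c d = 0.
Proof.
move=> a0 ab cd H.
have cH : on_sector (ccont f) a b c d by move=> r t hr ht; have [l /cdiff_cont] := H r t hr ht.
have sub a' b' c' d' : a <= a' -> b' <= b -> c <= c' -> d' <= d -> on_sector (ccont f) a' b' c' d'.
  move=> h1 h2 h3 h4 r t /andP[r1 r2] /andP[t1 t2]; apply: cH.
    by rewrite (le_trans h1)//= (le_trans r2).
  by rewrite (le_trans h3)//= (le_trans t2).
pose W := b - a; pose L := d - c.
pose J n a' c' := normc (rectint f a' (a' + W / 2 ^+ n) c' (c' + L / 2 ^+ n)).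
have W0 : 0 <= W by rewrite subr_ge0.
have L0 : 0 <= L by rewrite subr_ge0.
have aW : a + W = b by rewrite /W; ring.
have cL : c + L = d by rewrite /L; ring.
have Wn n : 0 <= W / 2 ^+ n by rewrite divr_ge0// exprn_ge0.
have Ln n : 0 <= L / 2 ^+ n by rewrite divr_ge0// exprn_ge0.
have half (x : R) n : x / 2 ^+ n = x / 2 ^+ n.+1 + x / 2 ^+ n.+1.
  by rewrite exprS; field; rewrite expf_neq0// pnatr_eq0.
suff J0 : J 0%N a c <= 0.
  by apply: eq0_normc; apply/eqP; rewrite eq_le normc_ge0 andbT; move: J0; rewrite /J expr0 !divr1 aW cL.
apply: (@bisection J W L a c) => //; rewrite ?aW ?cL.
- move=> n a' c' h1 h2 h3 h4; rewrite /J.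
  have := Wn n.+1; have := Ln n.+1; move: h2 h4; rewrite (half W n) (half L n) !addrA.
  move: (W / _) (L / _) => w l h2 h4 l0 w0.
  rewrite (@rectint_splitr f a' (a' + w) (a' + w + w)); [|lra|lra|lra|by apply: sub; lra].
  rewrite (@rectint_splitt f a' (a' + w) c' (c' + l)); [|lra|lra|lra|by apply: sub; lra].
  rewrite (@rectint_splitt f (a' + w) (a' + w + w) c' (c' + l)); [|lra|lra|lra|by apply: sub; lra].
  apply: le_trans (le_normcD _ _) _.
  apply: le_trans (lerD (le_normcD _ _) (le_normcD _ _)) _.
  have swap (n1 n2 n3 n4 : R) : n1 + n2 + (n3 + n4) <= n1 + n3 + n2 + n4 by rewrite addrA lerD2r addrAC.
  exact: swap.
- move=> p q e hp hq e0.
  have [l hl] := H p q hp hq.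
  (* At level [n] two points of a box are at distance at most [2 * K / 2 ^+ n], and width plus outer
     arc is at most [K / 2 ^+ n]. The length estimate thus gives [8 * K ^+ 2 / 4 ^+ n] times the
     error rate, which is therefore taken to be [e / (8 * K ^+ 2 + 1)]; the 1 keeps the denominator
     positive. *)
  pose K := W + b * L.
  have b0 : 0 <= b by apply: le_trans ab.
  have K0 : 0 <= K by rewrite addr_ge0// mulr_ge0.
  have K1 : 0 < 8 * K ^+ 2 + 1 by rewrite ltr_wpDl// mulr_ge0// exprn_ge0.
  have [del del0 hdel] := hl (e / (8 * K ^+ 2 + 1)) (divr_gt0 e0 K1).
  have [N hN] := pow2_small (2 * K) del0.
  exists N => a' c' h1 h2 h3 h4 hp' hq'; rewrite /J.
  have p0 : 0 <= p by case/andP: hp => ap _; apply: le_trans ap.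
  have pb : p <= b by case/andP: hp.
  (* The first-order expansion of [f] at the limit point integrates to 0, so [f] may be replaced by
     the remainder [f - A]. *)
  pose A z := (f (p%:C * expi q) - l * (p%:C * expi q)) + l * z.
  have cA z : ccont A z.
    apply: (@cdiff_cont _ _ l) => e' e'0; exists 1 => // w _.
    rewrite (_ : A w - A z - l * (w - z) = 0) ?normc_0 ?mulr_ge0 ?normc_ge0//; first exact: ltW.
    by rewrite /A; ring.
  set b' := a' + W / 2 ^+ N; set d' := c' + L / 2 ^+ N.
  have ab' : a' <= b' by rewrite lerDl.
  have cd' : c' <= d' by rewrite lerDl.
  have cf' := sub _ _ _ _ h1 h2 h3 h4.
  have -> : rectint f a' b' c' d' = rectint (fun z => f z - A z) a' b' c' d'.
    by rewrite rectintB// rectint_affine// subr0.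
  have dist r t : a' <= r <= b' -> c' <= t <= d' ->
      normc (r%:C * expi t - p%:C * expi q) <= 2 * K / 2 ^+ N.
    move=> /andP[r1 r2] /andP[t1 t2]; apply: le_trans (polar_dist _ _ _ p0) _.
    case/andP: hp' => p1 p2; case/andP: hq' => q1 q2.
    have rp : `|r - p| <= W / 2 ^+ N by rewrite ler_distl; apply/andP; split; [rewrite lerBlDr (le_trans p2)// lerD2r|rewrite (le_trans r2)// lerD2r].
    have tq : `|t - q| <= L / 2 ^+ N by rewrite ler_distl; apply/andP; split; [rewrite lerBlDr (le_trans q2)// lerD2r|rewrite (le_trans t2)// lerD2r].
    have : 2 * p * `|t - q| <= 2 * b * (L / 2 ^+ N) by apply: ler_pM => //; rewrite ?mulr_ge0// ler_wpM2l.
    have -> : 2 * K / 2 ^+ N = 2 * (W / 2 ^+ N) + 2 * b * (L / 2 ^+ N).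
      by rewrite /K; field; rewrite expf_neq0// pnatr_eq0.
    by have := Wn N; lra.
  apply: le_trans (@rectint_bound _ a' b' c' d' (e / (8 * K ^+ 2 + 1) * (2 * K / 2 ^+ N)) _ _ _ _ _) _ => //.
  + exact: le_trans h1.
  + move=> r t hr ht; have := cf' r t hr ht; have := cA (r%:C * expi t).
    move=> cA' cf'' e' e'0; have e'2 : 0 < e' / 2 by rewrite divr_gt0.
    have [d1 d10 k1] := cA' _ e'2; have [d2 d20 k2] := cf'' _ e'2.
    exists (Num.min d1 d2); first by rewrite lt_min d10.
    move=> w; rewrite lt_min => /andP[/k1 w1 /k2 w2].
    have -> : f w - A w - (f (r%:C * expi t) - A (r%:C * expi t)) =
      (f w - f (r%:C * expi t)) - (A w - A (r%:C * expi t)) by ring.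
    by apply: le_lt_trans (le_normcB _ _) _; rewrite [e']splitr; apply: ltrD.
  + move=> r t hr ht.
    have dd := dist r t hr ht.
    have := hdel (r%:C * expi t) (le_lt_trans dd (hN N (leqnn N))).
    set z := r%:C * expi t; set z0 := p%:C * expi q.
    have -> : f z - f z0 - l * (z - z0) = f z - A z by rewrite /A /z0; ring.
    move=> /le_trans; apply; apply: ler_wpM2l => //.
    by rewrite ltW// divr_gt0.
  + have hb : b' - a' + b' * (d' - c') <= K / 2 ^+ N.
      have -> : b' - a' = W / 2 ^+ N by rewrite /b'; ring.
      have -> : d' - c' = L / 2 ^+ N by rewrite /d'; ring.
      have -> : K / 2 ^+ N = W / 2 ^+ N + b * (L / 2 ^+ N) by rewrite /K; ring.
      by rewrite lerD2l ler_wpM2r.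
    have h0 : 0 <= 4 * (e / (8 * K ^+ 2 + 1) * (2 * K / 2 ^+ N)).
      by rewrite !mulr_ge0// ?ltW ?invr_gt0 ?exprn_gt0.
    apply: le_trans (ler_wpM2l h0 hb) _.
    have -> : (4 : R) ^+ N = 2 ^+ N * 2 ^+ N by rewrite -exprMn -natrM.
    have -> : 4 * (e / (8 * K ^+ 2 + 1) * (2 * K / 2 ^+ N)) * (K / 2 ^+ N) =
      (e / (2 ^+ N * 2 ^+ N)) * (8 * K ^+ 2 / (8 * K ^+ 2 + 1)).
      by field; rewrite expf_neq0 ?pnatr_eq0//= gt_eqF.
    rewrite ler_piMr ?divr_ge0 ?mulr_ge0 ?exprn_ge0//; first exact: ltW.
    by rewrite ler_pdivrMr// mul1r lerDl.
Qed.
End Goursat.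

(** * Rules for complex derivatives, and Goursat's theorem with an exceptional point *)

Section Holomorphic.
Variable R : realType.
Local Notation C := R[i].
Local Notation Re := complex.Re.
Local Notation Im := complex.Im.
Implicit Types (f g : C -> C) (z w l m : C).

Lemma complex_gt0P (e : C) : 0 < e -> exists2 x : R, 0 < x & e = x%:C.
Proof.
case: e => x y; rewrite ltcE /= => /andP[/eqP y0 x0]; exists x => //.
by rewrite y0.
Qed.

Lemma normC_E z : `|z| = (normc z)%:C.
Proof. by case: z. Qed.

Lemma cvgcP f z l : (f : C^o -> C^o) @ (z : C^o) --> (l : C^o) <->
  forall e : R, 0 < e -> exists2 d : R, 0 < d & forall w, normc (w - z) < d -> normc (f w - l) < e.
Proof.
split=> [/cvgrPdist_lt H e e0|H].
  have e0' : 0 < e%:C :> C by rewrite ltcR.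
  have /nbhs_ballP[d /= /complex_gt0P[x x0 ->] hd] := H _ e0'.
  exists x => // w wx.
  have bw : ball (z : C^o) x%:C w by rewrite -ball_normE /= normC_E ltcR distcC.
  by have := hd w bw; rewrite /= normC_E ltcR distcC.
apply: (iffRL (@cvgrPdist_lt _ C^o C^o (nbhs (z : C^o)) _ f l)) => _ /complex_gt0P[e e0 ->].
have [d d0 hd] := H e e0; apply/nbhs_ballP; exists d%:C; first by rewrite /= ltcR.
move=> w; rewrite -ball_normE /= !normC_E !ltcR distcC => /hd; by rewrite distcC.
Qed.

Lemma ccontP f z : ccont f z <-> (f : C^o -> C^o) @ (z : C^o) --> (f z : C^o).
Proof. by split=> [h|/cvgcP//]; apply/cvgcP. Qed.

Lemma ccontD f g z : ccont f z -> ccont g z -> ccont (fun w => f w + g w) z.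
Proof. by move=> /ccontP cf /ccontP cg; apply/ccontP; exact: (cvgD cf cg). Qed.

Lemma ccontM f g z : ccont f z -> ccont g z -> ccont (fun w => f w * g w) z.
Proof. by move=> /ccontP cf /ccontP cg; apply/ccontP; exact: (cvgM cf cg). Qed.

Lemma ccontV f z : f z != 0 -> ccont f z -> ccont (fun w => (f w)^-1) z.
Proof. by move=> f0 /ccontP cf; apply/ccontP; exact: (cvgV f0 cf). Qed.

Lemma ccont_cst (c : C) z : ccont (fun=> c) z.
Proof. by move=> e e0; exists 1 => // w _; rewrite subrr normc_0. Qed.

Lemma ccont_id z : ccont id z.
Proof. by move=> e e0; exists e. Qed.

Lemma ccont_comp f g z : ccont f z -> ccont g (f z) -> ccont (fun w => g (f w)) z.
Proof.
by move=> cf cg e /cg[d d0 hd]; have [d' d'0 hd'] := cf _ d0; exists d' => // w /hd'/hd.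
Qed.

Lemma ccontN f z : ccont f z -> ccont (fun w => - f w) z.
Proof. by move=> /ccontP cf; apply/ccontP; exact: (cvgN cf). Qed.

Lemma ccontB f g z : ccont f z -> ccont g z -> ccont (fun w => f w - g w) z.
Proof. by move=> cf cg; apply: ccontD => //; exact: ccontN. Qed.

(** With a slope function continuous at [z] in place of a remainder estimate, the rules for
    products, inverses and compositions reduce to the continuity of explicit slopes. *)
Lemma caratheodory f z l : cdiff f z l <->
  exists phi, [/\ forall w, f w - f z = phi w * (w - z), ccont phi z & phi z = l].
Proof.
split=> [H|[phi [E cp <-]] e e0].
  exists (fun w => if w == z then l else (f w - f z) / (w - z)).
  rewrite eqxx; split=> //.
    move=> w; case: eqVneq => [->|wz]; first by rewrite !subrr mulr0.
    by rewrite divfK// subr_eq0.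
  move=> e e0; have e20 : 0 < e / 2 by rewrite divr_gt0.
  have [d d0 hd] := H _ e20; exists d => // w wd; rewrite eqxx.
  case: eqVneq => [_|wz]; first by rewrite subrr normc_0.
  have wz0 : 0 < normc (w - z) by rewrite normc_gt0 subr_eq0.
  rewrite -(ltr_pM2r wz0) -normcM mulrBl divfK ?subr_eq0//.
  by apply: le_lt_trans (hd w wd) _; rewrite ltr_pM2r// gtr_pMr// invf_lt1 ?ltr1n.
have [d d0 hd] := cp _ e0; exists d => // w /hd wd.
by rewrite E -mulrBl normcM ler_wpM2r ?normc_ge0// ltW.
Qed.

Lemma cdiff_cst (c : C) z : cdiff (fun=> c) z 0.
Proof. by apply/caratheodory; exists (fun=> 0); split=> // [w|]; [rewrite subrr mul0r|exact: ccont_cst]. Qed.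

Lemma cdiff_id z : cdiff id z 1.
Proof. by apply/caratheodory; exists (fun=> 1); split=> // [w|]; [rewrite mul1r|exact: ccont_cst]. Qed.

Lemma cdiffD f g z l m : cdiff f z l -> cdiff g z m -> cdiff (fun w => f w + g w) z (l + m).
Proof.
move=> /caratheodory[p [Ep cp <-]] /caratheodory[q [Eq cq <-]]; apply/caratheodory.
exists (fun w => p w + q w); split=> //; last exact: ccontD.
by move=> w; rewrite mulrDl -Ep -Eq; ring.
Qed.

Lemma cdiffM f g z l m : cdiff f z l -> cdiff g z m ->
  cdiff (fun w => f w * g w) z (l * g z + f z * m).
Proof.
move=> hf hg; have cg := cdiff_cont hg; move: hf hg.
move=> /caratheodory[p [Ep cp <-]] /caratheodory[q [Eq cq <-]]; apply/caratheodory.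
exists (fun w => p w * g w + f z * q w); split=> //.
  by move=> w; rewrite mulrDl mulrAC -Ep -mulrA -Eq; ring.
by apply: ccontD; apply: ccontM => //; exact: ccont_cst.
Qed.

Lemma cdiffV f z l : f z != 0 -> cdiff f z l -> cdiff (fun w => (f w)^-1) z (- l / f z ^+ 2).
Proof.
move=> f0 hf; have cf := cdiff_cont hf; move: hf => /caratheodory[p [Ep cp <-]]; apply/caratheodory.
(* The slope identity must hold for every [w], also where [f w = 0] and the inverse is 0 by
   convention. Such [w] stay away from [z], so the special value does not affect continuity at
   [z]. *)
exists (fun w => if f w == 0 then (f z)^-1 * - (w - z)^-1 else - p w / (f w * f z)); split.
- move=> w; case: eqVneq => [fw0|fw0].
    have [wz|wz] := eqVneq w z; first by move: f0; rewrite -wz fw0 eqxx.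
    by rewrite fw0 invr0 sub0r -mulrA mulNr mulVf ?subr_eq0// mulrN1.
  have -> : - p w / (f w * f z) * (w - z) = - (p w * (w - z)) / (f w * f z) by ring.
  by rewrite -Ep; field; rewrite fw0 f0.
- have f0' : 0 < normc (f z) by rewrite normc_gt0.
  have : ccont (fun w => - p w / (f w * f z)) z.
    apply: ccontM; first exact: ccontN.
    by apply: ccontV; [rewrite mulf_neq0|apply: ccontM => //; exact: ccont_cst].
  move=> cc e /cc[d d0 hd]; have [d' d'0 hd'] := cf _ f0'.
  exists (Num.min d d'); first by rewrite lt_min d0.
  move=> w; rewrite lt_min => /andP[/hd h1 /hd' h2].
  rewrite (negPf f0) ifN//; apply/eqP => fw0; move: h2.
  by rewrite fw0 sub0r normcN ltxx.
- by rewrite (negPf f0) expr2.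
Qed.

Lemma cdiff_comp f g z l m : cdiff f z l -> cdiff g (f z) m ->
  cdiff (fun w => g (f w)) z (m * l).
Proof.
move=> hf; have cf := cdiff_cont hf; move: hf.
move=> /caratheodory[p [Ep cp <-]] /caratheodory[q [Eq cq <-]]; apply/caratheodory.
exists (fun w => q (f w) * p w); split=> //.
  by move=> w; rewrite Eq Ep mulrA.
by apply: ccontM => //; exact: ccont_comp.
Qed.

Lemma cdiff_eq f z l m : cdiff f z l -> l = m -> cdiff f z m.
Proof. by move=> h <-. Qed.

Lemma cdiffX f z l n : cdiff f z l ->
  cdiff (fun w => f w ^+ n.+1) z (n.+1%:R * f z ^+ n * l).
Proof.
move=> hf; elim: n => [|n IH].
  under [fun s => _]eq_fun do rewrite expr1.
  by rewrite expr0 !mul1r.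
under [fun s => _]eq_fun do rewrite exprS.
apply: cdiff_eq (cdiffM hf IH) _.
by rewrite -[n.+2%:R]natr1 exprS; ring.
Qed.

(** The link to the difference quotients behind [derivable] and [derive1], in which [analytic_on]
    and [PF_sum] are stated. *)
Lemma cdiffP f z l : cdiff f z l <->
  (fun h : C^o => h^-1 *: (((f : C^o -> C^o) \o shift (z : C^o)) (h *: (1 : C^o)) - (f z : C^o))) @
    ((0 : C^o)^') --> (l : C^o).
Proof.
split=> [H|/cvgrPdist_lt H].
  apply/cvgrPdist_le => _ /complex_gt0P[e e0 ->].
  have [d d0 hd] := H e e0.
  apply/nbhs_ballP; exists d%:C; first by rewrite /= ltcR.
  move=> h; rewrite -ball_normE /= !normC_E ltcR sub0r normcN => hd' h0.
  have h0' : 0 < normc h by rewrite normc_gt0.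
  rewrite lecR -(ler_pM2r h0') -normcM -normcN.
  have -> : - ((l - h^-1 *: (f (h *: (1 : C^o) + z) - f z)) * h) = f (h + z) - f z - l * (h + z - z).
    rewrite (_ : h *: (1 : C^o) = h); last exact: mulr1.
    by rewrite /GRing.scale /=; field.
  by have := hd (h + z); rewrite addrK; apply.
move=> e e0; have e0' : 0 < e%:C :> C by rewrite ltcR.
have := H _ e0'; rewrite /dnbhs.
move/nbhs_ballP => [_ /= /complex_gt0P[d d0 ->] hd].
exists d => // w wd.
have [->|wz] := eqVneq w z; first by rewrite !subrr mulr0 subrr normc_0 mulr0.
have h0' : 0 < normc (w - z) by rewrite normc_gt0 subr_eq0.
have := hd (w - z); rewrite -ball_normE /= !normC_E !ltcR sub0r normcN subr_eq0 => /(_ wd wz).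
have E : (l - (w - z)^-1 *: (f ((w - z) *: (1 : C^o) + z) - f z)) * (w - z) = - (f w - f z - l * (w - z)).
  rewrite (_ : (w - z) *: (1 : C^o) = w - z) ?subrK; last exact: mulr1.
  by rewrite /GRing.scale /=; field; rewrite subr_eq0.
by rewrite -(ltr_pM2r h0') -normcM E normcN => /ltW.
Qed.

Lemma cdiff_derivable f z l : cdiff f z l -> derivable (f : C^o -> C^o) z 1.
Proof. by move=> /cdiffP h; apply/cvg_ex; exists l. Qed.

Lemma cdiff_derive1 f z l : cdiff f z l -> derive1 (f : C^o -> C^o) z = l.
Proof.
move=> /cdiffP h; rewrite derive1E; apply: cvg_lim h => //; exact: norm_hausdorff.
Qed.

Lemma derivable_cdiff f z : derivable (f : C^o -> C^o) z 1 -> exists l, cdiff f z l.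
Proof. by move=> /cvg_ex[l h]; exists l; apply/cdiffP. Qed.

(** [1 - cos x] is twice the square of [sin (x / 2)], and the sine is positive between 0 and
    [pi]. *)
Lemma expi_eq1 (x : R) : expi x = 1 -> `|x| < 2 * pi -> x = 0.
Proof.
move=> /(congr1 (@complex.Re R)) /= c1 xb.
have pi0 := pi_gt0 R.
wlog x0 : x c1 xb / 0 <= x => [hw|].
  have [/hw->//|x0] := leP 0 x; apply/eqP; rewrite -oppr_eq0; apply/eqP; apply: hw.
  - by rewrite cosN.
  - by rewrite normrN.
  - by rewrite oppr_ge0 ltW.
apply/eqP; rewrite eq_le x0 andbT leNgt; apply/negP => x0'.
rewrite ger0_norm// in xb.
have := @sin_gt0_pi R (x / 2); rewrite divr_gt0//= ltr_pdivrMr// mulrC xb => /(_ isT) s0.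
move: c1; rewrite (_ : x = (x / 2) *+ 2); last by rewrite mulr2n -splitr.
rewrite cos_mulr2n cos2sin2 => c1.
have : sin (x / 2) ^+ 2 = 0 by move: c1; lra.
by move/eqP; rewrite sqrf_eq0 gt_eqF.
Qed.

Lemma polar_neq (r s t u : R) : 0 < r -> 0 < s -> `|t - u| < 2 * pi ->
  (r, t) <> (s, u) -> r%:C * expi t != s%:C * expi u.
Proof.
move=> r0 s0 tu neq; apply/eqP => E; apply: neq.
have rs : r = s.
  have := congr1 (@normc R) E.
  by rewrite !normcM !normc_expi !normc_real !mulr1 !gtr0_norm.
rewrite rs; congr (_, _); apply/eqP; rewrite -subr_eq0; apply/eqP; apply: expi_eq1 => //.
rewrite expiD expiN; apply: (mulIf (expi_neq0 u)); rewrite divfK ?expi_neq0// mul1r.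
apply: (@mulfI _ s%:C); last by rewrite -E rs.
by rewrite -normc_eq0 normc_real normr_eq0 gt_eqF.
Qed.

(** Cutting along the four sides of the inner rectangle leaves four pieces that avoid the
    exceptional point, and [goursat] annihilates each. *)
Lemma goursat_shrink f a b c d r1 r2 t1 t2 r0 t0 : 0 <= a -> a <= r1 -> r1 < r0 -> r0 < r2 -> r2 <= b ->
  c <= t1 -> t1 < t0 -> t0 < t2 -> t2 <= d -> on_sector (ccont f) a b c d ->
  (forall r t, a <= r <= b -> c <= t <= d -> (r, t) <> (r0, t0) ->
     exists l, cdiff f (r%:C * expi t) l) ->
  rectint f a b c d = rectint f r1 r2 t1 t2.
Proof.
move=> a0 ar1 r10 r02 r2b ct1 t10 t02 t2d cf hf.
have r12 := ltW (lt_trans r10 r02); have t12 := ltW (lt_trans t10 t02).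
have ar2 := le_trans ar1 r12; have r1b := le_trans r12 r2b.
have ct2 := le_trans ct1 t12; have t1d := le_trans t12 t2d.
have cd := le_trans ct1 t1d; have ab := le_trans ar1 r1b.
have sub a' b' c' d' : a <= a' -> b' <= b -> c <= c' -> d' <= d -> on_sector (ccont f) a' b' c' d'.
  move=> h1 h2 h3 h4 r t /andP[p1 p2] /andP[q1 q2]; apply: cf.
    by rewrite (le_trans h1)//= (le_trans p2).
  by rewrite (le_trans h3)//= (le_trans q2).
have sub' a' b' c' d' : a <= a' -> b' <= b -> c <= c' -> d' <= d ->
    (forall r t, a' <= r <= b' -> c' <= t <= d' -> (r, t) <> (r0, t0)) ->
    on_sector (fun z => exists l, cdiff f z l) a' b' c' d'.
  move=> h1 h2 h3 h4 hn r t hr ht; have /andP[p1 p2] := hr; have /andP[q1 q2] := ht.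
  apply: (hf _ _ _ _ (hn r t hr ht)).
    by rewrite (le_trans h1)//= (le_trans p2).
  by rewrite (le_trans h3)//= (le_trans q2).
rewrite (@rectint_splitr _ f a r1 b c d ar1 r1b cd cf).
rewrite (@goursat _ f a r1 c d a0 ar1 cd); last first.
  by apply: sub' => // r t /andP[_ p2] _ [rE _]; move: p2; rewrite rE leNgt r10.
rewrite add0r (@rectint_splitr _ f r1 r2 b c d r12 r2b cd); last exact: sub.
rewrite (@goursat _ f r2 b c d (le_trans a0 ar2) r2b cd); last first.
  by apply: sub' => // r t /andP[p1 _] _ [rE _]; move: p1; rewrite rE leNgt r02.
rewrite addr0 (@rectint_splitt _ f r1 r2 c t1 d r12 ct1 t1d); last exact: sub.
rewrite (@goursat _ f r1 r2 c t1 (le_trans a0 ar1) r12 ct1); last first.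
  by apply: sub' => // r t _ /andP[_ q2] [_ tE]; move: q2; rewrite tE leNgt t10.
rewrite add0r (@rectint_splitt _ f r1 r2 t1 t2 d r12 t12 t2d); last exact: sub.
rewrite (@goursat _ f r1 r2 t2 d (le_trans a0 ar1) r12 t2d) ?addr0//.
by apply: sub' => // r t _ /andP[q1 _] [_ tE]; move: q1; rewrite tE leNgt t02.
Qed.

(** Continuity bounds [f] near the exceptional point, and by [goursat_shrink] the integral equals
    that over an arbitrarily small rectangle around it. The intended function is the slope of a
    holomorphic function at a point, known there only to be continuous. *)
Lemma goursat_point f (a b c d r0 t0 : R) : 0 <= a -> a < r0 < b -> c < t0 < d ->
  on_sector (ccont f) a b c d ->
  (forall r t, a <= r <= b -> c <= t <= d -> (r, t) <> (r0, t0) ->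
     exists l, cdiff f (r%:C * expi t) l) ->
  rectint f a b c d = 0.
Proof.
move=> a0 /andP[ar rb] /andP[ct td] cf hf; apply: eq0_normc; apply/eqP.
rewrite eq_le normc_ge0 andbT; apply/ler_addgt0Pr => e e0; rewrite add0r.
set z0 := r0%:C * expi t0.
have r00 : 0 < r0 by apply: le_lt_trans ar.
have [d1 d10 hd1] := cf r0 t0 (introT andP (conj (ltW ar) (ltW rb))) (introT andP (conj (ltW ct) (ltW td))) 1 ltr01.
pose B := normc (f z0) + 1.
have B0 : 0 < B by rewrite ltr_wpDl ?normc_ge0.
pose m := Num.min (Num.min (r0 - a) (b - r0)) (Num.min (t0 - c) (d - t0)).
pose K := 8 * B * (1 + b).
have b0 : 0 < b by apply: lt_trans rb.
have K0 : 0 < K by rewrite !mulr_gt0// ltr_wpDl.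
(* Half the size of the small rectangle, in radius and in angle: it fits into the large one, stays
   within the distance [d1] on which [B] bounds [f], and makes the length estimate [x * K] at most
   [e]. *)
pose x := Num.min (Num.min m (d1 / (2 + 2 * r0))) (e / K) / 2.
have q0 : 0 < 2 + 2 * r0 by rewrite addr_gt0// mulr_gt0.
have x0 : 0 < x.
  by rewrite divr_gt0// !lt_min !subr_gt0 ar rb ct td divr_gt0// divr_gt0.
have : x < Num.min (Num.min m (d1 / (2 + 2 * r0))) (e / K).
  by rewrite gtr_pMr ?invf_lt1 ?ltr1n//; rewrite -(pmulr_lgt0 _ (_ : 0 < 2^-1)) ?invr_gt0.
rewrite !lt_min -!andbA => /and5P[xa xb xc xd /andP[xd1 xe]].
clearbody x.
have sub a' b' c' d' : a <= a' -> b' <= b -> c <= c' -> d' <= d -> on_sector (ccont f) a' b' c' d'.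
  move=> h1 h2 h3 h4 r t /andP[r1 r2] /andP[t1 t2]; apply: cf.
    by rewrite (le_trans h1)//= (le_trans r2).
  by rewrite (le_trans h3)//= (le_trans t2).
have ar' : a <= r0 - x by rewrite lerBrDr addrC -lerBrDr ltW.
have rb' : r0 + x <= b by rewrite addrC -lerBrDr ltW.
have ct' : c <= t0 - x by rewrite lerBrDr addrC -lerBrDr ltW.
have td' : t0 + x <= d by rewrite addrC -lerBrDr ltW.
have [y1 y2] : r0 - x < r0 /\ r0 < r0 + x by rewrite ltrBlDr ltrDl.
have [y3 y4] : t0 - x < t0 /\ t0 < t0 + x by rewrite ltrBlDr ltrDl.
have xx1 := ltW (lt_trans y1 y2); have xx2 := ltW (lt_trans y3 y4).
rewrite (goursat_shrink a0 ar' y1 y2 rb' ct' y3 y4 td' cf hf).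
apply: le_trans (@rectint_bound _ f _ _ _ _ B (le_trans a0 ar') xx1 xx2 (sub _ _ _ _ ar' rb' ct' td') _) _.
  move=> r t /andP[r1 r2] /andP[t1 t2].
  rewrite -(subrK (f z0) (f _)); apply: le_trans (le_normcD _ _) _.
  rewrite addrC lerD2l ltW//; apply: hd1; apply: le_lt_trans (polar_dist _ _ _ (ltW r00)) _.
  have h1 : `|r - r0| <= x by rewrite ler_distl r1 r2.
  have h2 : `|t - t0| <= x by rewrite ler_distl t1 t2.
  have : 2 * r0 * `|t - t0| <= 2 * r0 * x by rewrite ler_wpM2l// mulr_ge0// ltW.
  by move: xd1; rewrite ltr_pdivlMr// => xd1; nra.
have -> : r0 + x - (r0 - x) + (r0 + x) * (t0 + x - (t0 - x)) = 2 * x * (1 + (r0 + x)) by ring.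
apply: le_trans (_ : 4 * B * (2 * x * (1 + b)) <= _).
  apply: ler_wpM2l; rewrite ?mulr_ge0 ?(ltW B0)//; apply: ler_wpM2l; rewrite ?mulr_ge0 ?(ltW x0)// lerD2l; exact: rb'.
have -> : 4 * B * (2 * x * (1 + b)) = x * K by rewrite /K; ring.
by rewrite -ler_pdivlMr// ltW.
Qed.
End Holomorphic.

(** * Power and Laurent series with geometrically decaying coefficients *)

Section Series.
Variable R : realType.
Local Notation C := R[i].
Local Notation Re := complex.Re.
Local Notation Im := complex.Im.

Definition sconv (s : nat -> C) (l : C) := forall e : R, 0 < e ->
  exists N0, forall N, (N0 <= N)%N -> normc (s N - l) < e.

Lemma expn_le (a b : R) n : 0 <= a -> a <= b -> a ^+ n <= b ^+ n.
Proof. by move=> a0 ab; apply: lerXn2r => //; rewrite nnegrE// (le_trans a0). Qed.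

Lemma sconv_le s l B : sconv s l -> (forall N, normc (s N) <= B) -> normc l <= B.
Proof.
move=> H hB; apply/ler_addgt0Pr => e /H[N /(_ N (leqnn N)) h].
rewrite -(subrK (s N) l); apply: le_trans (le_normcD _ _) _.
by rewrite addrC distcC; apply: lerD => //; exact: ltW.
Qed.

Lemma sconvD s t l m : sconv s l -> sconv t m -> sconv (fun N => s N + t N) (l + m).
Proof.
move=> hs ht e e0; have e20 : 0 < e / 2 by rewrite divr_gt0.
have [N1 h1] := hs _ e20; have [N2 h2] := ht _ e20.
exists (maxn N1 N2) => N; rewrite geq_max => /andP[/h1 k1 /h2 k2].
have -> : s N + t N - (l + m) = (s N - l) + (t N - m) by ring.
by apply: le_lt_trans (le_normcD _ _) _; rewrite [e]splitr ltrD.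
Qed.

Lemma sconvZ (c : C) s l : sconv s l -> sconv (fun N => c * s N) (c * l).
Proof.
move=> hs e e0; have k0 : 0 < 1 + normc c by rewrite ltr_pwDl// normc_ge0.
have [N h] := hs _ (divr_gt0 e0 k0); exists N => n /h.
rewrite ltr_pdivlMr// -mulrBr normcM => h'; apply: le_lt_trans h'.
by rewrite mulrC ler_wpM2l ?normc_ge0// lerDr.
Qed.

Lemma sconvN s l : sconv s l -> sconv (fun N => - s N) (- l).
Proof. by move=> h e /h[N hN]; exists N => n /hN; rewrite -opprD normcN. Qed.

Lemma sconvB s t l m : sconv s l -> sconv t m -> sconv (fun N => s N - t N) (l - m).
Proof. by move=> h1 h2; apply: sconvD => //; exact: sconvN. Qed.

Lemma sconv_unique s l m : sconv s l -> sconv s m -> l = m.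
Proof.
move=> hl hm; have := sconvB hl hm => h.
apply/eqP; rewrite -subr_eq0 -normc_eq0 eq_le normc_ge0 andbT; apply/eqP.
apply/eqP; apply: sconv_le h _ => N; by rewrite subrr normc_0.
Qed.

Lemma eq_sconv s t l : (forall N, s N = t N) -> sconv s l -> sconv t l.
Proof. by move=> E h e /h[N hN]; exists N => n; rewrite -E; exact: hN. Qed.

Lemma sconv_shift s l k : sconv (fun N => s (N + k)%N) l -> sconv s l.
Proof.
move=> h e /h[N hN]; exists (N + k)%N => n kn.
have := hN (n - k)%N; rewrite subnK; last by apply: leq_trans kn; rewrite leq_addl.
by apply; rewrite leq_subRL ?(leq_trans _ kn) ?leq_addl// addnC.
Qed.

Lemma geo_small (K x e : R) : 0 <= x < 1 -> 0 < e ->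
  exists N0, forall N, (N0 <= N)%N -> K * x ^+ N < e.
Proof.
move=> /andP[x0 x1] e0.
have k0 : 0 < 1 + `|K| by rewrite ltr_pwDl.
have : `|x| < 1 by rewrite ger0_norm.
move=> /cvg_expr/cvgrPdist_lt/(_ _ (divr_gt0 e0 k0))[N _ hN].
exists N => n /hN /=; rewrite sub0r normrN ger0_norm ?exprn_ge0// ltr_pdivlMr// => h.
apply: le_lt_trans h; rewrite mulrC ler_wpM2l ?exprn_ge0//.
by rewrite (le_trans (ler_norm _))// lerDr.
Qed.

Lemma sconv_geo s l K x : 0 <= x < 1 -> (forall N, normc (s N - l) <= K * x ^+ N) -> sconv s l.
Proof.
move=> x01 h e e0; have [N0 hN] := geo_small K x01 e0; exists N0 => N /hN.
exact: le_lt_trans (h N).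
Qed.

Lemma geo_sum_le (x : R) n : 0 <= x < 1 -> \sum_(k < n) x ^+ k <= (1 - x)^-1.
Proof.
move=> /andP[x0 x1]; have x1' : 0 < 1 - x by rewrite subr_gt0.
rewrite -[leRHS]mul1r ler_pdivlMr//.
have -> : (\sum_(k < n) x ^+ k) * (1 - x) = 1 - x ^+ n.
  elim: n => [|n IH]; first by rewrite big_ord0 mul0r expr0 subrr.
  by rewrite big_ord_recr /= mulrDl IH exprS; ring.
by rewrite gerBl exprn_ge0.
Qed.

Lemma geo_tail (u : nat -> R) B x N m : 0 <= x < 1 -> 0 <= B -> (forall k, `|u k| <= B * x ^+ k) ->
  `|\sum_(k < N + m) u k - \sum_(k < N) u k| <= B * x ^+ N / (1 - x).
Proof.
move=> x01 B0 h; rewrite big_split_ord /= addrAC subrr add0r.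
apply: le_trans (ler_norm_sum _ _ _) _.
apply: le_trans (_ : \sum_(k < m) B * x ^+ N * x ^+ k <= _).
  by apply: ler_sum => k _; rewrite -mulrA -exprD h.
rewrite -mulr_sumr ler_wpM2l ?geo_sum_le// mulr_ge0// exprn_ge0//.
by case/andP: x01.
Qed.

Lemma geo_series (u : nat -> R) B x N : 0 <= x < 1 -> 0 <= B -> (forall k, `|u k| <= B * x ^+ k) ->
  `|\sum_(k < N) u k - limn (series u)| <= B * x ^+ N / (1 - x).
Proof.
move=> x01 B0 h.
have cu : cvgn (series u).
  apply: normed_cvg; apply: (@series_le_cvg _ _ (geometric B x)) => //.
  - by move=> n; rewrite /= normr_ge0.
  - by move=> n; rewrite /= mulr_ge0// exprn_ge0//; case/andP: x01.
  - by apply: is_cvg_geometric_series; case/andP: x01 => x0 x1; rewrite ger0_norm.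
apply/ler_addgt0Pr => e e0.
move/cvgrPdist_lt : cu => /(_ e e0)[M _ /(_ (N + M)%N)] /=; rewrite leq_addl => /(_ isT).
rewrite /series /= big_mkord => h1.
rewrite -(subrKA (\sum_(k < N + M) u k)); apply: le_trans (ler_normD _ _) _.
apply: lerD; last by rewrite distrC ltW.
by rewrite distrC; exact: geo_tail.
Qed.

Definition Csum (a : nat -> C) : C :=
  limn (series (fun k => Re (a k))) +i* limn (series (fun k => Im (a k))).

Lemma Re_sum n (a : nat -> C) : Re (\sum_(k < n) a k) = \sum_(k < n) Re (a k).
Proof. by elim: n => [|n IH]; rewrite ?big_ord0// !big_ord_recr /= ReD IH. Qed.

Lemma Im_sum n (a : nat -> C) : Im (\sum_(k < n) a k) = \sum_(k < n) Im (a k).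
Proof. by elim: n => [|n IH]; rewrite ?big_ord0// !big_ord_recr /= ImD IH. Qed.

Lemma Csum_tail (a : nat -> C) B x N : 0 <= x < 1 -> 0 <= B ->
  (forall k, normc (a k) <= B * x ^+ k) ->
  normc (\sum_(k < N) a k - Csum a) <= 2 * B * x ^+ N / (1 - x).
Proof.
move=> x01 B0 h; apply: le_trans (normc_le_ReIm _) _.
have -> : 2 * B * x ^+ N / (1 - x) = B * x ^+ N / (1 - x) + B * x ^+ N / (1 - x) by ring.
rewrite ReD ReN ImD ImN Re_sum Im_sum; apply: lerD; apply: geo_series => // k.
  exact: le_trans (Re_le_normc _) _.
exact: le_trans (Im_le_normc _) _.
Qed.

Lemma Csum_conv (a : nat -> C) B x : 0 <= x < 1 -> 0 <= B ->
  (forall k, normc (a k) <= B * x ^+ k) -> sconv (fun N => \sum_(k < N) a k) (Csum a).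
Proof.
move=> x01 B0 h; apply: (@sconv_geo _ _ (2 * B / (1 - x)) x) => // N.
by rewrite mulrAC; exact: Csum_tail.
Qed.

Definition Psum (a : nat -> C) (z : C) : C := Csum (fun k => a k * z ^+ k).

(** Induction: the remainder for [k.+1] is [w] times the remainder for [k] plus
    [k z ^ (k - 1) (w - z) ^ 2]. The factor [r ^+ 2] on the left avoids the exponent [k - 2] on the
    right, and the truncation of [k.-1] at [k = 0] is masked by the factor [k]. *)
Lemma pow_taylor (w z : C) (r : R) k : normc w <= r -> normc z <= r ->
  normc (w ^+ k - z ^+ k - k%:R * z ^+ k.-1 * (w - z)) * r ^+ 2 <=
  k%:R ^+ 2 * r ^+ k * normc (w - z) ^+ 2.
Proof.
move=> wr zr; have r0 : 0 <= r by apply: le_trans wr; exact: normc_ge0.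
elim: k => [|k IH].
  by rewrite !expr0 subrr !mul0r sub0r oppr0 normc_0 mul0r expr0n /= !mul0r.
set d := normc (w - z) ^+ 2 in IH *.
have d0 : 0 <= d by rewrite exprn_ge0// normc_ge0.
set e := w ^+ k - _ - _ in IH.
have -> : w ^+ k.+1 - z ^+ k.+1 - k.+1%:R * z ^+ k.+1.-1 * (w - z) =
    w * e + k%:R * z ^+ k.-1 * (w - z) ^+ 2.
  rewrite /e; case: (k) => [|j]; first by rewrite !expr0 !expr1 /=; ring.
  by rewrite /= !exprS -[j.+2%:R]natr1; ring.
apply: le_trans (ler_wpM2r (exprn_ge0 2 r0) (le_normcD _ _)) _.
rewrite mulrDl !normcM.
have h1 : normc w * normc e * r ^+ 2 <= k%:R ^+ 2 * r ^+ k.+1 * d.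
  rewrite -mulrA (exprS r k).
  have -> : k%:R ^+ 2 * (r * r ^+ k) * d = r * (k%:R ^+ 2 * r ^+ k * d) by ring.
  by apply: ler_pM; rewrite ?normc_ge0 ?mulr_ge0 ?normc_ge0 ?exprn_ge0.
have nk : normc (k%:R : C) = k%:R.
  by rewrite -[k%:R]/(k%:R : C) -(rmorph_nat (real_complex R)) normc_real ger0_norm.
have h2 : normc (k%:R : C) * normc (z ^+ k.-1) * (normc (w - z) * normc (w - z)) * r ^+ 2 <= k%:R * r ^+ k.+1 * d.
  rewrite nk normcX -expr2 -/d; case: (k) => [|j]; first by rewrite !mul0r.
  have -> : j.+1%:R * r ^+ j.+2 * d = j.+1%:R * r ^+ j * d * r ^+ 2 by rewrite !exprS; ring.
  rewrite ler_wpM2r ?exprn_ge0// ler_wpM2r// ler_wpM2l//=.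
  by rewrite expn_le ?normc_ge0.
apply: le_trans (lerD h1 h2) _.
rewrite -!mulrDl ler_wpM2r// ler_wpM2r ?exprn_ge0// -natr1.
have : 0 <= (k%:R : R) by []. move: (k%:R : R) => a a0; nra.
Qed.

(** For [y] strictly between [x] and 1, each of the first [k] powers of [x / y] is at least the
    [k]-th, so [k * (x / y) ^+ k] is at most the sum of the geometric series. This absorbs the
    polynomial factors produced by differentiating term by term. *)
Lemma nat_geo (x : R) : 0 <= x < 1 -> exists y K : R, [/\ 0 <= y < 1, 0 <= K, x < y &
  forall k, k%:R * x ^+ k <= K * y ^+ k].
Proof.
move=> /andP[x0 x1]; pose y := (x + 1) / 2.
have y0 : 0 < y by rewrite /y; lra.
have xy : x < y by rewrite /y; lra.
have y1 : y < 1 by rewrite /y; lra.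
have u0 : 0 <= x / y by rewrite divr_ge0// ltW.
have u1 : x / y < 1 by rewrite ltr_pdivrMr// mul1r.
exists y, (1 - x / y)^-1; split=> //; first by rewrite y1 ltW.
  by rewrite invr_ge0 subr_ge0 ltW.
move=> k; have -> : x ^+ k = (x / y) ^+ k * y ^+ k by rewrite -exprMn divfK// gt_eqF.
rewrite mulrA ler_wpM2r ?exprn_ge0 ?(ltW y0)//.
apply: le_trans (geo_sum_le k _); last by rewrite u0.
rewrite mulr_natl -[k in _ *+ k]card_ord -sumr_const; apply: ler_sum => i _.
exact: (ler_wiXn2l u0 (ltW u1) (ltnW (ltn_ord i))).
Qed.

(** The derivative is the series differentiated term by term. A quadratic bound on the remainder
    holds for all partial sums with one constant [M] and passes to the limit; the factor [k ^ 2] of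
    [pow_taylor] is absorbed by using [nat_geo] twice. *)
Lemma Psum_cdiff (a : nat -> C) (B q : R) (z : C) : 0 <= B -> 0 < q ->
  (forall k, normc (a k) <= B * q ^+ k) -> q * normc z < 1 ->
  exists l, cdiff (Psum a) z l.
Proof.
move=> B0 q0 ha qz.
pose r := (normc z + q^-1) / 2.
have zq : normc z < q^-1 by rewrite -[q^-1]mul1r ltr_pdivlMr// mulrC.
have zr : normc z < r by rewrite /r; lra.
have rq : r < q^-1 by rewrite /r; lra.
have r0 : 0 < r by apply: le_lt_trans (normc_ge0 z) zr.
pose x := q * r.
have x01 : 0 <= x < 1.
  rewrite /x mulr_ge0 ?ltW//=; move: rq; by rewrite -[q^-1]mul1r ltr_pdivlMr// mulrC.
have [y [K [y01 K0 xy hK]]] := nat_geo x01.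
have [y2 [K2 [y201 K20 yy2 hK2]]] := nat_geo y01.
have y0 : 0 <= y by case/andP: y01.
have kk k : k%:R ^+ 2 * x ^+ k <= K * K2 * y2 ^+ k.
  rewrite expr2 -mulrA; apply: le_trans (ler_wpM2l (ler0n _ _) (hK k)) _.
  by rewrite mulrCA -mulrA ler_wpM2l.
have r20 : 0 < r ^+ 2 by rewrite exprn_gt0.
pose M := B * (K * K2) / (1 - y2) / r ^+ 2.
have nk k : normc (k%:R : C) = k%:R.
  by rewrite -(rmorph_nat (real_complex R)) normc_real ger0_norm.
pose b k := a k * (k%:R * z ^+ k.-1).
have hb k : normc (b k) <= B * K / r * y ^+ k.
  rewrite /b !normcM nk normcX.
  apply: le_trans (_ : B * q ^+ k * (k%:R * r ^+ k.-1) <= _).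
    apply: ler_pM; rewrite ?normc_ge0 ?ha ?mulr_ge0 ?exprn_ge0 ?normc_ge0//.
    by rewrite ler_wpM2l// expn_le ?normc_ge0 ?ltW.
  case: k => [|k]; first by rewrite !mul0r mulr0 !mulr_ge0// ?exprn_ge0// invr_ge0 ltW.
  have -> : B * q ^+ k.+1 * (k.+1%:R * r ^+ k) = B * (k.+1%:R * x ^+ k.+1) / r.
    have -> : x ^+ k.+1 = q ^+ k.+1 * (r ^+ k * r) by rewrite -exprSr -exprMn.
    by field; rewrite gt_eqF.
  rewrite (mulrAC (B * K)) ler_wpM2r ?invr_ge0 ?(ltW r0)// -mulrA ler_wpM2l//.
have conv w : normc w <= r -> sconv (fun N => \sum_(k < N) a k * w ^+ k) (Psum a w).
  move=> wr; apply: (@Csum_conv _ B x) => // k.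
  rewrite normcM normcX /x exprMn mulrA; apply: ler_pM; rewrite ?normc_ge0 ?ha ?exprn_ge0 ?normc_ge0//.
  by rewrite expn_le ?normc_ge0.
have convl : sconv (fun N => \sum_(k < N) b k) (Csum b).
  by apply: (@Csum_conv _ (B * K / r) y) => //; rewrite !mulr_ge0// invr_ge0 ltW.
have M0 : 0 <= M.
  by rewrite /M !mulr_ge0// ?invr_ge0 ?(ltW r20)// subr_ge0; case/andP: y201 => _ /ltW.
have main w : normc w <= r ->
    normc (Psum a w - Psum a z - Csum b * (w - z)) <= M * normc (w - z) ^+ 2.
  move=> wr.
  have := sconvB (sconvB (conv w wr) (conv z (ltW zr))) (sconvZ (w - z) convl).
  rewrite (mulrC (w - z)) => /sconv_le; apply => N.
  rewrite mulr_sumr -!sumrB; apply: le_trans (le_normc_sum _ _ _) _.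
  apply: le_trans (_ : \sum_(k < N) (B * (K * K2) / r ^+ 2 * normc (w - z) ^+ 2) * y2 ^+ k <= _).
    apply: ler_sum => k _.
    have -> : a k * w ^+ k - a k * z ^+ k - (w - z) * b k =
       a k * (w ^+ k - z ^+ k - k%:R * z ^+ k.-1 * (w - z)) by rewrite /b; ring.
    rewrite normcM.
    have := pow_taylor k wr (ltW zr); rewrite -ler_pdivlMr// => /(ler_pM (normc_ge0 _) (normc_ge0 _) (ha k)).
    move=> /le_trans; apply.
    have -> : B * q ^+ k * (k%:R ^+ 2 * r ^+ k * normc (w - z) ^+ 2 / r ^+ 2) =
      (B / r ^+ 2 * normc (w - z) ^+ 2) * (k%:R ^+ 2 * x ^+ k).
      have -> : x ^+ k = q ^+ k * r ^+ k by exact: exprMn.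
      by move: (k%:R : R) (q ^+ k) (r ^+ k) => *; ring.
    have -> : B * (K * K2) / r ^+ 2 * normc (w - z) ^+ 2 * y2 ^+ k =
      (B / r ^+ 2 * normc (w - z) ^+ 2) * (K * K2 * y2 ^+ k) by ring.
    by rewrite ler_wpM2l// !mulr_ge0 ?invr_ge0 ?exprn_ge0 ?normc_ge0// ltW.
  rewrite -mulr_sumr.
  have -> : M * normc (w - z) ^+ 2 = B * (K * K2) / r ^+ 2 * normc (w - z) ^+ 2 * (1 - y2)^-1.
    by rewrite /M; ring.
  rewrite ler_wpM2l ?geo_sum_le// !mulr_ge0 ?invr_ge0 ?exprn_ge0 ?normc_ge0//; exact: ltW.
exists (Csum b) => e e0.
have M10 : 0 < 1 + M by rewrite ltr_pwDl.
exists (Num.min (r - normc z) (e / (1 + M))); first by rewrite lt_min subr_gt0 zr divr_gt0.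
move=> w; rewrite lt_min => /andP[w1 w2].
have wr : normc w <= r.
  rewrite -(subrK z w); apply: le_trans (le_normcD _ _) _.
  by rewrite -lerBrDr ltW.
apply: le_trans (main w wr) _; rewrite expr2 mulrA ler_wpM2r ?normc_ge0//.
apply: le_trans (_ : (1 + M) * normc (w - z) <= _).
  by rewrite ler_wpM2r ?normc_ge0// lerDr.
by rewrite mulrC -ler_pdivlMr// ltW.
Qed.

(** * Laurent series *)

(** [Negz k] is the index [-(k + 1)], so the indices run from [-N] to [N - 1]. *)
Definition lpart (c : int -> C) N (z : C) : C :=
  \sum_(k < N) (c k * z ^+ k + c (Negz k) * z^-1 ^+ k.+1).

Definition lsum (c : int -> C) (z : C) : C :=
  Psum (fun k => c (Posz k)) z + z^-1 * Psum (fun k => c (Negz k)) z^-1.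

Definition gbound (c : int -> C) (B q : R) := forall n, normc (c n) <= B * q ^+ `|n|%N.

Lemma gbound_ge0 c B q : gbound c B q -> 0 <= B.
Proof. by move=> /(_ 0); rewrite expr0 mulr1; apply: le_trans; exact: normc_ge0. Qed.

Lemma lpartE c N z : lpart c N z =
  \sum_(k < N) c k * z ^+ k + z^-1 * \sum_(k < N) c (Negz k) * z^-1 ^+ k.
Proof.
rewrite mulr_sumr -big_split /=; apply: eq_bigr => k _; congr (_ + _).
by rewrite exprS mulrCA.
Qed.

(** Each half of the series has a geometric tail of ratio at most [x]. The constant 4 counts two
    halves and, in each, two real components. *)
Lemma lsum_tail c B q z x N : 0 < q -> gbound c B q -> x < 1 ->
  q * normc z <= x -> q * normc z^-1 <= x ->
  normc (lpart c N z - lsum c z) <= 4 * B / (1 - x) * x ^+ N.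
Proof.
move=> q0 hc x1 zx zx'; have B0 := gbound_ge0 hc.
have x0 : 0 <= x by apply: le_trans zx; rewrite mulr_ge0 ?normc_ge0// ltW.
have x01 : 0 <= x < 1 by rewrite x0.
have x1' : 0 < 1 - x by rewrite subr_gt0.
have h1 : normc (\sum_(k < N) c k * z ^+ k - Psum (fun k => c (Posz k)) z) <= 2 * B * x ^+ N / (1 - x).
  apply: (@Csum_tail (fun k => c (Posz k) * z ^+ k)) => // k.
  rewrite normcM normcX; apply: le_trans (ler_wpM2r (exprn_ge0 _ (normc_ge0 _)) (hc k)) _.
  rewrite /= -mulrA -exprMn ler_wpM2l// expn_le// mulr_ge0 ?normc_ge0//; exact: ltW.
have h2 : normc (\sum_(k < N) c (Negz k) * z^-1 ^+ k - Psum (fun k => c (Negz k)) z^-1) <= 2 * (B * q) * x ^+ N / (1 - x).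
  apply: (@Csum_tail (fun k => c (Negz k) * z^-1 ^+ k)) => //; first by rewrite mulr_ge0// ltW.
  move=> k; rewrite normcM normcX; apply: le_trans (ler_wpM2r (exprn_ge0 _ (normc_ge0 _)) (hc (Negz k))) _.
  rewrite -[`|Negz k|%N]/k.+1 exprS.
  have -> : B * (q * q ^+ k) * normc z^-1 ^+ k = B * q * (q * normc z^-1) ^+ k by rewrite exprMn; ring.
  rewrite ler_wpM2l ?mulr_ge0 ?(ltW q0)// expn_le// mulr_ge0 ?normc_ge0//; exact: ltW.
rewrite lpartE /lsum opprD addrACA -mulrBr.
apply: le_trans (le_normcD _ _) _; rewrite normcM.
apply: le_trans (lerD h1 (ler_wpM2l (normc_ge0 _) h2)) _.
have -> : normc z^-1 * (2 * (B * q) * x ^+ N / (1 - x)) = (2 * B * x ^+ N / (1 - x)) * (q * normc z^-1) by ring.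
apply: le_trans (_ : 2 * B * x ^+ N / (1 - x) + 2 * B * x ^+ N / (1 - x) * 1 <= _).
  rewrite lerD2l ler_wpM2l ?mulr_ge0 ?exprn_ge0 ?invr_ge0 ?(ltW x1')//.
  by apply: le_trans zx' _; exact: ltW.
by rewrite le_eqVlt; apply/orP; left; apply/eqP; field; rewrite gt_eqF.
Qed.

Lemma lsum_conv c B q z : 0 < q -> gbound c B q -> q < normc z < q^-1 ->
  sconv (fun N => lpart c N z) (lsum c z).
Proof.
move=> q0 hc /andP[z1 z2].
have z0 : 0 < normc z by apply: lt_trans z1.
have h1 : q * normc z < 1 by rewrite mulrC -ltr_pdivlMr// mul1r.
have h2 : q * normc z^-1 < 1 by rewrite normcV ltr_pdivrMr// mul1r.
pose x := Num.max (q * normc z) (q * normc z^-1).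
apply: (@sconv_geo _ _ (4 * B / (1 - x)) x).
  by rewrite gt_max h1 h2 le_max mulr_ge0 ?normc_ge0// ltW.
move=> N; apply: (@lsum_tail _ _ q) => //; rewrite ?gt_max ?h1//; rewrite le_max lexx ?orbT//.
Qed.

Lemma lsum_cdiff c B q z : 0 < q -> gbound c B q -> q < normc z < q^-1 ->
  exists l, cdiff (lsum c) z l.
Proof.
move=> q0 hc /andP[z1 z2]; have B0 := gbound_ge0 hc.
have z0 : 0 < normc z by apply: lt_trans z1.
have h1 : q * normc z < 1 by rewrite mulrC -ltr_pdivlMr// mul1r.
have h2 : q * normc z^-1 < 1 by rewrite normcV ltr_pdivrMr// mul1r.
have [l1 d1] := @Psum_cdiff (fun k => c (Posz k)) B q z B0 q0 hc h1.
have Bq : 0 <= B * q by rewrite mulr_ge0// ltW.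
have hc' k : normc (c (Negz k)) <= B * q * q ^+ k.
  by apply: le_trans (hc _) _; rewrite -[`|Negz k|%N]/k.+1 exprS mulrA.
have [l2 d2] := @Psum_cdiff (fun k => c (Negz k)) (B * q) q z^-1 Bq q0 hc' h2.
have zn0 : z != 0 by rewrite -normc_gt0.
have dV : cdiff (fun w => w^-1) z (- 1 / z ^+ 2) by apply: (@cdiffV R id) => //; exact: cdiff_id.
by eexists; apply: cdiffD d1 (cdiffM dV (cdiff_comp dV d2)).
Qed.
End Series.

(** * Laurent coefficients and the Laurent expansion on an annulus *)

Section Laurent.
Variable R : realType.
Local Notation C := R[i].
Local Notation Re := complex.Re.
Local Notation Im := complex.Im.

Lemma pconton_bounded (a b : R) (h : R -> C) : a <= b -> pconton a b h ->
  exists2 B, 0 <= B & forall t, a <= t <= b -> normc (h t) <= B.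
Proof.
move=> ab hc.
have c1 : {within `[a, b], continuous (fun s => `|Re (h s)|)}.
  by apply: continuous_in_subspaceT => t /set_mem; rewrite /= in_itv /= => /hc[c _]; exact: cvg_norm.
have c2 : {within `[a, b], continuous (fun s => `|Im (h s)|)}.
  by apply: continuous_in_subspaceT => t /set_mem; rewrite /= in_itv /= => /hc[_ c]; exact: cvg_norm.
have [s1 _ h1] := EVT_max ab c1; have [s2 _ h2] := EVT_max ab c2.
exists (`|Re (h s1)| + `|Im (h s2)|); first exact: addr_ge0.
move=> t tab; apply: le_trans (normc_le_ReIm _) _.
by apply: lerD; [apply: h1|apply: h2]; rewrite in_itv.
Qed.

Lemma normc_exprz (z : C) (n : int) : normc (z ^ n) = normc z ^ n.
Proof.
case: n => n; first exact: normcX.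
by rewrite !NegzE -!exprnN normcV normcX.
Qed.

Lemma polar_exprz (r t : R) (n : int) : (r%:C * expi t) ^ n = (r%:C ^ n) * expi (n%:~R * t).
Proof. by rewrite expfzMl expiMz. Qed.

Lemma pcont_polar_exprz (r : R) n t : pcont (fun s => (r%:C * expi s) ^ n) t.
Proof.
under [fun s => _]eq_fun do rewrite polar_exprz.
by apply: pcontM; [exact: pcont_cst|exact: pcont_expiM].
Qed.

(** Integration is in [dt], that is [dz / ('i * z)]. Hence [lc f r n] below is the usual
    coefficient: [1 / (2 pi i)] times the integral of [f z / z ^ (n + 1) dz] over the circle of
    radius [r]. *)
Definition circint (f : C -> C) (r : R) : C := Cint 0 (2 * pi) (fun t => f (r%:C * expi t)).

Definition lc f r (n : int) : C := (2 * pi)^-1%:C * circint (fun z => f z * z ^ (- n)) r.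

Lemma pi2_gt0 : 0 < 2 * pi :> R. Proof. by rewrite mulr_gt0// pi_gt0. Qed.

Lemma circint_exprz (r : R) (n : int) : 0 < r -> circint (fun z => z ^ n) r = (n == 0)%:R * (2 * pi)%:C.
Proof.
move=> r0; rewrite /circint.
rewrite (eq_Cint (h' := fun t => r%:C ^ n * expi (n%:~R * t))); last by move=> t _; rewrite polar_exprz.
rewrite CintZ; last by move=> t _; exact: pcont_expiM.
have [->|n0] := eqVneq n 0.
  rewrite expr0z !mul1r (eq_Cint (h' := fun=> 1)); last by move=> t _; rewrite mul0r expi0.
  by rewrite Cint_cst ?subr0 ?mulr1// ltW// pi2_gt0.
rewrite Cint_expi ?(ltW pi2_gt0)// ?intr_eq0//.
by rewrite mulr0 expi0 expiMz expi2pi exp1rz subrr mul0r mulr0 mul0r.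
Qed.

Definition circcont (f : C -> C) (r : R) := pconton 0 (2 * pi) (fun t => f (r%:C * expi t)).

Lemma ccont_circcont f r : (forall t, ccont f (r%:C * expi t)) -> circcont f r.
Proof. by move=> h t _; apply: pcont_comp => //; exact: pcont_arc. Qed.

Lemma circcont_exprz r n : circcont (fun z => z ^ n) r.
Proof. by move=> t _; exact: pcont_polar_exprz. Qed.

Lemma circcontM f g r : circcont f r -> circcont g r -> circcont (fun z => f z * g z) r.
Proof. by move=> hf hg t ht; apply: pcontM; [exact: hf|exact: hg]. Qed.

Lemma circcontD f g r : circcont f r -> circcont g r -> circcont (fun z => f z + g z) r.
Proof. by move=> hf hg t ht; apply: pcontD; [exact: hf|exact: hg]. Qed.

Lemma circcontB f g r : circcont f r -> circcont g r -> circcont (fun z => f z - g z) r.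
Proof. by move=> hf hg t ht; apply: pcontB; [exact: hf|exact: hg]. Qed.

Lemma circcont_cst (c : C) r : circcont (fun=> c) r.
Proof. by move=> t _; exact: pcont_cst. Qed.

Lemma circcont_sum n (f : nat -> C -> C) r : (forall k, circcont (f k) r) ->
  circcont (fun z => \sum_(k < n) f k z) r.
Proof. by move=> h t ht; apply: (@pcont_sum R n (fun k t => f k (r%:C * expi t))) => k; exact: h. Qed.

Lemma circintZ (c : C) f r : circcont f r -> circint (fun z => c * f z) r = c * circint f r.
Proof. by move=> hf; exact: CintZ. Qed.

Lemma circintD f g r : circcont f r -> circcont g r ->
  circint (fun z => f z + g z) r = circint f r + circint g r.
Proof. by move=> hf hg; exact: CintD. Qed.

Lemma circintB f g r : circcont f r -> circcont g r ->
  circint (fun z => f z - g z) r = circint f r - circint g r.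
Proof. by move=> hf hg; exact: CintB. Qed.

Lemma circint_sum n (f : nat -> C -> C) r : (forall k, circcont (f k) r) ->
  circint (fun z => \sum_(k < n) f k z) r = \sum_(k < n) circint (f k) r.
Proof. by move=> h; exact: (@Cint_sum R _ _ n (fun k t => f k (r%:C * expi t))). Qed.

Lemma eq_circint f g r : 0 <= r -> (forall z, normc z = r -> f z = g z) -> circint f r = circint g r.
Proof.
by move=> r0 h; apply: eq_Cint => t _; apply: h; rewrite normcM normc_expi normc_real mulr1 ger0_norm.
Qed.

Lemma circint_bound f r B : 0 <= r -> circcont f r -> (forall z, normc z = r -> normc (f z) <= B) ->
  normc (circint f r) <= 2 * B * (2 * pi).
Proof.
move=> r0 hf hB; have := @Cint_bound R 0 (2 * pi) _ B (ltW pi2_gt0) hf; rewrite subr0; apply => t _.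
by apply: hB; rewrite normcM normc_expi normc_real mulr1 ger0_norm.
Qed.

Lemma circcont_bounded f r : 0 <= r -> circcont f r ->
  exists2 B, 0 <= B & forall z, normc z = r -> normc (f z) <= B.
Proof.
move=> r0 /(pconton_bounded (ltW pi2_gt0))[B B0 hB]; exists B => // z zr.
have [t /andP[t0 t1] ->] := polarP z; rewrite zr; apply: hB.
by rewrite t0 ltW.
Qed.

Lemma lc_bound f r B n : 0 < r -> circcont f r -> (forall z, normc z = r -> normc (f z) <= B) ->
  normc (lc f r n) <= 2 * B * r ^ (- n).
Proof.
move=> r0 hf hB; rewrite /lc normcM normc_real gtr0_norm ?invr_gt0 ?pi2_gt0//.
rewrite mulrC ler_pdivrMr ?pi2_gt0// -(mulrA 2); apply: circint_bound; first exact: ltW.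
  by apply: circcontM => //; exact: circcont_exprz.
move=> z zr; rewrite normcM normc_exprz zr ler_wpM2r ?hB//.
by rewrite exprz_ge0// ltW.
Qed.

Lemma lcZ (a : C) f r n : circcont f r -> lc (fun z => a * f z) r n = a * lc f r n.
Proof.
move=> hf; rewrite /lc mulrCA -(circintZ a); last by apply: circcontM => //; exact: circcont_exprz.
by congr (_ * _); apply: eq_Cint => t _; rewrite mulrA.
Qed.

Lemma lcD f g r n : circcont f r -> circcont g r ->
  lc (fun z => f z + g z) r n = lc f r n + lc g r n.
Proof.
move=> hf hg; rewrite /lc -mulrDr -circintD; [|by apply: circcontM => //; exact: circcont_exprz..].
by congr (_ * _); apply: eq_Cint => t _; rewrite mulrDl.
Qed.

Lemma lcB f g r n : circcont f r -> circcont g r ->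
  lc (fun z => f z - g z) r n = lc f r n - lc g r n.
Proof.
move=> hf hg; rewrite /lc -mulrBr -circintB; [|by apply: circcontM => //; exact: circcont_exprz..].
by congr (_ * _); apply: eq_Cint => t _; rewrite mulrBl.
Qed.

Lemma eq_lc f g r n : 0 <= r -> (forall z, normc z = r -> f z = g z) -> lc f r n = lc g r n.
Proof. by move=> r0 h; congr (_ * _); apply: eq_circint => // z /h ->. Qed.

Lemma lc_exprz (r : R) (m n : int) : 0 < r -> lc (fun z => z ^ m) r n = (m == n)%:R.
Proof.
move=> r0; rewrite /lc (@eq_circint _ (fun z => z ^ (m - n))) ?(ltW r0)//; last first.
  by move=> z zr; rewrite expfzDr// -normc_gt0 zr.
rewrite circint_exprz// subr_eq0 mulrCA -rmorphM mulVf ?rmorph1 ?mulr1//.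
by rewrite gt_eqF ?pi2_gt0.
Qed.

Lemma lc_cst (r : R) (a : C) n : 0 < r -> lc (fun=> a) r n = a * (n == 0)%:R.
Proof.
move=> r0; rewrite (@eq_lc _ (fun z => a * z ^ 0)) ?(ltW r0)//; last by move=> z _; rewrite expr0z mulr1.
by rewrite lcZ ?lc_exprz// 1?eq_sym//; exact: circcont_exprz.
Qed.

Lemma lpart_exprz (c : int -> C) N z : lpart c N z =
  \sum_(k < N) (c k * z ^ (k%:Z) + c (Negz k) * z ^ (Negz k)).
Proof.
by apply: eq_bigr => k _; rewrite NegzE -exprnP -exprnN -exprVn.
Qed.

Lemma circcont_lpart c N r : circcont (lpart c N) r.
Proof.
move=> t ht; rewrite (_ : (fun t => _) = (fun t => \sum_(k < N) (c k * (r%:C * expi t) ^ (k%:Z) +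
  c (Negz k) * (r%:C * expi t) ^ (Negz k)))); last by apply/funext => s; rewrite lpart_exprz.
apply: (@pcont_sum R N (fun k t => c (Posz k) * (r%:C * expi t) ^ (k%:Z) + c (Negz k) * (r%:C * expi t) ^ (Negz k))) => k.
by apply: pcontD; (apply: pcontM; [exact: pcont_cst|exact: pcont_polar_exprz]).
Qed.

Lemma lc_lpart c N r n : 0 < r -> (`|n| < N)%N -> lc (lpart c N) r n = c n.
Proof.
move=> r0 nN.
pose F k := fun z : C => c (Posz k) * z ^ (k%:Z) + c (Negz k) * z ^ (Negz k).
have cF k : circcont (F k) r.
  by apply: circcontD; (apply: circcontM; [exact: circcont_cst|exact: circcont_exprz]).
have lcF k : lc (F k) r n = c (Posz k) * (Posz k == n)%:R + c (Negz k) * (Negz k == n)%:R.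
  rewrite /F lcD; [|by apply: circcontM; [exact: circcont_cst|exact: circcont_exprz]..].
  by rewrite !lcZ ?lc_exprz//; exact: circcont_exprz.
have -> : lc (lpart c N) r n = \sum_(k < N) lc (F k) r n.
  rewrite /lc -mulr_sumr -(@circint_sum N (fun k z => F k z * z ^ (- n))); last first.
    by move=> k; apply: circcontM => //; exact: circcont_exprz.
  by congr (_ * _); apply: eq_Cint => t _; rewrite lpart_exprz mulr_suml.
under eq_bigr do rewrite lcF.
case: n nN {lcF} => n nN.
  rewrite (bigD1 (Ordinal nN)) //= eqxx mulr1 mulr0 addr0 big1 ?addr0// => i /negPf ni.
  by rewrite eqz_nat mulr0 addr0 -[(i == n :> nat)]/(i == Ordinal nN) ni mulr0.
rewrite (bigD1 (Ordinal (ltnW nN))) //= eqxx mulr1 mulr0 add0r big1 ?addr0// => i /negPf ni.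
rewrite mulr0 add0r; case: eqP => [[E]|]; last by rewrite mulr0.
by move: ni; rewrite -val_eqE /= E eqxx.
Qed.

(** As soon as [N > |n|], the [n]-th coefficient of the partial sum is exactly [c n], and Cauchy's
    estimate bounds the coefficient of the difference with [f]. *)
Lemma lc_unif f c r n : 0 < r -> circcont f r ->
  (forall e, 0 < e -> exists N0, forall N, (N0 <= N)%N -> forall z, normc z = r -> normc (lpart c N z - f z) <= e) ->
  lc f r n = c n.
Proof.
move=> r0 cf H; apply/eqP; rewrite -subr_eq0 -normc_eq0 eq_le normc_ge0 andbT.
apply/ler_addgt0Pr => e e0; rewrite add0r.
have rn : 0 < r ^ (- n) by rewrite exprz_gt0.
have e1 : 0 < e / (2 * r ^ (- n)) by rewrite divr_gt0// mulr_gt0.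
have [N0 hN] := H _ e1.
pose N := maxn N0 `|n|.+1.
have cB : circcont (fun z => lpart c N z - f z) r.
  by apply: circcontB => //; exact: circcont_lpart.
rewrite distcC -(@lc_lpart c N r n r0) ?leq_maxr// -lcB//; last exact: circcont_lpart.
apply: le_trans (lc_bound n r0 cB (hN N (leq_maxl _ _))) _.
rewrite le_eqVlt; apply/orP; left; apply/eqP; field.
by rewrite gt_eqF.
Qed.

Lemma lc_lsum c B q r n : 0 < q -> gbound c B q -> q < r < q^-1 -> lc (lsum c) r n = c n.
Proof.
move=> q0 hc /andP[z1 z2].
have z0 : 0 < r by apply: lt_trans z1.
have rn z : normc z = r -> q < normc z < q^-1 by move=> ->; rewrite z1.
have h1 : q * r < 1 by rewrite mulrC -ltr_pdivlMr// mul1r.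
have h2 : q * r^-1 < 1 by rewrite ltr_pdivrMr// mul1r.
pose x := Num.max (q * r) (q * r^-1).
have x1 : x < 1 by rewrite gt_max h1.
have x0 : 0 <= x by rewrite le_max mulr_ge0// ltW.
apply: lc_unif => //.
  apply: ccont_circcont => t.
  have nr : normc (r%:C * expi t) = r by rewrite normcM normc_expi normc_real mulr1 gtr0_norm.
  by have [l] := lsum_cdiff q0 hc (rn _ nr); exact: cdiff_cont.
move=> e e0; have [N0 hN] := @geo_small R (4 * B / (1 - x)) x e (introT andP (conj x0 x1)) e0.
exists N0 => N NN z zr; apply: le_trans (ltW (hN N NN)).
by apply: (@lsum_tail _ _ _ q) => //; rewrite ?normcV zr le_max lexx ?orbT.
Qed.

Lemma cdiff_near f g z l (d : R) : 0 < d -> (forall w, normc (w - z) < d -> f w = g w) ->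
  cdiff g z l -> cdiff f z l.
Proof.
move=> d0 E hg e /hg[d' d'0 h]; exists (Num.min d d'); first by rewrite lt_min d0.
move=> w; rewrite lt_min => /andP[/E -> /h]; rewrite E// subrr normc_0//.
Qed.

Definition holo_on (D : set C) (f : C -> C) := forall z, D z -> exists l, cdiff f z l.

Lemma cdiff_exprz (z : C) (n : int) : z != 0 -> exists l, cdiff (fun w => w ^ n) z l.
Proof.
move=> z0; case: n => [[|n]|n].
- by exists 0; exact: cdiff_cst.
- by eexists; apply: (cdiffX n (cdiff_id z)).
- by eexists; apply: (cdiffV (f := fun w => w ^+ n.+1)); [rewrite expf_neq0|apply: (cdiffX n (cdiff_id z))].
Qed.

Lemma annulusE (s : R) z : annulus s z = (s < normc z < s^-1) :> Prop.
Proof. by []. Qed.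

Lemma closed_sector_annulus (s r1 r2 : R) a b : s < r1 -> r1 <= r2 -> r2 < s^-1 -> 0 < s ->
  on_sector (annulus s) r1 r2 a b.
Proof.
move=> s1 r12 s2 s0 r t /andP[h1 h2] _; rewrite annulusE normcM normc_expi normc_real mulr1 gtr0_norm.
  by rewrite (lt_le_trans s1)// (le_lt_trans h2).
by apply: lt_le_trans h1; apply: lt_trans s1.
Qed.

Lemma rectint_circle (f : C -> C) r1 r2 : rectint f r1 r2 0 (2 * pi) = 0 ->
  arcint f r1 0 (2 * pi) = arcint f r2 0 (2 * pi).
Proof.
rewrite /rectint; have -> : radint f (2 * pi) r1 r2 = radint f 0 r1 r2.
  by rewrite /radint expi0 expi2pi.
by move=> /eqP; rewrite addrAC addrC addrA subr_eq0 addrA addNr add0r => /eqP ->.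
Qed.

Lemma arcint_circint f r : circcont f r ->
  arcint f r 0 (2 * pi) = 'i * circint (fun z => f z * z) r.
Proof.
move=> hf; rewrite -circintZ.
  by apply: eq_Cint => t _; rewrite mulrCA.
by apply: circcontM => //; apply: ccont_circcont => t; exact: ccont_id.
Qed.

Lemma i_neq0 : 'i != 0 :> C.
Proof. by rewrite -normc_eq0 /normc /= expr0n/= add0r expr1n sqrtr1 oner_neq0. Qed.

Lemma annulus_circle (s r : R) t : 0 < s -> s < r < s^-1 -> annulus s (r%:C * expi t).
Proof.
move=> s0 rs; rewrite annulusE normcM normc_expi normc_real mulr1 gtr0_norm//.
by case/andP: rs => + _; apply: lt_trans.
Qed.

Lemma holo_circcont s f r : 0 < s -> holo_on (annulus s) f -> s < r < s^-1 -> circcont f r.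
Proof.
by move=> s0 hf rs; apply: ccont_circcont => t; have [l /cdiff_cont] := hf _ (annulus_circle t s0 rs).
Qed.

(** Goursat's theorem for [f z * z ^ (- n - 1)] on a sector of full turn, whose two radial sides
    coincide and cancel. *)
Lemma lc_radius s f r1 r2 n : 0 < s -> holo_on (annulus s) f -> s < r1 < s^-1 -> s < r2 < s^-1 ->
  lc f r1 n = lc f r2 n.
Proof.
move=> s0 hf.
wlog r12 : r1 r2 / r1 <= r2 => [hw h1 h2|].
  case: (lerP r1 r2) => [r12|/ltW r21]; first exact: (hw _ _ r12 h1 h2).
  by rewrite (hw _ _ r21 h2 h1).
move=> /andP[s1 s1'] /andP[s2 s2'].
have r10 : 0 < r1 by apply: lt_trans s1.
have r20 : 0 < r2 by apply: lt_trans s2.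
pose g z := f z * z ^ (- n - 1).
have hg : holo_on (annulus s) g.
  move=> z zs; have [l hl] := hf z zs.
  have z0 : z != 0 by rewrite -normc_gt0; case/andP: zs => + _; apply: lt_trans.
  have [m hm] := cdiff_exprz (- n - 1) z0.
  by eexists; apply: cdiffM hl hm.
have E r : s < r -> r < s^-1 -> arcint g r 0 (2 * pi) = 'i * circint (fun z => f z * z ^ (- n)) r.
  move=> h1 h2; rewrite arcint_circint; last by apply: (holo_circcont s0 hg); rewrite h1.
  congr (_ * _); have r0 : 0 < r by apply: lt_trans h1.
  apply: eq_circint => [|z zr]; first exact: ltW.
  have z0 : z != 0 by rewrite -normc_gt0 zr.
  by rewrite /g -mulrA -[X in _ * (_ * X)](expr1z z) -expfzDr// subrK.
have G0 : rectint g r1 r2 0 (2 * pi) = 0.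
  apply: goursat; [exact: ltW|exact: r12|exact: ltW pi2_gt0|].
  by move=> r t hr ht; apply: hg; apply: (@closed_sector_annulus s r1 r2 0 (2 * pi)).
have := rectint_circle G0; rewrite (E r1 s1 s1') (E r2 s2 s2').
by move=> /(mulfI i_neq0) H; rewrite /lc H.
Qed.

(** The expansion of the kernel is an exact finite identity with remainder [q z ^+ N * k z], so
    integration is over finite sums only and the error is geometric. The expansions outside and
    inside the point are both instances. *)
Lemma kernel_conv (g k q : C -> C) (u : nat -> C -> C) (r x : R) : 0 < r -> 0 <= x < 1 ->
  circcont g r -> circcont k r -> circcont q r -> (forall j, circcont (u j) r) ->
  (forall z, normc z = r -> normc (q z) <= x) ->
  (forall z N, normc z = r -> k z = \sum_(j < N) u j z + q z ^+ N * k z) ->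
  sconv (fun N => \sum_(j < N) circint (fun z => g z * u j z) r) (circint (fun z => g z * k z) r).
Proof.
move=> r0 x01 cg ck cq cu hq hk.
have cgk := circcontM cg ck.
have [B B0 hB] := circcont_bounded (ltW r0) cgk.
apply: (@sconv_geo _ _ _ (2 * B * (2 * pi)) x) => // N.
rewrite -(@circint_sum N (fun j z => g z * u j z)); last by move=> j; exact: circcontM.
have cs : circcont (fun z => \sum_(j < N) g z * u j z) r.
  by apply: (@circcont_sum N (fun j z => g z * u j z)) => j; exact: circcontM.
rewrite -circintB//.
rewrite mulrAC -(mulrA 2); apply: circint_bound; first exact: ltW.
  exact: circcontB.
move=> z zr; rewrite -mulr_sumr -mulrBr (hk z N zr) opprD addNKr -(normcN (_ * _)) -mulrN opprK.
rewrite mulrCA mulrC normcM normcX; apply: ler_pM; rewrite ?normc_ge0 ?exprn_ge0 ?normc_ge0 ?hB//.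
by rewrite expn_le ?normc_ge0 ?hq.
Qed.

Lemma circcont_id r : circcont id r.
Proof. by apply: ccont_circcont => t; exact: ccont_id. Qed.

Lemma circcont_V r : circcont (fun z => z^-1) r.
Proof. by move=> t ht; exact: (@pcont_polar_exprz r (Negz 0) t). Qed.

Lemma circcontX f n r : circcont f r -> circcont (fun z => f z ^+ n) r.
Proof. by move=> hf t ht; apply: pcontX; exact: hf. Qed.

Lemma circcontN f r : circcont f r -> circcont (fun z => - f z) r.
Proof. by move=> hf t ht; apply: pcontN; exact: hf. Qed.

Lemma circcont_kernel (z0 : C) (r : R) : 0 < r -> normc z0 != r -> circcont (fun z => z / (z - z0)) r.
Proof.
move=> r0 zr; apply: circcontM; first exact: circcont_id.
apply: ccont_circcont => t; apply: ccontV; last by apply: ccontB; [exact: ccont_id|exact: ccont_cst].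
rewrite subr_eq0; apply: contra zr => /eqP <-.
by rewrite normcM normc_expi normc_real mulr1 gtr0_norm.
Qed.

(* Expand [z / (z - z0)] in powers of [z0 / z]. *)
Lemma cauchy_outer g (z0 : C) (r : R) : 0 < r -> normc z0 < r -> circcont g r ->
  sconv (fun N => \sum_(j < N) z0 ^+ j * circint (fun z => g z * z ^ (- (j : nat)%:Z)) r)
        (circint (fun z => g z * (z / (z - z0))) r).
Proof.
move=> r0 zr cg.
have K : sconv (fun N => \sum_(j < N) circint (fun z => g z * (z0 * z^-1) ^+ j) r)
    (circint (fun z => g z * (z / (z - z0))) r).
  apply: (@kernel_conv g (fun z => z / (z - z0)) (fun z => z0 * z^-1) (fun j z => (z0 * z^-1) ^+ j) r (normc z0 / r) r0).
  - by rewrite divr_ge0 ?normc_ge0 ?(ltW r0)//= ltr_pdivrMr// mul1r.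
  - exact: cg.
  - by apply: circcont_kernel; rewrite // lt_eqF.
  - by apply: circcontM; [exact: circcont_cst|exact: circcont_V].
  - by move=> j; apply: circcontX; apply: circcontM; [exact: circcont_cst|exact: circcont_V].
  - by move=> z <-; rewrite normcM normcV.
  - move=> z N nz; have zn0 : z != 0 by rewrite -normc_gt0 nz.
    have zz : z - z0 != 0.
      by rewrite subr_eq0; apply/eqP => zz; move: zr; rewrite -nz zz ltxx.
    elim: N => [|N IH]; first by rewrite big_ord0 add0r expr0 mul1r.
    rewrite big_ord_recr /= {1}IH -addrA; congr (_ + _).
    by rewrite exprS; field; rewrite zn0 zz.
apply: eq_sconv K => N; apply: eq_bigr => j _.
rewrite -(circintZ (z0 ^+ j)); last by apply: circcontM; [exact: cg|exact: circcont_exprz].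
apply: eq_circint => [|z _]; first exact: ltW.
by rewrite exprMn exprVn -exprnN mulrCA.
Qed.

(* Expand [z / (z - z0)] in powers of [z / z0]. *)
Lemma cauchy_inner g (z0 : C) (r : R) : 0 < r -> r < normc z0 -> circcont g r ->
  sconv (fun N => \sum_(j < N) - (z0^-1 ^+ j.+1 * circint (fun z => g z * z ^+ j.+1) r))
        (circint (fun z => g z * (z / (z - z0))) r).
Proof.
move=> r0 zr cg; have z00 : z0 != 0 by rewrite -normc_gt0; apply: lt_trans zr.
have K : sconv (fun N => \sum_(j < N) circint (fun z => g z * - ((z0^-1 * z) ^+ j.+1)) r)
    (circint (fun z => g z * (z / (z - z0))) r).
  apply: (@kernel_conv g (fun z => z / (z - z0)) (fun z => z0^-1 * z) (fun j z => - ((z0^-1 * z) ^+ j.+1)) r (r / normc z0) r0).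
  - by rewrite divr_ge0 ?normc_ge0 ?(ltW r0)//= ltr_pdivrMr ?mul1r// normc_gt0.
  - exact: cg.
  - by apply: circcont_kernel; rewrite // gt_eqF.
  - by apply: circcontM; [exact: circcont_cst|exact: circcont_id].
  - by move=> j; apply: circcontN; apply: circcontX; apply: circcontM; [exact: circcont_cst|exact: circcont_id].
  - by move=> z <-; rewrite normcM normcV mulrC.
  - move=> z N nz; have zn0 : z != 0 by rewrite -normc_gt0 nz.
    have zz : z - z0 != 0.
      by rewrite subr_eq0; apply/eqP => zz; move: zr; rewrite -nz zz ltxx.
    elim: N => [|N IH]; first by rewrite big_ord0 add0r expr0 mul1r.
    rewrite big_ord_recr /= {1}IH -addrA; congr (_ + _).
    by rewrite !exprS; field; rewrite z00 zz.
apply: eq_sconv K => N; apply: eq_bigr => j _.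
have cgj : circcont (fun z => g z * z ^+ j.+1) r.
  by apply: circcontM; [exact: cg|apply: circcontX; exact: circcont_id].
rewrite -mulNr -(circintZ (- z0^-1 ^+ j.+1))//.
apply: eq_circint => [|z _]; first exact: ltW.
by rewrite exprMn mulrN mulrCA mulNr.
Qed.

(** Cauchy's formula without a residue. With [g = f - f z0], the slope [phi] of [f] at [z0] is
    continuous there, so [goursat_point] equates its integrals over circles on both sides of [z0].
    Expanding [z / (z - z0)] on the outer circle gives the terms of nonnegative index of the Laurent
    series of [g], and on the inner circle the negative ones: the series of [g] converges to 0 at
    [z0]. The angle avoids 0 because the sector of full turn is slit there and [z0] has to be
    interior. *)
Lemma lc_diff_conv s f (r0 t0 : R) : 0 < s -> holo_on (annulus s) f -> s < r0 < s^-1 ->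
  0 < t0 < 2 * pi ->
  sconv (fun N => lpart (fun n => lc f 1 n) N (r0%:C * expi t0)) (f (r0%:C * expi t0)).
Proof.
move=> s0 hf /andP[sr rs] t0b; set z0 := r0%:C * expi t0.
have r00 : 0 < r0 by apply: lt_trans sr.
have nz0 : normc z0 = r0 by rewrite normcM normc_expi normc_real mulr1 gtr0_norm.
have z00 : z0 != 0 by rewrite -normc_gt0 nz0.
have s1 : s < 1 < s^-1.
  have ss : s < s^-1 by apply: lt_trans rs.
  have s21 : s * s < 1 by rewrite -ltr_pdivlMr// mul1r.
  have sl : s < 1 by rewrite ltNge; apply/negP => h; move: s21; rewrite ltNge -expr2 exprn_ege1.
  by rewrite sl invf_gt1.
pose r1 := (s + r0) / 2; pose r2 := (r0 + s^-1) / 2.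
have sr1 : s < r1 by rewrite /r1; lra.
have r1r0 : r1 < r0 by rewrite /r1; lra.
have r0r2 : r0 < r2 by rewrite /r2; lra.
have r2s : r2 < s^-1 by rewrite /r2; lra.
have r10 : 0 < r1 by apply: lt_trans sr1.
have r20 : 0 < r2 by apply: lt_trans r0r2.
have zA : annulus s z0 by rewrite annulusE nz0 sr.
have [l0 hl0] := hf z0 zA; have /caratheodory[phi [phiE cphi _]] := hl0.
pose g z := f z - f z0.
have phiN w : w != z0 -> phi w = g w / (w - z0).
  by move=> wz; rewrite /g phiE mulfK// subr_eq0.
have hg : holo_on (annulus s) g.
  by move=> z /hf[l hl]; eexists; apply: cdiffD hl (cdiff_cst _ _).
have dphi w : annulus s w -> w != z0 -> exists l, cdiff phi w l.
  move=> wA wz; have [l hl] := hg w wA.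
  have nwz : 0 < normc (w - z0) by rewrite normc_gt0 subr_eq0.
  have hV := cdiffV (f := fun v => v - z0) (_ : w - z0 != 0) (cdiffD (cdiff_id w) (cdiff_cst (- z0) w)).
  rewrite subr_eq0 in hV.
  eexists; apply: (cdiff_near nwz _ (cdiffM hl (hV wz))) => v vw.
  apply: phiN; apply/eqP => vz; move: vw; by rewrite vz distcC ltxx.
have cphiA w : annulus s w -> ccont phi w.
  by move=> wA; have [->//|/(dphi w wA)[l /cdiff_cont]] := eqVneq w z0.
have sA := @closed_sector_annulus s r1 r2 0 (2 * pi) sr1 (ltW (lt_trans r1r0 r0r2)) r2s s0.
have := @rectint_circle phi r1 r2; rewrite (@goursat_point _ _ _ _ _ _ r0 t0)//; first last.
- move=> r t hr ht neq; apply: dphi; first exact: sA.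
  case/andP: hr => hr1 hr2; apply: polar_neq => //; first by apply: lt_le_trans hr1.
  by case/andP: ht => ? ?; case/andP: t0b => ? ?; rewrite ltr_distl; apply/andP; split; lra.
- by move=> r t hr ht; apply: cphiA; exact: sA.
- by rewrite r1r0.
- exact: ltW.
move=> /(_ erefl).
have cc r : s < r < s^-1 -> circcont phi r.
  by move=> rr; apply: ccont_circcont => t; apply: cphiA; exact: annulus_circle.
have cg r : s < r < s^-1 -> circcont g r by exact: (holo_circcont s0 hg).
have rr1 : s < r1 < s^-1 by rewrite sr1 (lt_trans r1r0).
have rr2 : s < r2 < s^-1 by rewrite r2s (lt_trans sr).
move=> Earc; have A12 : circint (fun z => phi z * z) r1 = circint (fun z => phi z * z) r2.
  by apply: (mulfI i_neq0); rewrite -(arcint_circint (cc _ rr1)) -(arcint_circint (cc _ rr2)).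
move: A12.
pose k w := w / (w - z0).
have phiK r : 0 < r -> r != r0 -> circint (fun z => phi z * z) r = circint (fun z => g z * k z) r.
  move=> rp rn; apply: eq_circint => [|z zr]; first exact: ltW.
  rewrite phiN; first by rewrite /k -mulrA (mulrC z).
  by apply/eqP => zz; move: rn; rewrite -zr zz nz0 eqxx.
have n1 : r1 != r0 by rewrite lt_eqF.
have n2 : r2 != r0 by rewrite gt_eqF.
rewrite (phiK r1 r10 n1) (phiK r2 r20 n2) => A12.
have z0r2 : normc z0 < r2 by rewrite nz0.
have z0r1 : r1 < normc z0 by rewrite nz0.
have := sconvZ (2 * pi)^-1%:C (sconvB (cauchy_outer r20 z0r2 (cg _ rr2)) (cauchy_inner r10 z0r1 (cg _ rr1))).
rewrite -A12 subrr mulr0 => KK.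
(* Subtracting the constant [f z0] changes only the coefficient of index 0. *)
have gE n : lc f 1 n = lc g 1 n + f z0 * (n == 0)%:R.
  rewrite -(lc_cst (f z0) n ltr01) -(lcD n (cg _ s1) (circcont_cst _ _)).
  by apply: (eq_lc n ler01) => z _; rewrite /g subrK.
have lE N : lpart (fun n => lc f 1 n) N.+1 z0 = lpart (fun n => lc g 1 n) N.+1 z0 + f z0.
  rewrite /lpart; under eq_bigr do rewrite !gE /= !mulr0 addr0 mulrDl addrAC.
  rewrite big_split /=; congr (_ + _).
  rewrite big_ord_recl big1 ?addr0 => [|i _]; first by rewrite expr0 !mulr1.
  by rewrite /= mulr0 mul0r.
have lgE N : (2 * pi)^-1%:C * (\sum_(j < N) z0 ^+ j * circint (fun z => g z * z ^ (- (j : nat)%:Z)) r2 -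
    \sum_(j < N) - (z0^-1 ^+ j.+1 * circint (fun z => g z * z ^+ j.+1) r1)) = lpart (fun n => lc g 1 n) N z0.
  rewrite -sumrB mulr_sumr; apply: eq_bigr => j _.
  have -> : lc g 1 (Negz j) = (2 * pi)^-1%:C * circint (fun z => g z * z ^+ j.+1) r1.
    exact: (lc_radius (Negz j) s0 hg s1 rr1).
  have -> : lc g 1 j = (2 * pi)^-1%:C * circint (fun z => g z * z ^ (- (j : nat)%:Z)) r2.
    exact: (lc_radius j s0 hg s1 rr2).
  by rewrite opprK mulrDr mulrCA [in X in _ + X]mulrCA (mulrC (z0 ^+ j)) (mulrC (z0^-1 ^+ j.+1)).
apply: (@sconv_shift _ _ _ 1%N) => e e0.
have [N0 hN] := eq_sconv lgE KK e0; exists N0 => N NN.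
rewrite addn1 lE addrK -[X in normc X]subr0; apply: hN; exact: leqW.
Qed.

(** Cauchy's estimate on the circle of radius [r^-1] for the nonnegative indices and on that of
    radius [r] for the negative ones. *)
Lemma holo_gbound s f r : 0 < s -> holo_on (annulus s) f -> s < r -> r < 1 ->
  exists2 B, 0 <= B & gbound (fun n => lc f 1 n) B r.
Proof.
move=> s0 hf sr r1; have r0 : 0 < r by apply: lt_trans sr.
have s1 : s < 1 by apply: lt_trans r1.
have s1' : s < 1 < s^-1 by rewrite s1 invf_gt1.
have rs : s < r < s^-1 by rewrite sr (lt_trans r1)// invf_gt1.
have rs' : s < r^-1 < s^-1 by rewrite ltf_pV2 ?posrE// sr andbT (lt_trans s1)// invf_gt1.
have r'0 : 0 < r^-1 by rewrite invr_gt0.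
have c1 := holo_circcont s0 hf rs; have c2 := holo_circcont s0 hf rs'.
have [B1 B10 h1] := circcont_bounded (ltW r0) c1.
have [B2 B20 h2] := circcont_bounded (ltW r'0) c2.
exists (2 * (B1 + B2)); first by rewrite mulr_ge0// addr_ge0.
case=> n.
  rewrite (lc_radius n s0 hf s1' rs'); apply: le_trans (lc_bound n r'0 c2 h2) _.
  rewrite -exprnN exprVn invrK ler_wpM2r ?exprn_ge0 ?(ltW r0)//.
  by rewrite ler_wpM2l// lerDr.
rewrite (lc_radius (Negz n) s0 hf s1' rs); apply: le_trans (lc_bound (Negz n) r0 c1 h1) _.
rewrite NegzE opprK -exprnP -[`|- _|%N]/n.+1 ler_wpM2r ?exprn_ge0 ?(ltW r0)//.
by rewrite ler_wpM2l// lerDl.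
Qed.

Lemma annulus_shrink s (z : C) : 0 < s -> s < 1 -> annulus s z ->
  exists r, [/\ s < r, r < 1 & annulus r z].
Proof.
move=> s0 s1 /andP[z1 z2]; have z0 : 0 < normc z by apply: lt_trans z1.
have z3 : s < (normc z)^-1 by rewrite -[s]invrK ltf_pV2 ?posrE// invr_gt0.
pose m := Num.min (Num.min (normc z) (normc z)^-1) 1.
have sm : s < m by rewrite !lt_min z1 z3.
pose r := (s + m) / 2.
have sr : s < r by rewrite /r; lra.
have : r < m by rewrite /r; lra.
rewrite !lt_min -andbA => /and3P[r1 r2 r3]; exists r; split=> //.
rewrite annulusE r1 -[normc z]invrK ltf_pV2 ?posrE ?invr_gt0//; exact: lt_trans sr.
Qed.

Lemma laurent s f z : 0 < s -> s < 1 -> holo_on (annulus s) f -> annulus s z ->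
  f z = lsum (fun n => lc f 1 n) z.
Proof.
move=> s0 s1 hf zs; set c := fun n => lc f 1 n.
have cl w : annulus s w -> ccont (lsum c) w.
  move=> /(annulus_shrink s0 s1)[r [sr r1 wr]].
  have [B B0 hB] := holo_gbound s0 hf sr r1.
  have [l] := lsum_cdiff (lt_trans s0 sr) hB wr; exact: cdiff_cont.
have cf w : annulus s w -> ccont f w by move=> /hf[l]; exact: cdiff_cont.
have main (r0 t0 : R) : s < r0 < s^-1 -> 0 < t0 < 2 * pi ->
    f (r0%:C * expi t0) = lsum c (r0%:C * expi t0).
  move=> rs t0b; have ws := annulus_circle t0 s0 rs.
  have [r [sr r1 wr]] := annulus_shrink s0 s1 ws.
  have [B B0 hB] := holo_gbound s0 hf sr r1.
  exact: sconv_unique (lc_diff_conv s0 hf rs t0b) (lsum_conv (lt_trans s0 sr) hB wr).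
have [t /andP[t0 t1] zE] := polarP z.
have [t00|t00] := eqVneq t 0; last first.
  by rewrite zE; apply: main; rewrite ?zs// t1 andbT lt_neqAle eq_sym t00.
(* There remains the positive real axis, where the slit was. Both sides are continuous, so the
   identity is carried over from points of small positive angle [u]. *)
have pi0 := pi_gt0 R.
apply/eqP; rewrite -subr_eq0 -normc_eq0 eq_le normc_ge0 andbT; apply/ler_addgt0Pr => e e0.
rewrite add0r; have [d d0 hd] := ccontB (cf z zs) (cl z zs) e0.
have z0 : 0 < normc z by case/andP: zs => + _; apply: lt_trans.
pose u := Num.min (d / (4 * normc z)) pi.
have u0 : 0 < u by rewrite lt_min pi0 andbT divr_gt0// mulr_gt0.
have ud : 4 * normc z * u <= d by rewrite mulrC -ler_pdivlMr ?mulr_gt0// ge_min lexx.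
have upi : u <= pi by rewrite ge_min lexx orbT.
have dz : normc ((normc z)%:C * expi u - z) < d.
  rewrite {2}zE t00; apply: le_lt_trans (polar_dist _ _ _ (normc_ge0 z)) _.
  rewrite subrr normr0 add0r subr0 gtr0_norm//.
  by apply: lt_le_trans ud; rewrite ltr_pM2r// ltr_pM2r// ltr_nat.
have u2 : 0 < u < 2 * pi by rewrite u0 (le_lt_trans upi)// mulr_natl mulr2n ltrDl.
move: (hd _ dz); rewrite (main _ _ zs u2).
by move: (lsum c _) (lsum c z) (f z) => p q y; rewrite subrr sub0r normcN => /ltW.
Qed.
End Laurent.

(** * The Hardy space: boundary values, coefficients and norm *)

Section HardySpace2.
Variable R : realType.
Local Notation C := R[i].
Local Notation mu := (@lebesgue_measure R).
Local Notation Re := complex.Re.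
Local Notation Im := complex.Im.
Local Notation angles := (@angles R).

Definition cmeas (u : R -> C) : Prop :=
  measurable_fun angles (fun t => Re (u t)) /\ measurable_fun angles (fun t => Im (u t)).

Definition sqi (u : R -> C) : \bar R := (\int[mu]_(t in angles) (normc (u t) ^+ 2)%:E)%E.

Lemma measurable_angles : measurable angles.
Proof. exact: measurable_itv. Qed.

Lemma cmeas_pconton u : pconton 0 (2 * pi) u -> cmeas u.
Proof.
move=> /pconton_within[c1 c2].
by split; apply: subspace_continuous_measurable_fun => //; exact: measurable_angles.
Qed.

Lemma cmeasD u v : cmeas u -> cmeas v -> cmeas (fun t => u t + v t).
Proof.
move=> [u1 u2] [v1 v2]; split.
  by under eq_fun do rewrite ReD; exact: measurable_funD.
by under eq_fun do rewrite ImD; exact: measurable_funD.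
Qed.

Lemma cmeasZ (a : C) u : cmeas u -> cmeas (fun t => a * u t).
Proof.
move=> [u1 u2]; split.
  by under eq_fun do rewrite ReZ; apply: measurable_funB; apply: measurable_funM.
by under eq_fun do rewrite ImZ; apply: measurable_funD; apply: measurable_funM.
Qed.

Lemma cmeasB u v : cmeas u -> cmeas v -> cmeas (fun t => u t - v t).
Proof.
move=> hu hv; have := cmeasD hu (cmeasZ (-1) hv).
by under eq_fun do rewrite mulN1r.
Qed.

Lemma cmeas_sq u : cmeas u -> measurable_fun angles (fun t => (normc (u t) ^+ 2)%:E : \bar R).
Proof.
move=> [u1 u2]; apply/measurable_EFinP.
under eq_fun do rewrite sqr_normc_ReIm.
by apply: measurable_funD; apply: measurable_funX.
Qed.

Lemma sqi_ge0 u : (0 <= sqi u)%E.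
Proof. by apply: integral_ge0 => t _; rewrite lee_fin exprn_ge0// normc_ge0. Qed.

Lemma eq_sqi u v : (forall t, normc (u t) = normc (v t)) -> sqi u = sqi v.
Proof. by move=> h; apply: eq_integral => t _; rewrite h. Qed.

(** The pointwise inequality [(x + y) ^ 2 <= 2 x ^ 2 + 2 y ^ 2] serves in place of Minkowski's; the
    lost constants do not affect exponents. *)
Lemma sqiD u v : cmeas u -> cmeas v ->
  (sqi (fun t => (u t + v t)%R) <= 2%:E * sqi u + 2%:E * sqi v)%E.
Proof.
move=> hu hv; have mA := measurable_angles.
have p0 (w : R -> C) t : (0 <= (normc (w t) ^+ 2)%:E)%E by rewrite lee_fin exprn_ge0// normc_ge0.
rewrite /sqi -!ge0_integralZl_EFin//; [|exact: cmeas_sq..].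
rewrite -ge0_integralD//; first last.
- by apply: measurable_funeM; exact: cmeas_sq.
- by move=> t _; rewrite mule_ge0 ?p0// lee_fin.
- by apply: measurable_funeM; exact: cmeas_sq.
- by move=> t _; rewrite mule_ge0 ?p0// lee_fin.
apply: ge0_le_integral => //.
- by move=> t _; exact: (p0 (fun t => u t + v t)).
- by apply: cmeas_sq; exact: cmeasD.
- by apply: emeasurable_funD; apply: measurable_funeM; exact: cmeas_sq.
move=> t _; rewrite -!EFinM -EFinD lee_fin.
have h := le_normcD (u t) (v t).
have u0 := normc_ge0 (u t); have v0 := normc_ge0 (v t); have w0 := normc_ge0 (u t + v t).
move: h u0 v0 w0; move: (normc _) (normc _) (normc _) => x y z h y0 z0 x0.
have : z ^+ 2 <= (y + x) ^+ 2 by apply: expn_le.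
have := sqr_ge0 (y - x); rewrite !expr2; lra.
Qed.

Lemma sqi_bound u M : cmeas u -> 0 <= M -> (forall t, 0 <= t <= 2 * pi -> normc (u t) <= M) ->
  (sqi u <= (M ^+ 2 * (2 * pi))%:E)%E.
Proof.
move=> hu M0 hM.
have -> : (M ^+ 2 * (2 * pi))%:E = (\int[mu]_(t in angles) (cst (M ^+ 2)%:E) t)%E.
  rewrite integral_cst; last exact: measurable_angles.
  have E : mu angles = (2 * pi)%:E.
    by have := @lebesgue_measure_itv R `[0, 2 * pi]; rewrite /= lte_fin pi2_gt0 oppr0 adde0.
  by rewrite EFinM; congr (_ * _)%E; exact: esym E.
apply: ge0_le_integral; [exact: measurable_angles| |exact: cmeas_sq|exact: measurable_cst|].
  by move=> t _; rewrite lee_fin exprn_ge0// normc_ge0.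
move=> t; rewrite /Defs.angles /= in_itv /= => tb.
by rewrite lee_fin expn_le ?normc_ge0 ?hM.
Qed.

Lemma sqiZ (a : C) u : cmeas u -> sqi (fun t => (a * u t)%R) = ((normc a ^+ 2)%:E * sqi u)%E.
Proof.
move=> hu; rewrite /sqi -ge0_integralZl_EFin ?exprn_ge0 ?normc_ge0//.
- by apply: eq_integral => t _; rewrite normcM exprMn EFinM.
- exact: measurable_angles.
- by move=> t _; rewrite lee_fin exprn_ge0// normc_ge0.
- exact: cmeas_sq.
Qed.

(** The variance of [g] about its mean [m] is nonnegative. *)
Lemma Rint_sqr_le (g : R -> R) : (forall t, 0 <= t <= 2 * pi -> {for t, continuous g}) ->
  (\int[mu]_(t in `[0, 2 * pi]) g t) ^+ 2 <= 2 * pi * \int[mu]_(t in `[0, 2 * pi]) (g t ^+ 2).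
Proof.
move=> cg; set I := \int[mu]_(t in _) g t.
have int h : (forall t, 0 <= t <= 2 * pi -> {for t, continuous h}) -> mu.-integrable `[0, 2 * pi] (EFin \o h).
  move=> ch; apply: continuous_compact_integrable; first exact: segment_compact.
  by apply: continuous_in_subspaceT => t /set_mem; rewrite /= in_itv /= => /ch.
have P := pi2_gt0 R.
set Q := \int[mu]_(t in _) (g t ^+ 2).
pose m := I / (2 * pi).
have c2 t : 0 <= t <= 2 * pi -> {for t, continuous (fun t => g t ^+ 2)}.
  by move=> /cg c; apply: continuousM.
have c3 t : 0 <= t <= 2 * pi -> {for t, continuous (fun t => (- (2 * m)) * g t)}.
  by move=> /cg c; apply: continuousM; [exact: cst_continuous|exact: c].
have c4 (t : R) : 0 <= t <= 2 * pi -> {for t, continuous (fun=> m ^+ 2)}.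
  by move=> _; exact: cst_continuous.
have : 0 <= \int[mu]_(t in `[0, 2 * pi]) (g t ^+ 2 + (- (2 * m) * g t + m ^+ 2)).
  apply: Rintegral_ge0 => t _.
  have -> : g t ^+ 2 + (- (2 * m) * g t + m ^+ 2) = (g t - m) ^+ 2 by ring.
  exact: sqr_ge0.
rewrite RintegralD//; [|exact: int|]; last first.
  by apply: int => t ht; apply: continuousD; [exact: c3|exact: c4].
rewrite (RintegralD _ (int _ c3) (int _ c4))//.
rewrite (RintegralZl _ _ (int _ cg))//.
rewrite Rintegral_cst//= lebesgue_measure_itv /= lte_fin P /= oppr0 addr0 -/I -/Q.
have -> : Q + (- (2 * m) * I + m ^+ 2 * (2 * pi)) = Q - I ^+ 2 / (2 * pi).
  rewrite /m; clearbody I Q; move: (2 * pi) P => T P; field.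
  by rewrite gt_eqF.
by rewrite subr_ge0 ler_pdivrMr// mulrC.
Qed.

Lemma Cint_sqr_le (h : R -> C) : pconton 0 (2 * pi) h ->
  (((normc (Cint 0 (2 * pi) h) ^+ 2)%:E <= (2 * pi)%:E * sqi h))%E.
Proof.
move=> hc.
have int g : (forall t, 0 <= t <= 2 * pi -> {for t, continuous g}) -> mu.-integrable `[0, 2 * pi] (EFin \o g).
  move=> ch; apply: continuous_compact_integrable; first exact: segment_compact.
  by apply: continuous_in_subspaceT => t /set_mem; rewrite /= in_itv /= => /ch.
have c1 t : 0 <= t <= 2 * pi -> {for t, continuous (fun t => Re (h t))} by move=> /hc[].
have c2 t : 0 <= t <= 2 * pi -> {for t, continuous (fun t => Im (h t))} by move=> /hc[].
have c1' t : 0 <= t <= 2 * pi -> {for t, continuous (fun t => Re (h t) ^+ 2)} by move=> /c1 c; apply: continuousM.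
have c2' t : 0 <= t <= 2 * pi -> {for t, continuous (fun t => Im (h t) ^+ 2)} by move=> /c2 c; apply: continuousM.
have E : sqi h = (\int[mu]_(t in `[0%R, 2 * pi]) (Re (h t) ^+ 2) + \int[mu]_(t in `[0%R, 2 * pi]) (Im (h t) ^+ 2))%:E.
  rewrite -RintegralD//; [|exact: int|exact: int].
  rewrite /sqi /Rintegral fineK.
    by apply: eq_integral => t _; rewrite sqr_normc_ReIm.
  apply: integrable_fin_num => //.
  by apply: int => t ht; apply: continuousD; [exact: c1'|exact: c2'].
rewrite E -EFinM lee_fin sqr_normc_ReIm (mulrDr (2 * pi)).
exact: (lerD (Rint_sqr_le c1) (Rint_sqr_le c2)).
Qed.

Lemma lc_sqi f r n : 0 < r -> circcont f r ->
  ((normc (lc f r n) ^+ 2)%:E <= ((2 * pi)^-1 * (r ^ (- n)) ^+ 2)%:E * sqi (fun t => f (r%:C * expi t)%R))%E.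
Proof.
move=> r0 cf; have P := pi2_gt0 R.
pose h t := f (r%:C * expi t) * (r%:C * expi t) ^ (- n).
have ch : pconton 0 (2 * pi) h by move=> t ht; apply: pcontM; [exact: cf|exact: pcont_polar_exprz].
have := Cint_sqr_le ch.
have -> : sqi h = (((r ^ (- n)) ^+ 2)%:E * sqi (fun t => f (r%:C * expi t)%R))%E.
  have := @sqiZ ((r ^ (- n))%:C) _ (cmeas_pconton cf).
  rewrite normc_real real_normK ?num_real// => <-; apply: eq_sqi => t.
  rewrite /h !normcM normc_exprz normcM normc_expi !normc_real mulr1 mulrC; congr (_ * _).
  by rewrite gtr0_norm// ger0_norm// exprz_ge0// ltW.
rewrite /lc /circint -/h normcM normc_real gtr0_norm ?invr_gt0// => H.
rewrite exprMn EFinM.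
apply: le_trans (lee_wpmul2l _ H) _; first by rewrite lee_fin exprn_ge0// invr_ge0 ltW.
rewrite !muleA -!EFinM le_eqVlt; apply/orP; left; apply/eqP; congr (_%:E * _)%E.
by move: (2 * pi) P => T P; field; rewrite gt_eqF.
Qed.

(** * Boundary extensions *)

Lemma cvg0_near (F : set_system R) {FF : ProperFilter F} (S : R -> \bar R) (P : set R) e :
  S @ F --> 0%E -> F P -> 0 < e -> exists2 r, P r & (S r < e%:E)%E.
Proof.
move=> /fine_cvgP[fS /cvgrPdist_lt cS] FP e0.
have h1 : F (fun r => S r \is a fin_num) := fS.
have h2 : F (fun r => `|0 - (fine \o S) r| < e) := cS e e0.
have [r [[Pr fr] h]] := @filter_ex _ _ FF _ (filterI (filterI FP h1) h2).
exists r => //; move: h; rewrite sub0r normrN => h.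
by rewrite -(fineK fr) lte_fin (le_lt_trans (ler_norm _)).
Qed.

Lemma le_sqi_lim (x : \bar R) (K : R) (y : \bar R) : 0 <= K ->
  (forall e : R, 0 < e -> (x <= K%:E * e%:E + y)%E) -> (x <= y)%E.
Proof.
move=> K0 H; apply/lee_addgt0Pr => e e0; rewrite addeC.
have K1 : 0 < 1 + K by rewrite ltr_pwDl.
apply: le_trans (H (e / (1 + K)) (divr_gt0 e0 K1)) _.
rewrite leeD2r// -EFinM lee_fin mulrCA ler_piMr ?(ltW e0)//.
by rewrite ler_pdivrMr// mul1r lerDr.
Qed.

Definition bext_sq (F : set_system R) f := fine (sqi (boundary_extension F f)).

Lemma boundary_extensionP (F : set_system R) f : (exists phi, is_boundary_extension F f phi) ->
  is_boundary_extension F f (boundary_extension F f).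
Proof. by move=> h; exact: (@xgetPex _ _ [set phi | is_boundary_extension F f phi]). Qed.

Lemma square_integrable_cmeas phi : square_integrable phi -> cmeas phi /\ sqi phi \is a fin_num.
Proof. by move=> [m1 m2 lt]; split=> //; rewrite ge0_fin_numE// sqi_ge0. Qed.

Lemma H2normE rho f : H2norm rho f =
  Num.sqrt ((2 * pi)^-1 * (bext_sq rho^'+ f + bext_sq rho^-1^'- f)).
Proof. by []. Qed.

Lemma bext_sq_ge0 F f : 0 <= bext_sq F f.
Proof. by apply: fine_ge0; exact: sqi_ge0. Qed.

(* Letting [r] follow [F] bounds the coefficients by the boundary values. *)
Lemma lc_bext (F : set_system R) {FF : ProperFilter F} f (P : set R) n (c : C) K : F P -> 0 <= K ->
  (exists phi, is_boundary_extension F f phi) ->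
  (forall r, P r -> [/\ 0 < r, circcont f r, c = lc f r n & r ^ (- n) <= K]) ->
  normc c ^+ 2 <= (2 * pi)^-1 * K ^+ 2 * (2 * bext_sq F f).
Proof.
move=> FP K0 hphi hP; have [sphi cphi] := boundary_extensionP hphi.
have [mphi fphi] := square_integrable_cmeas sphi.
have P0 := pi2_gt0 R.
have k0 : 0 <= (2 * pi)^-1 * K ^+ 2 by rewrite mulr_ge0 ?exprn_ge0// invr_ge0 ltW.
rewrite -lee_fin; set phi := boundary_extension F f in sphi cphi mphi fphi.
have -> : ((2 * pi)^-1 * K ^+ 2 * (2 * bext_sq F f))%:E = (((2 * pi)^-1 * K ^+ 2)%:E * (2%:E * sqi phi))%E.
  by rewrite !EFinM /bext_sq fineK.
apply: (@le_sqi_lim _ ((2 * pi)^-1 * K ^+ 2 * 2)) => [|e e0]; first by rewrite mulr_ge0.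
have [r Pr Sr] := cvg0_near cphi FP e0.
have [r0 cf -> rK] := hP r Pr.
apply: le_trans (lc_sqi n r0 cf) _.
have mf := cmeas_pconton cf.
apply: le_trans (_ : ((2 * pi)^-1 * K ^+ 2)%:E * (2%:E * sqi (fun t => (f (r%:C * expi t) - phi t)%R) + 2%:E * sqi phi) <= _)%E.
  apply: lee_pmul; [|exact: sqi_ge0| |].
  - by rewrite lee_fin mulr_ge0 ?exprn_ge0 ?exprz_ge0 ?(ltW r0)// invr_ge0 ltW.
  - rewrite lee_fin ler_wpM2l ?invr_ge0 ?(ltW P0)// expn_le ?exprz_ge0 ?(ltW r0)//.
  - have := sqiD (cmeasB mf mphi) mphi.
    by rewrite (_ : (fun t => _) = (fun t => f (r%:C * expi t))); [|apply/funext => t; rewrite subrK].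
rewrite ge0_muleDr; [|by rewrite mule_ge0 ?sqi_ge0// lee_fin..].
apply: leeD => //; rewrite !EFinM -!muleA.
by do 4!(apply: lee_wpmul2l; first by rewrite lee_fin ?invr_ge0 ?(ltW P0)); exact: ltW.
Qed.

Lemma bext_sq_bound (F : set_system R) {FF : ProperFilter F} f (P : set R) M : F P -> 0 <= M ->
  (exists phi, is_boundary_extension F f phi) ->
  (forall r, P r -> circcont f r /\ forall t, 0 <= t <= 2 * pi -> normc (f (r%:C * expi t)) <= M) ->
  bext_sq F f <= 2 * (M ^+ 2 * (2 * pi)).
Proof.
move=> FP M0 hphi hP; have [sphi cphi] := boundary_extensionP hphi.
have [mphi fphi] := square_integrable_cmeas sphi.
rewrite -lee_fin /bext_sq fineK//; set phi := boundary_extension F f in sphi cphi mphi fphi *.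
apply: (@le_sqi_lim _ 2) => // e e0.
have [r Pr Sr] := cvg0_near cphi FP e0.
have [cf hM] := hP r Pr; have mf := cmeas_pconton cf.
have := sqiD (cmeasB mphi mf) mf.
rewrite (_ : (fun t => _) = phi); [move=> h|by apply/funext => t; rewrite subrK].
apply: le_trans h _; apply: leeD.
  apply: lee_wpmul2l; first by rewrite lee_fin.
  by rewrite (eq_sqi (v := fun t => f (r%:C * expi t) - phi t)) ?ltW// => t; rewrite distcC.
rewrite EFinM; apply: lee_wpmul2l; first by rewrite lee_fin.
exact: sqi_bound.
Qed.

(** * The Hardy space *)

Section Rho.
Variable rho : R.
Hypothesis rho0 : 0 < rho.
Hypothesis rho1 : rho < 1.

Lemma H2_holo f : H2 rho f -> holo_on (annulus rho) f.
Proof. by move=> [h _ _ _] z /h; exact: derivable_cdiff. Qed.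

Lemma one_in : rho < 1 < rho^-1.
Proof. by rewrite rho1 invf_gt1. Qed.

Lemma rho_lt_inv : rho < rho^-1.
Proof. by apply: lt_trans rho1 _; case/andP: one_in. Qed.

Definition cf (f : C -> C) (n : int) : C := lc f 1 n.

(** A nonnegative index is estimated on circles tending to the outer boundary, where
    [r ^ (- n) <= q ^+ n] once [r > q^-1]; a negative one on circles tending to the inner boundary,
    once [r < q]. Since [q > rho], such radii belong to the respective filter. *)
Lemma H2_gbound f q : H2 rho f -> rho < q -> q < 1 -> gbound (cf f) (2 * H2norm rho f) q.
Proof.
have aux1 (x y : R) : 0 <= x -> y <= x + y by lra.
have aux2 (x y : R) : 0 <= y -> x <= x + y by lra.
have aux (x y b : R) : b <= x + y -> 0 <= x -> 0 <= y -> 2 * b <= 4 * (x + y) by lra.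
move=> Hf rq q1 n; have hf := H2_holo Hf; case: Hf => _ _ e1 e2.
have P := pi2_gt0 R.
have q0 : 0 < q by apply: lt_trans rq.
have N0 : 0 <= 2 * H2norm rho f by rewrite mulr_ge0// sqrtr_ge0.
rewrite -(@ler_pXn2r _ 2)// ?nnegrE ?normc_ge0 ?mulr_ge0 ?exprn_ge0 ?(ltW q0)//.
have HN : H2norm rho f ^+ 2 = (2 * pi)^-1 * (bext_sq rho^'+ f + bext_sq rho^-1^'- f).
  by rewrite H2normE sqr_sqrtr// mulr_ge0 ?invr_ge0 ?(ltW P)// addr_ge0 ?bext_sq_ge0.
rewrite exprMn exprMn HN.
have cr r : rho < r < rho^-1 -> circcont f r by exact: (holo_circcont rho0 hf).
have b1 := bext_sq_ge0 rho^'+ f; have b2 := bext_sq_ge0 rho^-1^'- f.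
suff [b bE le] : exists2 b : R, b <= bext_sq rho^'+ f + bext_sq rho^-1^'- f &
    normc (cf f n) ^+ 2 <= (2 * pi)^-1 * (q ^+ `|n|) ^+ 2 * (2 * b).
  apply: le_trans le _.
  have -> : 2 ^+ 2 * ((2 * pi)^-1 * (bext_sq rho^'+ f + bext_sq rho^-1^'- f)) * (q ^+ `|n|) ^+ 2 =
     (2 * pi)^-1 * (q ^+ `|n|) ^+ 2 * (4 * (bext_sq rho^'+ f + bext_sq rho^-1^'- f)).
    by move: (bext_sq _ _ + _) ((2 * pi)^-1) => *; ring.
  rewrite ler_wpM2l ?mulr_ge0 ?exprn_ge0 ?invr_ge0 ?(ltW P) ?(ltW q0)//.
  exact: aux bE b1 b2.
have K0 n' : 0 <= q ^+ n' by rewrite exprn_ge0// ltW.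
case: n => n.
  exists (bext_sq rho^-1^'- f); first exact: aux1 b1.
  have FP : (rho^-1^'-) [set r | q^-1 < r < rho^-1].
    apply: filterS2 (nbhs_left_lt rho^-1) (nbhs_left_gt (_ : q^-1 < rho^-1)); last by rewrite ltf_pV2 ?posrE.
    by move=> r r1 r2; rewrite /= r1 r2.
  have hP r : [set r | q^-1 < r < rho^-1] r -> [/\ 0 < r, circcont f r, cf f n = lc f r n & r ^ (- n%:Z) <= q ^+ n].
    move=> /andP[r1 r2]; have q'0 : 0 < q^-1 by rewrite invr_gt0.
    have r0 : 0 < r by apply: lt_trans r1.
    have rr : rho < r < rho^-1.
      by rewrite r2 andbT (lt_trans _ r1)// (lt_trans rho1)// invf_gt1.
    split; [exact: r0|exact: cr|exact: (lc_radius n rho0 hf one_in rr)|].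
    by rewrite -exprnN -exprVn expn_le ?invr_ge0 ?(ltW r0)// -[q]invrK lef_pV2 ?posrE// ltW.
  exact: (lc_bext FP (K0 n) e2 hP).
exists (bext_sq rho^'+ f); first exact: aux2 b2.
have FP : (rho^'+) [set r | rho < r < q].
  by apply: filterS2 (nbhs_right_gt rho) (nbhs_right_lt rq) => r r1 r2; rewrite /= r1 r2.
have hP r : [set r | rho < r < q] r ->
    [/\ 0 < r, circcont f r, cf f (Negz n) = lc f r (Negz n) & r ^ (- Negz n) <= q ^+ n.+1].
  move=> /andP[r1 r2]; have r0 : 0 < r by apply: lt_trans r1.
  have rr : rho < r < rho^-1.
    by rewrite r1 (lt_trans r2)// (lt_trans q1)// invf_gt1.
  split; [exact: r0|exact: cr|exact: (lc_radius (Negz n) rho0 hf one_in rr)|].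
  by rewrite NegzE opprK -exprnP expn_le ?(ltW r0)// ltW.
- exact: (lc_bext FP (K0 n.+1) e1 hP).
- exact: sqrtr_ge0.
Qed.

Lemma H2_lsum f z : H2 rho f -> annulus rho z -> f z = lsum (cf f) z.
Proof. by move=> /H2_holo hf; exact: laurent. Qed.

(** On the annulus both functions are the sum of the same Laurent series, and elsewhere both are 0.
    Identities between operators are thereby checked coefficient by coefficient. *)
Lemma H2_ext f g : H2 rho f -> H2 rho g -> (forall n, cf f n = cf g n) -> f = g.
Proof.
move=> Hf Hg E; apply/funext => z; have [zA|zA] := pselect (annulus rho z).
  rewrite (H2_lsum Hf zA) (H2_lsum Hg zA).
  by have -> : cf f = cf g by apply/funext => n; exact: E.
by case: Hf => _ -> // _ _; case: Hg => _ -> // _ _.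
Qed.

Lemma H2_circcont f : H2 rho f -> circcont f 1.
Proof. by move=> /H2_holo hf; exact: (holo_circcont rho0 hf one_in). Qed.

Lemma bextP_lin (F : set_system R) {FF : ProperFilter F} (a : C) f g phi psi : F [set r | circcont f r /\ circcont g r] ->
  is_boundary_extension F f phi -> is_boundary_extension F g psi ->
  is_boundary_extension F (fun z => a * f z + g z) (fun t => a * phi t + psi t).
Proof.
move=> Fc [sf cvf] [sg cvg].
have [mf ff] := square_integrable_cmeas sf; have [mg fg] := square_integrable_cmeas sg.
have [m1 m2] := cmeasD (cmeasZ a mf) mg.
split.
  split=> //; apply: le_lt_trans (sqiD (cmeasZ a mf) mg) _.
  have Lf : (sqi phi < +oo)%E by case: sf.
  have Lg : (sqi psi < +oo)%E by case: sg.
  rewrite sqiZ//; apply: lte_add_pinfty; apply: lte_mul_pinfty => //; rewrite ?lee_fin//.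
  by apply: lte_mul_pinfty; rewrite ?lee_fin ?exprn_ge0 ?normc_ge0.
apply: (@squeeze_cvge _ _ _ _ (fun=> 0%E) _ (fun r => 2%:E * ((normc a ^+ 2)%:E * sqi (fun t => (f (r%:C * expi t) - phi t)%R)) +
     2%:E * sqi (fun t => (g (r%:C * expi t) - psi t)%R))%E).
- apply: filterS Fc => r [cf1 cg1]; apply/andP; split.
    by apply: (sqi_ge0 (fun t => (a * f (r%:C * expi t) + g (r%:C * expi t) - (a * phi t + psi t))%R)).
  have h1 := cmeasB (cmeas_pconton cf1) mf; have h2 := cmeasB (cmeas_pconton cg1) mg.
  rewrite -sqiZ//; apply: le_trans (sqiD (cmeasZ a h1) h2).
  rewrite le_eqVlt; apply/orP; left; apply/eqP; apply: (eq_sqi (u := fun t => _)) => t; congr normc; ring.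
- exact: cvg_cst.
- have -> : 0%E = (2%:E * ((normc a ^+ 2)%:E * 0) + 2%:E * 0)%E :> \bar R by rewrite !mule0 adde0.
  apply: cvgeD; first by rewrite !mule0.
    by apply: cvgeZl => //; apply: cvgeZl.
  by apply: cvgeZl.
Qed.

Lemma H2_lin (a : C) f g : H2 rho f -> H2 rho g -> H2 rho (fun z => a * f z + g z).
Proof.
move=> Hf Hg; have hf := H2_holo Hf; have hg := H2_holo Hg.
have cc r : rho < r < rho^-1 -> circcont f r /\ circcont g r.
  by move=> rr; split; [exact: (holo_circcont rho0 hf rr)|exact: (holo_circcont rho0 hg rr)].
have rr := rho_lt_inv.
case: Hf => _ f0 [p1 f1] [p2 f2]; case: Hg => _ g0 [q1 g1] [q2 g2]; split.
- move=> z zA; have [l hl] := hf z zA; have [m hm] := hg z zA.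
  exact: cdiff_derivable (cdiffD (cdiffM (cdiff_cst a z) hl) hm).
- by move=> z zA; rewrite f0// g0// mulr0 addr0.
- exists (fun t => a * p1 t + q1 t); apply: bextP_lin => //.
  by apply: filterS2 (nbhs_right_gt rho) (nbhs_right_lt rr) => r r1 r2; apply: cc; rewrite r1 r2.
- exists (fun t => a * p2 t + q2 t); apply: bextP_lin => //.
  by apply: filterS2 (nbhs_left_lt rho^-1) (nbhs_left_gt rr) => r r1 r2; apply: cc; rewrite r1 r2.
Qed.

Lemma cf_lin (a : C) f g n : H2 rho f -> H2 rho g ->
  cf (fun z => a * f z + g z) n = a * cf f n + cf g n.
Proof.
move=> Hf Hg; rewrite /cf lcD ?lcZ//; [exact: H2_circcont|apply: circcontM|exact: H2_circcont].
  exact: circcont_cst.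
exact: H2_circcont.
Qed.

(** * Synthesis of elements of the Hardy space *)

Definition lsynth (c : int -> C) (z : C) : C :=
  if rho < normc z < rho^-1 then lsum c z else 0.

Lemma pow_lip (w z : C) (r : R) k : normc w <= r -> normc z <= r ->
  normc (w ^+ k - z ^+ k) * r <= k%:R * r ^+ k * normc (w - z).
Proof.
move=> wr zr; have r0 : 0 <= r by apply: le_trans wr; exact: normc_ge0.
elim: k => [|k IH]; first by rewrite !expr0 subrr normc_0 !mul0r.
have -> : w ^+ k.+1 - z ^+ k.+1 = w * (w ^+ k - z ^+ k) + z ^+ k * (w - z) by rewrite !exprS; ring.
apply: le_trans (ler_wpM2r r0 (le_normcD _ _)) _; rewrite mulrDl !normcM normcX.
have h1 : normc w * normc (w ^+ k - z ^+ k) * r <= r * (k%:R * r ^+ k * normc (w - z)).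
  by rewrite -mulrA; apply: ler_pM; rewrite ?normc_ge0 ?mulr_ge0 ?normc_ge0.
have h2 : normc z ^+ k * normc (w - z) * r <= r ^+ k * normc (w - z) * r.
  by rewrite !ler_wpM2r ?normc_ge0// expn_le ?normc_ge0.
apply: le_trans (lerD h1 h2) _.
by rewrite le_eqVlt; apply/orP; left; apply/eqP; rewrite exprS -natr1; move: (k%:R : R) (r ^+ k) => *; ring.
Qed.

Lemma Psum_lip (a : nat -> C) B q r : 0 <= B -> 0 < q -> 0 < r -> q * r < 1 ->
  (forall k, normc (a k) <= B * q ^+ k) ->
  exists2 K, 0 <= K & forall w z, normc w <= r -> normc z <= r ->
    normc (Psum a w - Psum a z) <= K * normc (w - z).
Proof.
move=> B0 q0 r0 qr ha.
have x01 : 0 <= q * r < 1 by rewrite qr mulr_ge0// ltW.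
have [y [K [y01 K0 xy hK]]] := nat_geo x01.
have conv w : normc w <= r -> sconv (fun N => \sum_(k < N) a k * w ^+ k) (Psum a w).
  move=> wr; apply: (@Csum_conv _ _ B (q * r)) => // k.
  rewrite normcM normcX exprMn mulrA; apply: ler_pM; rewrite ?normc_ge0 ?ha ?exprn_ge0 ?normc_ge0//.
  by rewrite expn_le ?normc_ge0.
have y1 : 0 < 1 - y by rewrite subr_gt0; case/andP: y01.
exists (B * K / (1 - y) / r); first by rewrite !mulr_ge0// invr_ge0 ltW.
move=> w z wr zr; have := sconvB (conv w wr) (conv z zr).
move/sconv_le; apply => N; rewrite -sumrB; apply: le_trans (le_normc_sum _ _ _) _.
apply: le_trans (_ : \sum_(k < N) (B * K / r * normc (w - z)) * y ^+ k <= _).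
  apply: ler_sum => k _; rewrite -mulrBr normcM.
  have := pow_lip k wr zr; rewrite -ler_pdivlMr// => /(ler_pM (normc_ge0 _) (normc_ge0 _) (ha k)).
  move=> /le_trans; apply.
  have -> : B * q ^+ k * (k%:R * r ^+ k * normc (w - z) / r) = (B / r * normc (w - z)) * (k%:R * (q * r) ^+ k).
    by rewrite exprMn; move: (k%:R : R) (q ^+ k) (r ^+ k) => *; ring.
  have -> : B * K / r * normc (w - z) * y ^+ k = (B / r * normc (w - z)) * (K * y ^+ k) by ring.
  by rewrite ler_wpM2l// !mulr_ge0 ?invr_ge0 ?normc_ge0// ltW.
rewrite -mulr_sumr.
have -> : B * K / (1 - y) / r * normc (w - z) = B * K / r * normc (w - z) * (1 - y)^-1 by ring.
by rewrite ler_wpM2l ?geo_sum_le// !mulr_ge0 ?invr_ge0 ?normc_ge0// ltW.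
Qed.

Variable q : R.
Hypothesis q0 : 0 < q.
Hypothesis qrho : q < rho.

(** The constant of [lsum_tail] at [N = 0], with ratio [x = q / rho] valid on the closed annulus. *)
Definition lsum_cst : R := 4 / (1 - q / rho).

Lemma qr1 : q / rho < 1. Proof. by rewrite ltr_pdivrMr// mul1r. Qed.

Lemma lsum_cst_ge0 : 0 <= lsum_cst.
Proof. by rewrite divr_ge0// subr_ge0 ltW// qr1. Qed.

Lemma closed_annulus z : rho <= normc z <= rho^-1 -> q < normc z < q^-1.
Proof. by move=> /andP[h1 h2]; rewrite (lt_le_trans qrho)// (le_lt_trans h2)// ltf_pV2 ?posrE. Qed.

Lemma lsum_bound c B z : gbound c B q -> rho <= normc z <= rho^-1 -> normc (lsum c z) <= lsum_cst * B.
Proof.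
move=> hc /andP[z1 z2]; have z0 : 0 < normc z by apply: lt_le_trans z1.
have := @lsum_tail _ c B q z (q / rho) 0 q0 hc qr1.
rewrite /lpart big_ord0 sub0r normcN expr0 mulr1 => h.
rewrite /lsum_cst mulrAC; apply: h; first by rewrite ler_wpM2l// ltW.
by rewrite normcV ler_wpM2l ?(ltW q0)// lef_pV2 ?posrE.
Qed.

(** Decay at a rate [q < rho] makes the series converge beyond the boundary. The Lipschitz bound on
    the closed annulus gives the convergence of the values on inner circles to those on the
    boundary, uniformly in the angle. *)
Lemma lsum_lip c B : gbound c B q -> exists2 K, 0 <= K &
  forall w z, rho <= normc w <= rho^-1 -> rho <= normc z <= rho^-1 ->
    normc (lsum c w - lsum c z) <= K * normc (w - z).
Proof.
move=> hc; have B0 := gbound_ge0 hc.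
have r'0 : 0 < rho^-1 by rewrite invr_gt0.
have hc' k : normc (c (Negz k)) <= B * q * q ^+ k.
  by apply: le_trans (hc _) _; rewrite -[`|Negz k|%N]/k.+1 exprS mulrA.
have Bq : 0 <= B * q by rewrite mulr_ge0// ltW.
have [K1 K10 h1] := @Psum_lip (fun k => c (Posz k)) B q rho^-1 B0 q0 r'0 qr1 hc.
have [K2 K20 h2] := @Psum_lip (fun k => c (Negz k)) (B * q) q rho^-1 Bq q0 r'0 qr1 hc'.
pose M2 := 2 * (B * q) / (1 - q / rho).
have x01 : 0 <= q / rho < 1 by rewrite qr1 divr_ge0// ltW.
have hM v : normc v <= rho^-1 -> normc (Psum (fun k => c (Negz k)) v) <= M2.
  move=> vr; have := @Csum_tail _ (fun k => c (Negz k) * v ^+ k) (B * q) (q / rho) 0 x01 Bq.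
  rewrite big_ord0 sub0r normcN expr0 mulr1; apply => k.
  rewrite normcM normcX exprMn mulrA; apply: ler_pM; rewrite ?normc_ge0 ?hc' ?exprn_ge0 ?normc_ge0//.
  by rewrite expn_le ?normc_ge0.
have M20 : 0 <= M2 by apply: le_trans (hM 0 _); rewrite ?normc_ge0// normc_0 ltW.
exists (K1 + (M2 * rho^-1 ^+ 2 + rho^-1 * K2 * rho^-1 ^+ 2)).
  have r2 : 0 <= rho^-1 ^+ 2 by rewrite exprn_ge0// ltW.
  by apply: addr_ge0 => //; apply: addr_ge0; apply: mulr_ge0 => //; apply: mulr_ge0 => //; exact: ltW.
move=> w z /andP[w1 w2] /andP[z1 z2].
have w0 : 0 < normc w by apply: lt_le_trans w1.
have z0 : 0 < normc z by apply: lt_le_trans z1.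
have wV : normc w^-1 <= rho^-1 by rewrite normcV lef_pV2 ?posrE.
have zV : normc z^-1 <= rho^-1 by rewrite normcV lef_pV2 ?posrE.
have dV : normc (w^-1 - z^-1) <= rho^-1 ^+ 2 * normc (w - z).
  have -> : w^-1 - z^-1 = w^-1 * z^-1 * (z - w).
    by field; rewrite -!normc_gt0 w0 z0.
  rewrite !normcM expr2 (distcC z); apply: ler_wpM2r; first exact: normc_ge0.
  by apply: ler_pM; rewrite ?normc_ge0.
rewrite /lsum; set P1 := Psum _; set P2 := Psum _.
have -> : P1 w + w^-1 * P2 w^-1 - (P1 z + z^-1 * P2 z^-1) =
  (P1 w - P1 z) + ((w^-1 - z^-1) * P2 w^-1 + z^-1 * (P2 w^-1 - P2 z^-1)).
  by move: (P1 w) (P1 z) (P2 w^-1) (P2 z^-1) => *; ring.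
apply: le_trans (le_normcD _ _) _; rewrite [leRHS]mulrDl; apply: lerD; first exact: h1.
apply: le_trans (le_normcD _ _) _; rewrite [leRHS]mulrDl !normcM; apply: lerD.
  rewrite mulrC -mulrA; apply: ler_pM; rewrite ?normc_ge0 ?hM//.
rewrite -!mulrA; apply: ler_pM; rewrite ?normc_ge0//.
by apply: le_trans (h2 _ _ wV zV) _; rewrite ler_wpM2l// mulrA -expr2.
Qed.

Lemma lsynth_circ c r t : rho < r < rho^-1 -> lsynth c (r%:C * expi t) = lsum c (r%:C * expi t).
Proof.
move=> rr; rewrite /lsynth normcM normc_expi normc_real mulr1 gtr0_norm ?rr//.
by case/andP: rr => + _; exact: lt_trans.
Qed.

Lemma normc_circ (r t : R) : 0 < r -> normc (r%:C * expi t) = r.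
Proof. by move=> r0; rewrite normcM normc_expi normc_real mulr1 gtr0_norm. Qed.

Lemma lsum_circcont c B r : gbound c B q -> rho <= r <= rho^-1 -> circcont (lsum c) r.
Proof.
move=> hc rr; have r0 : 0 < r by apply: lt_le_trans rho0 _; case/andP: rr.
apply: ccont_circcont => t.
have := @closed_annulus (r%:C * expi t); rewrite normc_circ// => /(_ rr) h.
have [|l] := lsum_cdiff q0 hc (z := r%:C * expi t); first by rewrite normc_circ.
exact: cdiff_cont.
Qed.

Lemma lsynth_circcont c B r : gbound c B q -> rho < r < rho^-1 -> circcont (lsynth c) r.
Proof.
move=> hc rr; have := @lsum_circcont c B r hc; rewrite !ltW ?andbT; case/andP: (rr) => // r1 r2.
move=> /(_ isT) h t ht; have := h t ht.
by rewrite (_ : (fun t => lsynth c _) = (fun t => lsum c (r%:C * expi t)))//; apply/funext => s; rewrite lsynth_circ.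
Qed.

Lemma lsynth_bext (F : set_system R) {FF : ProperFilter F} c B (r0 : R) : gbound c B q ->
  rho <= r0 <= rho^-1 -> F [set r | rho < r < rho^-1] -> (fun r => `|r - r0|) @ F --> 0 ->
  is_boundary_extension F (lsynth c) (fun t => lsum c (r0%:C * expi t)).
Proof.
move=> hc rr FA Fr.
have r00 : 0 < r0 by apply: lt_le_trans rho0 _; case/andP: rr.
have cphi := lsum_circcont hc rr.
have B0 := gbound_ge0 hc.
have [m1 m2] := cmeas_pconton cphi.
split.
  split=> //; apply: le_lt_trans (sqi_bound (M := lsum_cst * B) (conj m1 m2) _ _) (ltry _).
    by rewrite mulr_ge0// lsum_cst_ge0.
  by move=> t _; apply: lsum_bound => //; rewrite normc_circ.
have [K K0 hK] := lsum_lip hc.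
apply: (@squeeze_cvge _ _ _ _ (fun=> 0%E) _ (fun r => ((K * `|r - r0|) ^+ 2 * (2 * pi))%:E)).
- apply: filterS FA => r rA; apply/andP; split.
    exact: (sqi_ge0 (fun t => lsynth c (r%:C * expi t) - lsum c (r0%:C * expi t))).
  apply: (sqi_bound (u := fun t => lsynth c (r%:C * expi t) - lsum c (r0%:C * expi t))).
  + by apply: cmeasB; apply: cmeas_pconton => //; exact: (lsynth_circcont hc).
  + by rewrite mulr_ge0.
  move=> t _; rewrite lsynth_circ//.
  have rp : 0 < r by case/andP: rA => + _; exact: lt_trans.
  have := @hK (r%:C * expi t) (r0%:C * expi t); rewrite !normc_circ// => h.
  apply: le_trans (h _ rr) _; first by case/andP: rA => /ltW -> /ltW ->.
  rewrite ler_wpM2l//.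
  have -> : r%:C * expi t - r0%:C * expi t = (r - r0)%:C * expi t by rewrite rmorphB mulrBl.
  by rewrite normcM normc_expi mulr1 normc_real.
- exact: cvg_cst.
- apply: cvg_EFin; first by near=> r.
  have -> : 0 = (K * 0) ^+ 2 * (2 * pi) :> R by rewrite mulr0 expr0n mul0r.
  apply: cvgMl; apply: (@cvgM _ _ _ _ (fun r => K * `|r - r0|) (fun r => K * `|r - r0|)); exact: cvgMr.
Unshelve. all: by end_near. Qed.

Lemma cvg_dist_right (x : R) : (fun r => `|r - x|) @ x^'+ --> (0 : R).
Proof.
have -> : 0 = `|x - x| by rewrite subrr normr0.
apply: cvg_at_right_filter; apply: cvg_norm; apply: cvgB; [exact: cvg_id|exact: cvg_cst].
Qed.

Lemma cvg_dist_left (x : R) : (fun r => `|r - x|) @ x^'- --> (0 : R).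
Proof.
have -> : 0 = `|x - x| by rewrite subrr normr0.
apply: cvg_at_left_filter; apply: cvg_norm; apply: cvgB; [exact: cvg_id|exact: cvg_cst].
Qed.

Lemma near_right_annulus : (rho^'+) [set r | rho < r < rho^-1].
Proof.
by apply: filterS2 (nbhs_right_gt rho) (nbhs_right_lt rho_lt_inv) => r r1 r2; rewrite /= r1 r2.
Qed.

Lemma near_left_annulus : (rho^-1^'-) [set r | rho < r < rho^-1].
Proof.
by apply: filterS2 (nbhs_left_lt rho^-1) (nbhs_left_gt rho_lt_inv) => r r1 r2; rewrite /= r1 r2.
Qed.

Lemma lsynth_H2 c B : gbound c B q -> H2 rho (lsynth c).
Proof.
move=> hc; have rr := ltW rho_lt_inv; split.
- move=> z zA; have /andP[z1 z2] := zA.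
  have [|l hl] := lsum_cdiff q0 hc (z := z); first by apply: closed_annulus; rewrite !ltW.
  pose d := Num.min (normc z - rho) (rho^-1 - normc z).
  have d0 : 0 < d by rewrite lt_min !subr_gt0 z1.
  apply: cdiff_derivable (cdiff_near d0 _ hl) => w.
  rewrite lt_min => /andP[w1 w2]; have := le_distc_normc w z; rewrite ler_distl => /andP[w3 w4].
  by rewrite /lsynth ifT//; apply/andP; split; [move: w1 w3|move: w2 w4]; lra.
- by move=> z /negP/negPf zA; rewrite /lsynth -[rho < _ < _]/(_ : bool) zA.
- exists (fun t => lsum c (rho%:C * expi t)); apply: lsynth_bext hc _ _ _ => //.
  + by rewrite lexx.
  + exact: near_right_annulus.
  + exact: cvg_dist_right.
- exists (fun t => lsum c (rho^-1%:C * expi t)); apply: lsynth_bext hc _ _ _ => //.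
  + by rewrite lexx rr.
  + exact: near_left_annulus.
  + exact: cvg_dist_left.
Qed.

(** The counterpart of [H2_gbound]: there the norm controls the coefficients at rates above [rho],
    here coefficients decaying at a rate below [rho] control the norm. *)
Lemma lsynth_norm c B : gbound c B q -> H2norm rho (lsynth c) <= 2 * (lsum_cst * B).
Proof.
move=> hc; have B0 := gbound_ge0 hc; have P := pi2_gt0 R.
have M0 : 0 <= lsum_cst * B by rewrite mulr_ge0// lsum_cst_ge0.
have [_ _ e1 e2] := lsynth_H2 hc.
have hP r : rho < r < rho^-1 -> circcont (lsynth c) r /\ forall t, 0 <= t <= 2 * pi -> normc (lsynth c (r%:C * expi t)) <= lsum_cst * B.
  move=> rr; split; first exact: (lsynth_circcont hc).
  move=> t _; rewrite lsynth_circ//; apply: lsum_bound => //.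
  rewrite normc_circ; last by case/andP: rr => + _; exact: lt_trans.
  by case/andP: rr => /ltW -> /ltW ->.
have b1 : bext_sq rho^'+ (lsynth c) <= 2 * ((lsum_cst * B) ^+ 2 * (2 * pi)).
  by apply: bext_sq_bound near_right_annulus M0 e1 hP.
have b2 : bext_sq rho^-1^'- (lsynth c) <= 2 * ((lsum_cst * B) ^+ 2 * (2 * pi)).
  by apply: bext_sq_bound near_left_annulus M0 e2 hP.
have K2 : 0 <= 2 * (lsum_cst * B) by rewrite mulr_ge0.
rewrite H2normE -(ger0_norm K2) -sqrtr_sqr ler_wsqrtr// mulrC ler_pdivrMr//.
apply: le_trans (lerD b1 b2) _; rewrite le_eqVlt; apply/orP; left; apply/eqP; ring.
Qed.

Lemma lsynth_cf c B n : gbound c B q -> cf (lsynth c) n = c n.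
Proof.
move=> hc; rewrite /cf -[RHS](@lc_lsum _ c B q 1 n q0 hc); last first.
  have := @closed_annulus 1; rewrite normc1; apply.
  by have /andP[/ltW -> /ltW ->] := one_in.
apply: eq_lc => // z z1; rewrite /lsynth z1.
by rewrite one_in.
Qed.
End Rho.
End HardySpace2.

(** * Inverse branches, and the operators in terms of Laurent coefficients *)

Section Branches.
Variable R : realType.
Local Notation C := R[i].
Local Notation Re := complex.Re.
Local Notation Im := complex.Im.
Implicit Types (b : bool) (u v y z : C) (f : C -> C).

(** Both maps are squares of a Moebius map, the identity for [b = false], so the two symbols are
    treated together. [moebius_inv'] is the derivative of [moebius_inv]. *)
Definition moebius b (y : C) : C := if b then (y + 4^-1) / (1 + y / 4) else y.
Definition moebius_inv b (u : C) : C := if b then (u - 4^-1) / (1 - u / 4) else u.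
Definition moebius_inv' b (u : C) : C := if b then (15 / 16) / (1 - u / 4) ^+ 2 else 1.

Lemma four_neq0 : 4 != 0 :> C. Proof. by rewrite pnatr_eq0. Qed.

Lemma T_mapE b y : T_map b y = moebius b y ^+ 2.
Proof. by case: b. Qed.

Lemma normc_nat n : normc (n%:R : C) = n%:R.
Proof. by rewrite -(rmorph_nat (real_complex R)) normc_real ger0_norm. Qed.

Lemma den_neq0 u : normc u < 4 -> 1 - u / 4 != 0.
Proof.
move=> u4; rewrite subr_eq0; apply/eqP => E; move: u4.
have -> : u = 4 by rewrite -[u](divfK four_neq0) -E mul1r.
by rewrite normc_nat ltxx.
Qed.

(** The disjunction excludes the pole of [moebius_inv true] at 4; the identity has no pole. *)
Lemma moebiusK b u : normc u < 4 \/ b = false -> moebius b (moebius_inv b u) = u.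
Proof.
case: b => // -[u4|//]; rewrite /moebius /moebius_inv; have := den_neq0 u4.
set w := 1 - u / 4; have -> : u = 4 * (1 - w) by rewrite /w; field.
move=> w0; have -> : 1 + (4 * (1 - w) - 4^-1) / w / 4 = 15 / 16 / w by field.
by field.
Qed.

(** At the pole [y = -4] the quotient is 0 by the convention on inverses, so a nonzero value shows
    that [y] is not the pole. *)
Lemma moebius_invK b y : moebius b y != 0 -> moebius_inv b (moebius b y) = y.
Proof.
case: b => //; rewrite /moebius /moebius_inv.
set w := 1 + y / 4; have -> : y = 4 * (w - 1) by rewrite /w; field.
have [->|w0 _] := eqVneq w 0; first by rewrite invr0 mulr0 eqxx.
have -> : 1 - (4 * (w - 1) + 4^-1) / w / 4 = 15 / 16 / w by field.
by field.
Qed.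

Lemma cdiff_moebius_inv b u : normc u < 4 \/ b = false ->
  cdiff (moebius_inv b) u (moebius_inv' b u).
Proof.
case: b => [[u4|//]|_]; last exact: cdiff_id.
have d0 := den_neq0 u4.
have dd : cdiff (fun w => 1 - w / 4) u (- 4^-1).
  have := cdiffD (cdiff_cst 1 u) (cdiffM (cdiff_id u) (cdiff_cst (- 4^-1) u)).
  rewrite mul1r mulr0 addr0 add0r.
  by rewrite (_ : (fun w => 1 + _) = (fun w => 1 - w / 4))//; apply/funext => w; rewrite mulrN.
have := cdiffM (cdiffD (cdiff_id u) (cdiff_cst (- 4^-1) u)) (cdiffV (f := fun w => 1 - w / 4) d0 dd).
move/cdiff_eq; apply; rewrite /moebius_inv'.
move: d0; set w := 1 - u / 4; have -> : u = 4 * (1 - w) by rewrite /w; field.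
by move=> w0; field.
Qed.

Lemma cdiff_moebius_inv' b u : normc u < 4 \/ b = false ->
  exists l, cdiff (moebius_inv' b) u l.
Proof.
case: b => [[u4|//]|_]; last by exists 0; exact: cdiff_cst.
have d0 := den_neq0 u4.
have dd : cdiff (fun w => 1 - w / 4) u (- 4^-1).
  have := cdiffD (cdiff_cst 1 u) (cdiffM (cdiff_id u) (cdiff_cst (- 4^-1) u)).
  rewrite mul1r mulr0 addr0 add0r.
  by rewrite (_ : (fun w => 1 + _) = (fun w => 1 - w / 4))//; apply/funext => w; rewrite mulrN.
have d20 : (1 - u / 4) ^+ 2 != 0 by rewrite expf_neq0.
by eexists; apply: (cdiffM (cdiff_cst (15 / 16) u) (cdiffV (f := fun w => (1 - w / 4) ^+ 2) d20 (cdiffX 1 dd))).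
Qed.

Lemma derive1_T_map b u : normc u < 4 \/ b = false -> u != 0 ->
  derive1 (T_map b : C^o -> C^o) (moebius_inv b u) = 2 * u / moebius_inv' b u.
Proof.
case: b => [[u4|//]|_] u0; last first.
  rewrite divr1; apply: cdiff_derive1; apply: cdiff_eq (cdiffX 1 (cdiff_id u)) _.
  by rewrite expr1 mulr1.
have := moebiusK (or_introl u4 : normc u < 4 \/ true = false); have d0 := den_neq0 u4.
rewrite /moebius; set y := moebius_inv true u => yE.
have eE : 1 + y / 4 = 15 / 16 / (1 - u / 4).
  move: d0; rewrite /y /moebius_inv; set w := 1 - u / 4; have -> : u = 4 * (1 - w) by rewrite /w; field.
  by move=> w0; field.
have e0 : 1 + y / 4 != 0 by rewrite eE mulf_neq0 ?invr_eq0// mulf_neq0 ?invr_eq0 ?pnatr_eq0.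
have dd : cdiff (fun w => 1 + w / 4) y 4^-1.
  have := cdiffD (cdiff_cst 1 y) (cdiffM (cdiff_id y) (cdiff_cst 4^-1 y)).
  by rewrite mul1r mulr0 addr0 add0r.
have dM := cdiffM (cdiffD (cdiff_id y) (cdiff_cst 4^-1 y)) (cdiffV (f := fun w => 1 + w / 4) e0 dd).
apply: cdiff_derive1; apply: cdiff_eq (cdiffX 1 dM) _.
have key : (1 + 0) / (1 + y / 4) + (y + 4^-1) * (- 4^-1 / (1 + y / 4) ^+ 2) = (moebius_inv' true u)^-1.
  rewrite /moebius_inv' eE /y /moebius_inv.
  move: d0; set w := 1 - u / 4; have -> : u = 4 * (1 - w) by rewrite /w; field.
  by move=> w0; field.
by rewrite expr1 yE key.
Qed.

Lemma moebius_inv'_neq0 b u : normc u < 4 \/ b = false -> moebius_inv' b u != 0.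
Proof.
case: b => [[u4|//]|_]; last exact: oner_neq0.
by rewrite mulf_neq0 ?invr_eq0 ?expf_neq0 ?den_neq0// mulf_neq0 ?invr_eq0 ?pnatr_eq0.
Qed.

Lemma csqrt_ex z : exists u, u ^+ 2 = z.
Proof. by exists (sqrtc z); rewrite sqr_sqrtc. Qed.

(** The transfer operator of the Moebius factor alone; [PF_sum] is obtained by composing it with the
    transfer operator of squaring. *)
Definition branch b f u : C := f (moebius_inv b u) * moebius_inv' b u.

Lemma PF_sumE b f u : normc u = 1 ->
  PF_sum (T_map b) f (u ^+ 2) = (branch b f u - branch b f (- u)) / (2 * u).
Proof.
move=> u1; have u0 : u != 0 by rewrite -normc_gt0 u1.
have u4 : normc u < 4 \/ b = false by left; rewrite u1 ltr1n.
have nu4 : normc (- u) < 4 \/ b = false by left; rewrite normcN u1 ltr1n.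
have nu0 : - u != 0 by rewrite oppr_eq0.
have neq : moebius_inv b u <> moebius_inv b (- u).
  move=> E; have := moebiusK u4; rewrite E moebiusK// => /eqP.
  by rewrite eq_sym -addr_eq0 -mulr2n mulrn_eq0/= (negPf u0).
rewrite /PF_sum.
have -> : T_map b @^-1` [set u ^+ 2] = [set moebius_inv b u] `|` [set moebius_inv b (- u)].
  apply/seteqP; split=> [y|y [->|->]]; rewrite /= T_mapE; last 2 first.
  - by rewrite moebiusK.
  - by rewrite moebiusK// sqrrN.
  move/eqP; rewrite eqf_sqr => /orP[] /eqP E; [left|right].
    by rewrite -E moebius_invK// E.
  by rewrite -E moebius_invK// E.
rewrite fsbigU0 ?fsbig_set1 ?finite_set1//; last by move=> y [/= -> /neq].
rewrite !derive1_T_map// /branch.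
have := moebius_inv'_neq0 u4; have := moebius_inv'_neq0 nu4.
move: (f _) (f _) (moebius_inv' b u) (moebius_inv' b (- u)) => p q m n n0 m0.
change (q / (2 * u / m) + p / (2 * - u / n) = (q * m - p * n) / (2 * u)).
by field; rewrite u0 m0 n0.
Qed.

Lemma normc_sq_moebius (u : C) : normc (u - 4^-1) ^+ 2 = normc u ^+ 2 - Re u / 2 + 16^-1.
Proof.
have q : (4^-1 : C) = (4^-1 : R)%:C by rewrite fmorphV rmorph_nat.
by rewrite q !sqr_normc_ReIm ReD ImD ReN ImN /=; field.
Qed.

Lemma normc_sq_den (u : C) : normc (1 - u / 4) ^+ 2 = 1 - Re u / 2 + normc u ^+ 2 / 16.
Proof.
have q : (4^-1 : C) = (4^-1 : R)%:C by rewrite fmorphV rmorph_nat.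
by rewrite q !sqr_normc_ReIm ReD ImD ReN ImN ReZ ImZ /=; field.
Qed.

(** Here [t] is the modulus of a point [u] and [x] its real part. The difference of the two sides is
    affine in [x] and smallest at [x = t], a positive real point, where it factors as a difference
    of squares. The next lemma has the same structure. *)
Lemma moebius_lower (s t x : R) : 4^-1 < s -> s < 1 -> s < t -> t < s^-1 -> x <= t ->
  (s - 4^-1) ^+ 2 * (1 - x / 2 + t ^+ 2 / 16) < (1 - s / 4) ^+ 2 * (t ^+ 2 - x / 2 + 16^-1).
Proof.
move=> s4 s1 st ts xt.
have s0 : 0 < s by lra.
have ts1 : s * t < 1 by rewrite mulrC -ltr_pdivlMr// mul1r.
have t4 : t < 4 by apply: lt_le_trans ts _; rewrite -[4]invrK lef_pV2 ?posrE ?invr_gt0//; lra.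
rewrite -subr_gt0.
have -> : (1 - s / 4) ^+ 2 * (t ^+ 2 - x / 2 + 16^-1) - (s - 4^-1) ^+ 2 * (1 - x / 2 + t ^+ 2 / 16) =
  15 / 32 * (1 - s ^+ 2) * (t - x) +
  (15 / 16 * (t - s)) * ((t - 4^-1) * (1 - s / 4) + (s - 4^-1) * (1 - t / 4)) by field.
apply: ltr_wpDl.
  by rewrite !mulr_ge0// ?subr_ge0// expr_le1 ?ltW.
apply: mulr_gt0; first by rewrite mulr_gt0// subr_gt0.
by apply: addr_gt0; apply: mulr_gt0; lra.
Qed.

Lemma moebius_upper (s t x : R) : 4^-1 < s -> s < 1 -> s < t -> t < s^-1 -> x <= t ->
  (s - 4^-1) ^+ 2 * (t ^+ 2 - x / 2 + 16^-1) < (1 - s / 4) ^+ 2 * (1 - x / 2 + t ^+ 2 / 16).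
Proof.
move=> s4 s1 st ts xt.
have s0 : 0 < s by lra.
have ts1 : s * t < 1 by rewrite mulrC -ltr_pdivlMr// mul1r.
have t4 : t < 4 by apply: lt_le_trans ts _; rewrite -[4]invrK lef_pV2 ?posrE ?invr_gt0//; lra.
rewrite -subr_gt0.
have -> : (1 - s / 4) ^+ 2 * (1 - x / 2 + t ^+ 2 / 16) - (s - 4^-1) ^+ 2 * (t ^+ 2 - x / 2 + 16^-1) =
  15 / 32 * (1 - s ^+ 2) * (t - x) +
  (15 / 16 * (1 - s * t)) * ((1 - s / 4) * (1 - t / 4) + (s - 4^-1) * (t - 4^-1)) by field.
apply: ltr_wpDl.
  by rewrite !mulr_ge0// ?subr_ge0// expr_le1 ?ltW.
apply: mulr_gt0; first by rewrite mulr_gt0// subr_gt0.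
by apply: addr_gt0; apply: mulr_gt0; lra.
Qed.

(** The extreme moduli are approached at the real points [s] and [s^-1], whose images are the two
    radii of the target annulus. The inequalities are proved for squared moduli, which are
    polynomial in [normc u] and [Re u]. *)
Lemma moebius_annulus (s : R) u : 4^-1 < s -> s < 1 -> annulus s u ->
  annulus ((s - 4^-1) / (1 - s / 4)) (moebius_inv true u).
Proof.
move=> s4 s1; rewrite annulusE => /andP[su us].
have s0 : 0 < s by lra.
have u0 : 0 < normc u by apply: lt_trans su.
have ru : Re u <= normc u by apply: le_trans (ler_norm _) (Re_le_normc u).
have t4 : normc u < 4 by apply: lt_le_trans us _; rewrite -[4]invrK lef_pV2 ?posrE ?invr_gt0//; lra.
have d0 : 0 < normc (1 - u / 4) by rewrite normc_gt0 den_neq0.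
have a0 : 0 < s - 4^-1 by lra.
have b0 : 0 < 1 - s / 4 by lra.
have lt2 (x y : R) : 0 <= x -> 0 <= y -> (x < y) = (x ^+ 2 < y ^+ 2).
  by move=> x0 y0; rewrite ltr_pXn2r// nnegrE.
rewrite annulusE /moebius_inv normcM normcV invf_div; apply/andP; split.
  rewrite ltr_pdivrMr// mulrAC ltr_pdivlMr// lt2 ?mulr_ge0 ?normc_ge0 ?(ltW a0) ?(ltW b0)//.
  rewrite !exprMn normc_sq_moebius normc_sq_den [X in _ < X]mulrC; exact: moebius_lower.
rewrite ltr_pdivrMr// mulrAC ltr_pdivlMr// lt2 ?mulr_ge0 ?normc_ge0 ?(ltW a0) ?(ltW b0)//.
rewrite !exprMn normc_sq_moebius normc_sq_den [X in X < _]mulrC; exact: moebius_upper.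
Qed.

(* The coefficients of [PF_operator rho (T_map b) f] decay like powers of
   [s2 ^+ 2], whence [s2 ^+ 2 < rho]. *)
Definition branch_bounds (rho : R) b (s1 s2 r1 D : R) : Prop :=
  [/\ [/\ 0 < s1, s1 < s2, s2 < 1 & s2 ^+ 2 < rho], rho < r1, r1 < 1, 0 < D &
      forall u, annulus s1 u -> [/\ normc u < 4 \/ b = false, annulus r1 (moebius_inv b u) &
         normc (moebius_inv' b u) <= D]].

(** Let [m] be the image of [rho] under the Moebius factor. The hypothesis, or [rho < 1] when that
    factor is the identity, says [m < sqrt rho]; [s1] and [s2] divide the interval between them into
    thirds. From [s1 > m] it follows that the inverse branch maps the annulus of [s1] into that of
    some [r1 > rho], and [s2 < sqrt rho] gives [s2 ^+ 2 < rho]. *)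
Lemma branch_bounds_ex (rho : R) b : 0 < rho -> rho < 1 ->
  (b -> ((rho + 4^-1) / (1 + rho / 4)) ^+ 2 < rho) ->
  exists s1 s2 r1 D, branch_bounds rho b s1 s2 r1 D.
Proof.
move=> rho0 rho1 hb; pose x := Num.sqrt rho.
have x0 : 0 < x by rewrite sqrtr_gt0.
have xx : x ^+ 2 = rho by rewrite sqr_sqrtr// ltW.
have x1 : x < 1 by rewrite -(@ltr_pXn2r _ 2)// ?nnegrE ?ler01 ?(ltW x0)// xx expr1n.
have rx : rho < x by rewrite -xx expr2 gtr_pMr.
pose m := if b then (rho + 4^-1) / (1 + rho / 4) else rho.
have den0 : 0 < 1 + rho / 4 by lra.
have mx : m < x.
  rewrite /m; case: (b) hb => // /(_ isT) h.
  by rewrite -(@ltr_pXn2r _ 2)// ?nnegrE ?(ltW x0) ?xx// divr_ge0//; lra.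
have m0 : 0 < m by rewrite /m; case: (b) => //; rewrite divr_gt0//; lra.
pose s1 := m + (x - m) / 3; pose s2 := m + (x - m) / 3 * 2.
have ms1 : m < s1 by rewrite /s1; lra.
have s12 : s1 < s2 by rewrite /s1 /s2; lra.
have s2x : s2 < x by rewrite /s2; lra.
have s10 : 0 < s1 by lra.
have s20 : 0 < s2 by lra.
have P1 : [/\ 0 < s1, s1 < s2, s2 < 1 & s2 ^+ 2 < rho].
  by split; [lra|lra|lra|rewrite -xx ltr_pXn2r// nnegrE ltW].
clearbody s1 s2; move: @m m0 mx ms1; case: (b) hb => [_|_] m m0 mx ms1; last first.
  exists s1, s2, s1, 1; split=> //; first by lra.
  by move=> u uA; split=> //; [right|rewrite /moebius_inv' normc1].
have m4 : 4^-1 < m by rewrite /m ltr_pdivlMr//; lra.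
have s4 : 4^-1 < s1 by lra.
have s11 : s1 < 1 by lra.
have d0 : 0 < 1 - s1 / 4 by lra.
(* [r1] is the image of [s1] under the inverse Moebius map. The bound on the derivative comes from
   [normc (1 - u / 4) >= 1 - s1^-1 / 4], with the numerator 15 / 16 bounded by 1. *)
exists s1, s2, ((s1 - 4^-1) / (1 - s1 / 4)), (16 * s1 ^+ 2 / (4 * s1 - 1) ^+ 2).
have e0 : 0 < 4 * s1 - 1 by lra.
split=> //.
- by rewrite ltr_pdivlMr//; move: ms1; rewrite /m ltr_pdivrMr//; lra.
- by rewrite ltr_pdivrMr//; lra.
- by rewrite divr_gt0 ?exprn_gt0// mulr_gt0// exprn_gt0.
move=> u uA; have /andP[u1 u2] := uA.
have u4 : normc u < 4 by apply: lt_le_trans u2 _; rewrite -[4]invrK lef_pV2 ?posrE ?invr_gt0//; lra.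
split; [by left|exact: moebius_annulus|].
have de : (4 * s1 - 1) / (4 * s1) <= normc (1 - u / 4).
  apply: le_trans (_ : 1 - normc u / 4 <= _).
    have -> : (4 * s1 - 1) / (4 * s1) = 1 - s1^-1 / 4 by field; rewrite gt_eqF.
    by move: u2; lra.
  rewrite lerBlDr -{1}(@normc1 R) -{1}(subrK (u / 4) 1); apply: le_trans (le_normcD _ _) _.
  by rewrite lerD2l normcM normcV normc_nat.
have de0 : 0 < (4 * s1 - 1) / (4 * s1) by rewrite divr_gt0// mulr_gt0.
rewrite /moebius_inv' normcM normcV normcX.
have n15 : normc (15 / 16 : C) <= 1 by rewrite normcM normcV !normc_nat; lra.
apply: le_trans (_ : 1 * ((4 * s1 - 1) / (4 * s1)) ^- 2 <= _); last first.
  by rewrite le_eqVlt; apply/orP; left; apply/eqP; field; rewrite !gt_eqF.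
apply: ler_pM; rewrite ?normc_ge0 ?invr_ge0 ?exprn_ge0 ?normc_ge0//.
by rewrite lef_pV2 ?posrE ?exprn_gt0// ?(lt_le_trans de0)//; apply: expn_le => //; exact: ltW.
Qed.

(** * The Perron-Frobenius operators in terms of Laurent coefficients *)

Lemma lpartS (c : int -> C) N z :
  lpart c N.+1 z = lpart c N z + (c N * z ^+ N + c (Negz N) * z^-1 ^+ N.+1).
Proof. by rewrite /lpart big_ord_recr. Qed.

(** Even powers cancel, and dividing by [2 * u] turns twice the power [2 k + 1] of [u] into the
    power [k] of [u ^+ 2]. The truncations agree: the odd indices between [-2N] and [2N - 1] are the
    [2 k + 1] with [-N <= k <= N - 1]. *)
Lemma lpart_half (d : int -> C) N u : u != 0 ->
  (lpart d N.*2 u - lpart d N.*2 (- u)) / (2 * u) = lpart (fun k => d (2 * k + 1)) N (u ^+ 2).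
Proof.
move=> u0; elim: N => [|N IH]; first by rewrite /lpart double0 !big_ord0 subrr mul0r; exact: erefl.
rewrite doubleS !lpartS -IH.
have -> : d (2 * N%:Z + 1) = d (N.*2.+1)%:Z by congr d; lia.
have -> : d (2 * Negz N + 1) = d (Negz N.*2) by congr d; rewrite !NegzE; lia.
have E1 : (- u) ^+ N.*2 = u ^+ N.*2 by rewrite exprNn -mul2n exprM sqrrN expr1n expr1n mul1r.
have E2 : (- u)^-1 ^+ N.*2 = u^-1 ^+ N.*2 by rewrite invrN exprNn -mul2n exprM sqrrN expr1n expr1n mul1r.
have E3 : (u ^+ 2) ^+ N = u ^+ N.*2 by rewrite -exprM mul2n.
have E4 : (u ^+ 2)^-1 ^+ N.+1 = u^-1 ^+ N.*2.+2 by rewrite -exprVn -exprM mul2n doubleS.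
rewrite E3 E4 !(exprS _ N.*2.+1) !(exprS _ N.*2) E1 E2.
move: (u ^+ N.*2) (u^-1 ^+ N.*2) (lpart d _ _) (lpart d _ _) (d _) (d _) (d _) (d _) => a b p q d1 d2 d3 d4.
by field.
Qed.

Lemma index_le (k : int) : (2 * `|k|%N <= `|(2 * k + 1)%R|%N.+1)%N.
Proof. lia. Qed.

(** The rate is squared because [2 |k| <= |2 k + 1| + 1]; the 1 costs the factor [s^-1]. *)
Lemma lsum_half (d : int -> C) B s u : 0 < s -> s < 1 -> gbound d B s -> normc u = 1 ->
  gbound (fun k => d (2 * k + 1)) (B / s) (s ^+ 2) /\
  (lsum d u - lsum d (- u)) / (2 * u) = lsum (fun k => d (2 * k + 1)) (u ^+ 2).
Proof.
move=> s0 s1 hd u1; have B0 := gbound_ge0 hd.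
have u0 : u != 0 by rewrite -normc_gt0 u1.
have ub : s < normc u < s^-1 by rewrite u1 s1 invf_gt1.
have nub : s < normc (- u) < s^-1 by rewrite normcN.
have s20 : 0 < s ^+ 2 by rewrite exprn_gt0.
have s21 : s ^+ 2 < 1 by rewrite expr_lt1// ltW.
have hc : gbound (fun k => d (2 * k + 1)) (B / s) (s ^+ 2).
  move=> k; apply: le_trans (hd _) _; rewrite -mulrA ler_wpM2l//.
  rewrite [leRHS]mulrC ler_pdivlMr// -exprSr -exprM; apply: ler_wiXn2l; [exact: ltW|exact: ltW|exact: index_le].
split=> //; apply: (@sconv_unique _ (fun N => lpart (fun k => d (2 * k + 1)) N (u ^+ 2))); last first.
  by apply: (lsum_conv s20 hc); rewrite normcX u1 expr1n s21 invf_gt1.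
apply: (eq_sconv (s := fun N => (2 * u)^-1 * (lpart d N.*2 u - lpart d N.*2 (- u)))).
  by move=> N; rewrite mulrC lpart_half.
rewrite [X in sconv _ X]mulrC; apply: sconvZ.
have h1 := sconvB (lsum_conv s0 hd ub) (lsum_conv s0 hd nub).
move=> e /h1[N0 h]; exists N0 => N NN; apply: h.
by rewrite (leq_trans NN)// -addnn leq_addr.
Qed.

Section PF.
Variable rho : R.
Hypothesis rho0 : 0 < rho.
Hypothesis rho1 : rho < 1.
Variable b : bool.
Variables s1 s2 r1 D : R.
Hypothesis bb : branch_bounds rho b s1 s2 r1 D.

(* With [h := branch b f] and [z = u ^+ 2], [PF_sum (T_map b) f z] is
   [(h u - h (- u)) / (2 * u)], so only the odd coefficients of [h] survive. *)
Definition pfc f (k : int) : C := lc (branch b f) 1 (2 * k + 1).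

Lemma branch_bounds_pos : [/\ 0 < s1, s1 < 1, 0 < s2 & 0 < r1].
Proof. by case: bb => [[h1 h2 h3 h4] h5 h6 h7 _]; split=> //; [lra|lra|exact: lt_trans h5]. Qed.

Lemma branch_holo f : H2 rho f -> holo_on (annulus s1) (branch b f).
Proof.
move=> Hf u uA; case: bb => _ r1r _ _ /(_ u uA)[u4 NA _]; have [s10 s11 s20 r10] := branch_bounds_pos.
have NA' : annulus rho (moebius_inv b u).
  by case/andP: NA => n1 n2; rewrite annulusE (lt_trans r1r)// (lt_trans n2)// ltf_pV2 ?posrE.
have [l hl] := H2_holo Hf NA'; have [m hm] := cdiff_moebius_inv' u4.
by eexists; apply: cdiffM (cdiff_comp (cdiff_moebius_inv u4) hl) hm.
Qed.

Lemma lc_gbound (h : C -> C) M : holo_on (annulus s1) h -> (forall u, annulus s1 u -> normc (h u) <= M) ->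
  gbound (lc h 1) (2 * M) s2.
Proof.
move=> hh hM n; have [s10 s11 s20 _] := branch_bounds_pos; case: bb => [[_ s12 s21 _] _ _ _ _].
have o1 : s1 < 1 < s1^-1 by rewrite s11 invf_gt1.
have M0 : 0 <= M by apply: le_trans (normc_ge0 _) (hM 1 _); rewrite annulusE normc1.
have c1 : s1 < s2 < s1^-1 by rewrite s12 (lt_trans s21)// invf_gt1.
have c2 : s1 < s2^-1 < s1^-1 by rewrite ltf_pV2 ?posrE// s12 andbT (lt_trans s11)// invf_gt1.
have s2'0 : 0 < s2^-1 by rewrite invr_gt0.
case: n => n.
  rewrite (lc_radius n s10 hh o1 c2); apply: le_trans (lc_bound n s2'0 (holo_circcont s10 hh c2) _) _.
    by move=> z zr; apply: hM; rewrite annulusE zr.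
  by rewrite -exprnN exprVn invrK.
rewrite (lc_radius (Negz n) s10 hh o1 c1); apply: le_trans (lc_bound (Negz n) s20 (holo_circcont s10 hh c1) _) _.
  by move=> z zr; apply: hM; rewrite annulusE zr.
by [].
Qed.

Lemma pfc_gbound f M : H2 rho f -> (forall u, annulus s1 u -> normc (branch b f u) <= M) ->
  gbound (pfc f) (2 * M / s2) (s2 ^+ 2).
Proof.
move=> Hf hM; have [s10 s11 s20 _] := branch_bounds_pos; case: bb => [[_ s12 s21 _] _ _ _ _].
by have [] := lsum_half s20 s21 (lc_gbound (branch_holo Hf) hM) (@normc1 R).
Qed.

(** Decay at a rate [q] above [rho] still bounds [f] uniformly on the annulus of [r1 > q], and this
    is where the inverse branches take their values. *)
Lemma f_bound f B q u : H2 rho f -> rho < q -> q < r1 -> gbound (cf f) B q -> annulus s1 u ->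
  normc (branch b f u) <= 4 / (1 - q / r1) * B * D.
Proof.
move=> Hf rq qr hB uA; case: bb => _ r1r r11 D0 /(_ u uA)[u4 NA hD].
have [s10 s11 s20 r10] := branch_bounds_pos; have q0 : 0 < q by apply: lt_trans rq.
have NA' : annulus rho (moebius_inv b u).
  by case/andP: NA => n1 n2; rewrite annulusE (lt_trans r1r)// (lt_trans n2)// ltf_pV2 ?posrE.
rewrite normcM; apply: ler_pM; rewrite ?normc_ge0//.
rewrite (H2_lsum rho0 rho1 Hf NA'); apply: (lsum_bound r10 q0 qr hB).
by case/andP: NA => /ltW -> /ltW ->.
Qed.

(** [PF_operator] is a choice among the elements of [H2] with the prescribed values on the unit
    circle. Synthesis from [pfc] exhibits one; coefficients are computed on the unit circle, so any
    two coincide. *)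
Lemma PF_operatorE f : H2 rho f ->
  [/\ PF_operator rho (T_map b) f = lsynth rho (pfc f),
      exists2 B, 0 <= B & gbound (pfc f) B (s2 ^+ 2) &
      forall z, circle 1 z -> PF_operator rho (T_map b) f z = PF_sum (T_map b) f z].
Proof.
move=> Hf; have [s10 s11 s20 r10] := branch_bounds_pos; case: (bb) => [[_ s12 s21 s2r] r1r r11 D0 hA].
pose q := (rho + r1) / 2.
have rq : rho < q by rewrite /q; lra.
have qr : q < r1 by rewrite /q; lra.
have q1 : q < 1 by lra.
have hB := H2_gbound rho0 rho1 Hf rq q1.
have hM u (uA : annulus s1 u) := f_bound Hf rq qr hB uA.
have hc := pfc_gbound Hf hM; have hl := lc_gbound (branch_holo Hf) hM.
have s220 : 0 < s2 ^+ 2 by rewrite exprn_gt0.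
have HL := lsynth_H2 rho0 rho1 s220 s2r hc.
have one : rho < 1 < rho^-1 by rewrite rho1 invf_gt1.
have EL z : circle 1 z -> lsynth rho (pfc f) z = PF_sum (T_map b) f z.
  rewrite /circle /= => z1; rewrite /lsynth z1 one.
  have [u uE] := csqrt_ex z.
  have u1 : normc u = 1.
    apply/eqP; rewrite -(@eqrXn2 _ 2)// ?normc_ge0// -normcX uE z1 expr1n//.
  rewrite -uE PF_sumE//.
  have [_ <-] := lsum_half s20 s21 hl u1.
  have uA : annulus s1 u by rewrite annulusE u1 s11 invf_gt1.
  have nuA : annulus s1 (- u) by rewrite annulusE normcN u1 s11 invf_gt1.
  by rewrite (laurent s10 s11 (branch_holo Hf) uA) (laurent s10 s11 (branch_holo Hf) nuA).
have [Hg Eg] : H2 rho (PF_operator rho (T_map b) f) /\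
    forall z, circle 1 z -> PF_operator rho (T_map b) f z = PF_sum (T_map b) f z.
  exact: (@xgetPex _ _ [set g | H2 rho g /\ forall z, circle 1 z -> g z = PF_sum (T_map b) f z]
    (ex_intro _ (lsynth rho (pfc f)) (conj HL EL))).
split=> //; last by eexists; [exact: (gbound_ge0 hc)|exact: hc].
apply: (H2_ext rho0 rho1 Hg HL) => n; apply: eq_lc => // z z1.
by rewrite Eg// EL.
Qed.
End PF.

(** * The averaging operator *)

(* [U_operator eps] multiplies [z ^ n] by [ufactor eps n]. *)
Definition ufactor (eps : R) (n : int) : C :=
  2^-1%:C * Cint (-1) 1 (fun t => expi (- (2 * pi * eps * t)) ^ (n + 1)).

Lemma ufactorE eps n : ufactor eps n =
  2^-1%:C * Cint (-1) 1 (fun t => expi (- (2 * pi * eps * (n + 1)%:~R) * t)).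
Proof.
congr (_ * _); apply: eq_Cint => t _; rewrite -expiMz; congr expi; ring.
Qed.

Lemma leN1_1 : -1 <= 1 :> R. Proof. by lra. Qed.

Lemma ufactor_bound eps n : normc (ufactor eps n) <= 2.
Proof.
rewrite ufactorE normcM normc_real ger0_norm ?invr_ge0//.
have := @Cint_bound R (-1) 1 (fun t => expi (- (2 * pi * eps * (n + 1)%:~R) * t)) 1 leN1_1.
move=> /(_ (fun t _ => pcont_expiM _ t)) h.
have {}h : normc (Cint (-1) 1 (fun t => expi (- (2 * pi * eps * (n + 1)%:~R) * t))) <= 2 * 1 * (1 - -1).
  by apply: h => t _; rewrite normc_expi.
by move: h; move: (normc _) => x h; lra.
Qed.

Lemma ufactor_fix eps : ufactor eps (-1) = 1.
Proof.
rewrite ufactorE addNr mulr0 oppr0 (eq_Cint (h' := fun=> 1)); last by move=> t _; rewrite mul0r expi0.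
rewrite Cint_cst ?leN1_1// opprK mulr1 -rmorphM; congr (_%:C).
by rewrite -[1 + 1]/2 mulVf.
Qed.

(** With this value of [eps] the integrand is [expi (- (pi * m * t))], which runs through [|m|] full
    periods on [[-1, 1]]. *)
Lemma ufactor_kill (N : nat) (n m : int) : (0 < N)%N -> m != 0 -> n + 1 = m * N%:Z ->
  ufactor (2 * N%:R)^-1 n = 0.
Proof.
move=> N0 m0 E; rewrite ufactorE E.
have -> : 2 * pi * (2 * N%:R)^-1 * (m * N%:Z)%:~R = pi * m%:~R :> R.
  by rewrite intrM -[(N%:Z)%:~R]/(N%:R : R); field; rewrite pnatr_eq0 -lt0n.
have k0 : - (pi * m%:~R) != 0 :> R by rewrite oppr_eq0 mulf_neq0 ?intr_eq0// gt_eqF ?pi_gt0.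
rewrite Cint_expi ?leN1_1//.
have -> : expi (- (pi * m%:~R) * 1) = expi (- (pi * m%:~R) * -1 : R).
  have -> : - (pi * m%:~R) * -1 = (- (pi * m%:~R) * 1) + m%:~R * (2 * pi) :> R by ring.
  have e2 : expi (m%:~R * (2 * pi)) = 1 :> C by rewrite expiMz expi2pi exp1rz.
  by rewrite expiD e2 [RHS]mulr1.
by rewrite subrr mul0r mulr0.
Qed.

Section U.
Variable rho q : R.
Hypothesis rho0 : 0 < rho.
Hypothesis rho1 : rho < 1.
Hypothesis q0 : 0 < q.
Hypothesis qrho : q < rho.

Lemma ufactor_gbound eps c B : gbound c B q -> gbound (fun n => ufactor eps n * c n) (2 * B) q.
Proof.
move=> hc n; rewrite normcM -mulrA; apply: ler_pM; rewrite ?normc_ge0 ?ufactor_bound//.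
Qed.

(** Rotation preserves the modulus, so the tail estimate for the Laurent series at [z * w t] is
    uniform in [t]. Partial sums are integrated term by term and the error is geometric. *)
Lemma U_lsynth eps c B : gbound c B q ->
  U_operator eps (lsynth rho c) = lsynth rho (fun n => ufactor eps n * c n).
Proof.
move=> hc; apply/funext => z; have B0 := gbound_ge0 hc.
pose w t := expi (- (2 * pi * eps * t)).
have nw t : normc (z * w t) = normc z by rewrite normcM normc_expi mulr1.
have wE t : w t = expi (- (2 * pi * eps) * t) by rewrite /w mulNr.
have pw t : pcont w t by rewrite (_ : w = fun t => expi (- (2 * pi * eps) * t)); [exact: pcont_expiM|apply/funext].
rewrite /U_operator -/(Cint (-1) 1 _) /lsynth.
have [zA|zA] := boolP (rho < normc z < rho^-1); rewrite ?zA ?(negPf zA); last first.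
  rewrite (eq_Cint (h' := fun=> 0)); last by move=> t _; rewrite -/(w t) nw (negPf zA) mul0r.
  by rewrite Cint_cst ?leN1_1// !mulr0.
have zn : normc z != 0 by case/andP: zA => z1 _; rewrite gt_eqF// (lt_trans rho0).
have z0 : z != 0 by rewrite -normc_eq0.
rewrite (eq_Cint (h' := fun t => lsum c (z * w t) * w t)); last by move=> t _; rewrite -/(w t) nw zA.
have qz v : normc v = normc z -> q < normc v < q^-1.
  move=> ->; case/andP: zA => z1 z2; rewrite (lt_trans qrho)//= (lt_trans z2)// ltf_pV2 ?posrE//.
have pl t : pcont (fun t => lsum c (z * w t) * w t) t.
  apply: pcontM; last exact: pw.
  apply: (@pcont_comp _ (lsum c) (fun t => z * w t)); last by apply: pcontM; [exact: pcont_cst|exact: pw].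
  by have [l] := lsum_cdiff q0 hc (qz _ (nw t)); exact: cdiff_cont.
have pp N t : pcont (fun t => lpart c N (z * w t) * w t) t.
  apply: pcontM; last exact: pw.
  rewrite (_ : (fun t => lpart c N (z * w t)) = (fun t => \sum_(k < N) (c k * (z * w t) ^+ k + c (Negz k) * (z * w t)^-1 ^+ k.+1))); last by [].
  have pzw : pcont (fun t => z * w t) t by apply: pcontM; [exact: pcont_cst|exact: pw].
  have pzwV : pcont (fun t => (z * w t)^-1) t.
    have : pcont (fun t => z^-1 * expi ((2 * pi * eps) * t)) t by apply: pcontM; [exact: pcont_cst|exact: pcont_expiM].
    rewrite (_ : (fun t => z^-1 * _) = (fun t => (z * w t)^-1))//; apply/funext => s.
    by rewrite invfM -expiN opprK.
  apply: (@pcont_sum R N (fun k t => c (Posz k) * (z * w t) ^+ k + c (Negz k) * (z * w t)^-1 ^+ k.+1)) => k.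
  by apply: pcontD; (apply: pcontM; [exact: pcont_cst|exact: pcontX]).
have hc' := ufactor_gbound eps hc.
apply: (@sconv_unique _ (fun N => lpart (fun n => ufactor eps n * c n) N z)); last exact: (lsum_conv q0 hc' (qz _ erefl)).
pose x := Num.max (q * normc z) (q * normc z^-1).
have /andP[qz1 qz2] := qz _ (erefl (normc z)).
have x1 : x < 1.
  rewrite gt_max normcV; apply/andP; split.
    by rewrite mulrC -ltr_pdivlMr// mul1r.
  by rewrite ltr_pdivrMr ?mul1r// (lt_trans q0).
have x01 : 0 <= x < 1 by rewrite x1 le_max mulr_ge0 ?normc_ge0// ltW.
apply: (@sconv_geo _ _ _ (2^-1 * (2 * (4 * B / (1 - x)) * 2)) x) => // N.
have -> : lpart (fun n => ufactor eps n * c n) N z = 2^-1%:C * Cint (-1) 1 (fun t => lpart c N (z * w t) * w t).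
  pose F k t := c (Posz k) * z ^+ k * (w t) ^ (k%:Z + 1) + c (Negz k) * z^-1 ^+ k.+1 * (w t) ^ (Negz k + 1).
  have pwz (m : int) t : pcont (fun t => w t ^ m) t.
    rewrite (_ : (fun t => w t ^ m) = (fun t => expi ((m%:~R * - (2 * pi * eps)) * t))); first exact: pcont_expiM.
    by apply/funext => s; rewrite wE -expiMz mulrA.
  have pF k t : pcont (F k) t.
    by apply: pcontD; (apply: pcontM; [exact: pcont_cst|exact: pwz]).
  rewrite (eq_Cint (h' := fun t => \sum_(k < N) F k t)); last first.
    move=> t _; rewrite /lpart mulr_suml; apply: eq_bigr => k _; rewrite /F mulrDl.
    have w0 : w t != 0 by exact: expi_neq0.
    rewrite expfzDr// expr1z exprMn !mulrA; congr (_ + _).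
    rewrite expfzDr// expr1z invfM exprMn NegzE -exprnN -exprVn; rewrite !mulrA; congr (_ * _).
  rewrite (@Cint_sum R _ _ N F); last by move=> k t _; exact: pF.
  rewrite mulr_sumr; apply: eq_bigr => k _.
  rewrite /F CintD; [|by move=> t _; apply: pcontM; [exact: pcont_cst|exact: pwz]..].
  rewrite !CintZ; [|by move=> t _; exact: pwz..].
  have E m : ufactor eps m = 2^-1%:C * Cint (-1) 1 (fun s => w s ^ (m + 1)) by [].
  by rewrite !E; move: (Cint _ _ _) (Cint _ _ _) => *; ring.
rewrite -mulrBr -CintB; [|by move=> t _; exact: pp|by move=> t _; exact: pl].
rewrite normcM normc_real ger0_norm ?invr_ge0// -(mulrA 2^-1) ler_wpM2l ?invr_ge0//.
have -> : 2 * (4 * B / (1 - x)) * 2 * x ^+ N = 2 * (4 * B / (1 - x) * x ^+ N) * (1 - -1) by rewrite opprK; ring.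
apply: Cint_bound; first exact: leN1_1.
  by move=> t _; apply: pcontB; [exact: pp|exact: pl].
move=> t _; rewrite -mulrBl normcM normc_expi mulr1.
by apply: (lsum_tail N q0 hc x1); rewrite ?normcV nw -?normcV le_max lexx ?orbT.
Qed.
End U.
End Branches.

(** * Conservation of the coefficient of index -1, and positivity of the Moebius weight *)

Section Mean.
Variable R : realType.
Local Notation C := R[i].
Local Notation Re := complex.Re.
Local Notation Im := complex.Im.
Local Notation mu := (@lebesgue_measure R).
Local Notation N := (moebius_inv (R := R) true).
Local Notation N' := (moebius_inv' (R := R) true).

Lemma circ1 t : (1 : R)%:C * expi t = expi t. Proof. exact: mul1r. Qed.

(** The coefficient of index -1 is the integral of [h z dz] over the unit circle up to a constant,
    and a primitive returns to its initial value after a full turn. *)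
Lemma lc_primitive (h F : C -> C) : (forall t, pcont (fun s => h (expi s)) t) ->
  (forall t, pderiv (fun s => F (expi s)) t (h (expi t) * ('i * expi t))) -> lc h 1 (-1) = 0.
Proof.
move=> ch hF; have P := pi2_gt0 R.
have cp t : pcont (fun s => h (expi s) * ('i * expi s)) t.
  by apply: pcontM; [exact: ch|apply: pcontM; [exact: pcont_cst|exact: pcont_expi]].
have E : circint (fun z => h z * z ^ (- -1)) 1 = Cint 0 (2 * pi) (fun t => - 'i * (h (expi t) * ('i * expi t))).
  apply: eq_Cint => t _; rewrite circ1 opprK expr1z.
  have ii : 'i * 'i = -1 :> C by rewrite -expr2 sqr_i.
  rewrite mulrCA (mulrA (- 'i)) mulNr ii opprK mul1r //.
rewrite /lc E CintZ; last by move=> t _; exact: cp.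
rewrite (Cint_FTC (F := fun s => F (expi s)) (ltW P)); [|by move=> t _; exact: cp|by move=> t _; exact: hF].
by rewrite expi2pi expi0 subrr !mulr0.
Qed.

Lemma normc_moebius_inv u : normc u = 1 -> normc (N u) = 1.
Proof.
move=> u1; have d0 : normc (1 - u / 4) != 0.
  by rewrite normc_eq0 den_neq0// u1 ltr1n.
rewrite /moebius_inv normcM normcV; apply: (mulIf d0); rewrite divfK// mul1r.
apply/eqP; rewrite -(@eqrXn2 _ 2)// ?normc_ge0//.
rewrite normc_sq_moebius normc_sq_den u1; by apply/eqP; field.
Qed.

Lemma pderiv_expi1 t : pderiv (@expi R) t ('i * expi t).
Proof.
have := pderiv_expi 1 t; rewrite !mul1r.
by rewrite (_ : (fun s => expi (1 * s)) = @expi R)//; apply/funext => s; rewrite mul1r.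
Qed.

Lemma expi_den t : 1 - expi t / 4 != 0 :> C.
Proof. by rewrite den_neq0// normc_expi ltr1n. Qed.

Lemma pderiv_moebius_inv t : pderiv (fun s => N (expi s)) t (N' (expi t) * ('i * expi t)).
Proof.
have d0 := expi_den t.
have hn : pderiv (fun s => expi s - 4^-1) t ('i * expi t + 0).
  by apply: pderivD; [exact: pderiv_expi1|exact: pderiv_cst].
have hd : pderiv (fun s => 1 - expi s / 4) t (- ('i * expi t / 4)).
  have := pderivD (pderiv_cst 1 t) (pderivM (pderiv_expi1 t) (pderiv_cst (- 4^-1) t)).
  rewrite (_ : (fun s => 1 + _) = (fun s => 1 - expi s / 4)); last by apply/funext => s; rewrite mulrN.
  by move/pderiv_eq; apply; rewrite mulr0 addr0 add0r mulrN.
have := pderivM hn (pderivV (f := fun s => 1 - expi s / 4) d0 hd).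
move/pderiv_eq; apply; rewrite /moebius_inv'.
move: d0; move: (expi t) => u; set w := 1 - u / 4; have -> : u = 4 * (1 - w) by rewrite /w; field.
by move=> w0; field.
Qed.

Lemma pcont_moebius_inv' t : pcont (fun s => N' (expi s)) t.
Proof.
have d0 := expi_den t.
have [l hl] := @cdiff_moebius_inv' R true (expi t) (or_introl (etrans (f_equal (fun x => x < 4) (normc_expi t)) (ltr1n _ 4))).
exact: (pcont_comp (cdiff_cont hl) (pcont_expi t)).
Qed.

Lemma moebius_inv_expi0 t : N (expi t) != 0.
Proof. by rewrite -normc_gt0 normc_moebius_inv ?normc_expi. Qed.

Lemma pcont_moebius_term k t : pcont (fun s => N (expi s) ^ k * N' (expi s)) t.
Proof.
apply: pcontM; last exact: pcont_moebius_inv'.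
have [l hl] := cdiff_exprz k (moebius_inv_expi0 t).
exact: (pcont_comp (f := fun z => z ^ k) (cdiff_cont hl) (pderiv_cont (pderiv_moebius_inv t))).
Qed.

(** For [k <> -1] a multiple of [N u ^ (k + 1)] is a primitive. For [k = -1] the logarithmic
    derivative of [N] is [1 / (u - 4^-1) - 1 / (u - 4)], and only the first pole lies in the unit
    disc. *)
Lemma lc_moebius_term (k : int) : lc (fun u => N u ^ k * N' u) 1 (-1) = (k == -1)%:R.
Proof.
have P := pi2_gt0 R.
case: k => k.
  apply: (lc_primitive (F := fun u => k.+1%:R^-1 * N u ^+ k.+1)) => t; first exact: pcont_moebius_term.
  apply: pderiv_eq (pderivM (pderiv_cst k.+1%:R^-1 t) (pderivX k (pderiv_moebius_inv t))) _.
  by rewrite mul0r add0r !mulrA mulVf ?pnatr_eq0// mul1r.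
case: k => [|k].
  rewrite eqxx /lc.
  have E : circint (fun u => N u ^ (-1) * N' u * u ^ (- -1)) 1 =
     circint (fun u => 1 * (u / (u - 4^-1)) - 1 * (u / (u - 4))) 1.
    apply: eq_circint => // u u1; rewrite opprK expr1z exprN1 /moebius_inv /moebius_inv'.
    have d0 : 1 - u / 4 != 0 by rewrite den_neq0// u1 ltr1n.
    have n0 : N u != 0 by rewrite -normc_gt0 normc_moebius_inv.
    have n1 : u - 4^-1 != 0 by move: n0; rewrite /moebius_inv mulf_eq0 negb_or => /andP[].
    have -> : u - 4 = - 4 * (1 - u / 4) by field.
    have -> : u - 4^-1 = (4 * u - 1) / 4 by field.
    have n4 : 4 * u - 1 != 0 by apply: contra n1 => /eqP n4; apply/eqP; rewrite -(mulKf (four_neq0 R) u); rewrite -[4 * u](subrK 1) n4 add0r mulr1 subrr.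
    have d4 : 4 - u != 0 by apply: contra d0 => /eqP d4; apply/eqP; rewrite -[u](subKr 4) d4 subr0 divff ?subrr ?(four_neq0 R).
    by field; rewrite n4 d4.
  have z4 : normc (4^-1 : C) = 4^-1 by rewrite normcV normc_nat.
  have l1 : normc (4^-1 : C) < 1 by rewrite z4 invf_lt1 ?ltr1n.
  have l2 : 1 < normc (4 : C) by rewrite normc_nat ltr1n.
  have c1 := circcont_cst (1 : C) (1 : R).
  have k1 := circcont_kernel ltr01 (negbT (lt_eqF l1)).
  have k2 := circcont_kernel ltr01 (negbT (gt_eqF l2)).
  rewrite [Negz 0]/(-1 : int) E circintB; [|exact: circcontM|exact: circcontM].
  have -> : circint (fun u => 1 * (u / (u - 4^-1))) 1 = (2 * pi)%:C :> C.
    apply: (sconv_unique (cauchy_outer ltr01 l1 c1)).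
    apply: (sconv_shift (k := 1)); apply: (@sconv_geo _ _ _ 0 0); first by rewrite lexx ltr01.
    move=> K; rewrite mul0r addn1 big_ord_recl expr0 mul1r big1 => [|i _].
      rewrite (eq_circint (g := fun z => z ^ 0))// => [|z _]; last by rewrite mul1r.
      by rewrite circint_exprz// mul1r addr0 subrr normc_0.
    rewrite (eq_circint (g := fun z => z ^ (- (lift ord0 i)%:Z)))// => [|z _]; last by rewrite mul1r.
    by rewrite circint_exprz// mul0r mulr0.
  have -> : circint (fun u => 1 * (u / (u - 4))) 1 = 0 :> C.
    apply: (sconv_unique (cauchy_inner ltr01 l2 c1)).
    apply: (@sconv_geo _ _ _ 0 0); first by rewrite lexx ltr01.
    move=> K; rewrite mul0r big1 ?subr0 ?normc_0// => i _.
    rewrite (eq_circint (g := fun z => z ^ (i.+1)%:Z))// => [|z _]; last by rewrite mul1r.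
    by rewrite circint_exprz// mul0r mulr0 oppr0.
  by rewrite subr0 -rmorphM mulVf ?gt_eqF.
apply: (lc_primitive (F := fun u => - k.+1%:R^-1 * (N u)^-1 ^+ k.+1)) => t; first exact: pcont_moebius_term.
have n0 := moebius_inv_expi0 t.
apply: pderiv_eq (pderivM (pderiv_cst (- k.+1%:R^-1) t) (pderivX k (pderivV (f := fun s => N (expi s)) n0 (pderiv_moebius_inv t)))) _.
rewrite !mul0r !add0r NegzE -exprnN -exprVn !exprS.
move: n0; move: (N _) (N' _) ('i * _) => m d e m0.
have k0 : k.+1%:R != 0 :> C by rewrite pnatr_eq0.
move: k0; move: (k.+1%:R) (m^-1 ^+ k) => kk mk k0; field.
by rewrite k0 m0.
Qed.

Lemma normc_moebius_inv'_le u : normc u = 1 -> normc (N' u) <= 2.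
Proof.
move=> u1; have a : 3 / 4 <= normc (1 - u / 4).
  have : normc u / 4 = 4^-1 by rewrite u1 mul1r.
  have := le_normcD (1 - u / 4) (u / 4); rewrite subrK normc1 normcM normcV normc_nat => h1 h2.
  lra.
rewrite /moebius_inv' normcM normcV normcX ler_pdivrMr ?exprn_gt0//; last by apply: lt_le_trans a; lra.
have : (3 / 4) ^+ 2 <= normc (1 - u / 4) ^+ 2 by apply: expn_le => //; lra.
by rewrite normcM normcV !normc_nat expr2; move: (_ ^+ 2) => x; lra.
Qed.

Lemma lc_branch_lpart (c : int -> C) K :
  circcont (fun u => lpart c K (N u) * N' u) 1 /\
  lc (fun u => lpart c K (N u) * N' u) 1 (-1) = (0 < K)%N%:R * c (-1).
Proof.
have tE k : circcont (fun u => N u ^ k * N' u) 1.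
  move=> t _; have := pcont_moebius_term k t.
  by rewrite (_ : (fun s => N (expi s) ^ k * _) = (fun t => N (1%:C * expi t) ^ k * N' (1%:C * expi t)))//; apply/funext => s; rewrite circ1.
elim: K => [|K [cK IH]].
  have E u : lpart c 0 (N u) * N' u = 0 by rewrite /lpart big_ord0 mul0r.
  rewrite (funext E) lc_cst// !mul0r.
  by split=> //; exact: circcont_cst.
have E u : lpart c K.+1 (N u) * N' u = lpart c K (N u) * N' u +
    (c K * (N u ^ K%:Z * N' u) + c (Negz K) * (N u ^ (Negz K) * N' u)).
  by rewrite lpartS !mulrDl !mulrA NegzE -exprnN -exprVn.
have cz k : circcont (fun u => c k * (N u ^ k * N' u)) 1.
  by apply: circcontM; [exact: circcont_cst|exact: tE].
have cD := circcontD (cz K) (cz (Negz K)).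
rewrite (funext E); split; first exact: circcontD.
rewrite (lcD _ cK cD) IH (lcD _ (cz K) (cz (Negz K))) !(lcZ _ _ (tE _)) !lc_moebius_term.
case: K {cK IH E cD} => [|K]; first by rewrite mul0r add0r mulr0 add0r mulr1 mul1r.
by rewrite mulr0 mulr0 !addr0.
Qed.

Variable rho : R.
Hypothesis rho0 : 0 < rho.
Hypothesis rho1 : rho < 1.

(** Since [2 * (-1) + 1 = -1], the claim is that the change of variables by the Moebius map
    preserves the integral of [f z dz] over the unit circle. It holds exactly for partial sums
    containing the index -1, and passes to the limit since [N] maps the unit circle to itself. *)
Lemma pfc_mean b f : H2 rho f -> circcont (branch b f) 1 -> pfc b f (-1) = cf f (-1).
Proof.
rewrite /pfc; have -> : 2 * (-1) + 1 = -1 :> int by [].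
case: b => Hf cb; last by apply: eq_lc => // u _; rewrite /branch mulr1.
pose q := (rho + 1) / 2.
have rq : rho < q by move: rho1; rewrite /q; clear; move: (rho) => x x1; lra.
have q1 : q < 1 by move: rho1; rewrite /q; clear; move: (rho) => x x1; lra.
have q0 : 0 < q by apply: lt_trans rq.
have hB := H2_gbound rho0 rho1 Hf rq q1.
set B := 2 * _ in hB.
apply: (@sconv_unique _ (fun K => lc (fun u => lpart (cf f) K (N u) * N' u) 1 (-1))); last first.
  apply: (sconv_shift (k := 1)); apply: (@sconv_geo _ _ _ 0 0); first by rewrite lexx ltr01.
  by move=> K; have [_ ->] := lc_branch_lpart (cf f) (K + 1); rewrite addn1 mul1r subrr normc_0 mul0r.
apply: (@sconv_geo _ _ _ (2 * (4 * B / (1 - q) * 2)) q); first by rewrite (ltW q0).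
move=> K; have [cK _] := lc_branch_lpart (cf f) K.
rewrite -lcB//; apply: le_trans (lc_bound (B := 4 * B / (1 - q) * q ^+ K * 2) (-1) ltr01 _ _) _.
- exact: circcontB.
- move=> u u1; rewrite /branch -mulrBl normcM.
  have Nu := normc_moebius_inv u1.
  have NA : annulus rho (N u) by rewrite annulusE Nu rho1 invf_gt1.
  apply: ler_pM; rewrite ?normc_ge0 ?normc_moebius_inv'_le//.
  rewrite (H2_lsum rho0 rho1 Hf NA); apply: (lsum_tail K q0 hB q1).
    by rewrite Nu mulr1.
  by rewrite normcV Nu invr1 mulr1.
rewrite opprK expr1z mulr1 le_eqVlt; apply/orP; left; apply/eqP; ring.
Qed.

(** * Positivity *)

(** As [dz = 'i * z dt], the product [z * f z] is the density in the angle. The order of [C] makes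
    it real as well as nonnegative. *)
Definition circle_pos (f : C -> C) := forall z, normc z = 1 -> 0 <= z * f z.

(** This is the derivative of the angle of [N (expi t)] with respect to [t], a Poisson kernel: on
    the circle it equals 15 / 16 divided by the squared modulus of [1 - u / 4], which is
    [17 / 16 - cos t / 2]. *)
Lemma moebius_weight_ge0 u : normc u = 1 -> 0 <= u * N' u / N u.
Proof.
move=> u1; have d0 : 1 - u / 4 != 0 by rewrite den_neq0// u1 ltr1n.
have n0 : N u != 0 by rewrite -normc_gt0 normc_moebius_inv.
have u0 : u != 0 by rewrite -normc_gt0 u1.
have [t _ uE] := polarP u; rewrite u1 circ1 in uE.
have x0 : 0 < 17 / 16 - cos t / 2 by have := cos_le1 t; move: (cos t) => x; lra.
have -> : u * N' u / N u = (15 / 16 / (17 / 16 - cos t / 2))%:C.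
  have uu : u + u^-1 = (cos t *+ 2)%:C.
    rewrite uE -expiN; apply: complex_eqP; rewrite ?ReD ?ImD /= ?cosN ?sinN ?subrr//.
  have dE : (1 - u / 4) * (1 - u^-1 / 4) = (17 / 16 - cos t / 2)%:C.
    have -> : (17 / 16 - cos t / 2) = 17 / 16 - (cos t *+ 2) / 4 by rewrite -mulr_natr; field.
    have hC (x : R) : (17 / 16 - x / 4)%:C = 17 / 16 - x%:C / 4 by rewrite rmorphB !rmorphM !fmorphV !rmorph_nat.
    rewrite hC -uu.
    by field.
  move: dE; set X := 17 / 16 - cos t / 2 => dE.
  have -> : (15 / 16 / X)%:C = 15 / 16 / ((1 - u / 4) * (1 - u^-1 / 4)) by rewrite dE !rmorphM !fmorphV !rmorph_nat.
  have d1 : 1 - u^-1 / 4 != 0 by rewrite den_neq0// normcV u1 invr1 ltr1n.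
  have n1 : u - 4^-1 != 0 by move: n0; rewrite /moebius_inv mulf_eq0 negb_or => /andP[].
  rewrite /moebius_inv /moebius_inv'.
  have -> : 1 - u^-1 / 4 = (4 * u - 1) / (4 * u) by field.
  have -> : u - 4^-1 = (4 * u - 1) / 4 by field.
  have n4 : 4 * u - 1 != 0 by apply: contra n1 => /eqP n4; apply/eqP; rewrite -(mulKf (four_neq0 R) u) -[4 * u](subrK 1) n4 add0r mulr1 subrr.
  have d4 : 4 - u != 0 by apply: contra d0 => /eqP d4; apply/eqP; rewrite -[u](subKr 4) d4 subr0 divff ?subrr ?(four_neq0 R).
  by field; rewrite ?n4 ?d4 ?u0.
by rewrite lecR divr_ge0// ltW.
Qed.
End Mean.

(** * Positive densities, the Lasota-Yorke inequality and the collapse along zeros *)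

Section Dynamics.
Variable R : realType.
Local Notation C := R[i].
Local Notation Re := complex.Re.
Local Notation Im := complex.Im.
Local Notation mu := (@lebesgue_measure R).

Implicit Types (b : bool) (u v z : C) (f g : C -> C) (n k : int).

Lemma Rintegral_norm_le (a b : R) (h g : R -> R) :
  mu.-integrable `[a, b] (EFin \o h) -> mu.-integrable `[a, b] (EFin \o g) ->
  (forall t, a <= t <= b -> `|h t| <= g t) ->
  `|\int[mu]_(t in `[a, b]) h t| <= \int[mu]_(t in `[a, b]) g t.
Proof.
move=> ih ig hg; apply: le_trans (le_normr_Rintegral _ ih) _ => //.
have iN : mu.-integrable `[a, b] (EFin \o (fun t => `|h t|)) by exact: integrable_norm ih.
by apply: (le_Rintegral _ iN ig) => // t; rewrite /= in_itv /= => /hg.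
Qed.

Lemma Cint_dom (a b : R) (h g : R -> C) : pconton a b h -> pconton a b g ->
  (forall t, a <= t <= b -> normc (h t) <= Re (g t)) ->
  normc (Cint a b h) <= 2 * Re (Cint a b g).
Proof.
move=> ch cg hg; have [i1 i2] := pconton_integrable ch; have [j1 _] := pconton_integrable cg.
apply: le_trans (normc_le_ReIm _) _; rewrite mulr_natl mulr2n; apply: lerD.
  by apply: (Rintegral_norm_le i1 j1) => t /hg; apply: le_trans; exact: Re_le_normc.
by apply: (Rintegral_norm_le i2 j1) => t /hg; apply: le_trans; exact: Im_le_normc.
Qed.

Lemma Cintegral_ge0 (D : set R) (h : R -> C) : (forall t, D t -> 0 <= h t) -> 0 <= Cintegral D h.
Proof.
move=> h0; have {}h0 t : D t -> Im (h t) = 0 /\ 0 <= Re (h t).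
  by move=> /h0; rewrite lecE /= => /andP[/eqP -> ->].
rewrite /Cintegral lecE /=; apply/andP; split.
  rewrite /Rintegral [X in fine X](_ : _ = 0%E) //; rewrite -[RHS](integral0 mu D).
  by apply: eq_integral => t /set_mem /h0[-> _].
by apply: Rintegral_ge0 => t /h0[].
Qed.

(** Positivity gives [normc (f z) = f z * z] on the circle, so every coefficient is dominated by the
    mean of this density, which is the coefficient of index -1. The 2 comes from the two
    components. *)
Lemma pos_cf_bound f n : circcont f 1 -> circle_pos f -> normc (cf f n) <= 2 * Re (cf f (-1)).
Proof.
move=> cf1 pf; have P := pi2_gt0 R.
have c0 : 0 < (2 * pi)^-1 :> R by rewrite invr_gt0.
have pz k : circcont (fun z => f z * z ^ k) 1.
  by apply: circcontM => //; exact: circcont_exprz.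
have E : Re (cf f (-1)) = (2 * pi)^-1 * Re (circint (fun z => f z * z ^ (- -1)) 1).
  by rewrite /cf /lc ReZ /= mul0r subr0.
rewrite E mulrCA /cf /lc normcM normc_real gtr0_norm// ler_pM2l//.
apply: (Cint_dom (pz (- n)) (pz _)) => t _; set z := _ * expi t.
have z1 : normc z = 1 by rewrite normcM normc_real normr1 mul1r normc_expi.
rewrite opprK expr1z normcM normc_exprz z1 exp1rz mulr1.
have := pf z z1; rewrite mulrC lecE /= => /andP[/eqP i0 r0].
have -> : normc (f z) = normc (f z * z) by rewrite normcM z1 mulr1.
rewrite -(@ler_pXn2r _ 2) ?nnegrE ?normc_ge0//.
by rewrite sqr_normc_ReIm i0 expr0n addr0.
Qed.

Variable rho eps : R.
Hypothesis rho0 : 0 < rho.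
Hypothesis rho1 : rho < 1.

Definition opA b (f : C -> C) : C -> C := U_operator eps (PF_operator rho (T_map b) f).

(** The bound on the maximum modulus, evaluated at the point [rho] for [T_map true]. For squaring
    the corresponding inequality is [rho ^+ 2 < rho], which is automatic. *)
Definition good b := b -> ((rho + 4^-1) / (1 + rho / 4)) ^+ 2 < rho.

Lemma branch_circcont b f : good b -> H2 rho f -> circcont (branch b f) 1.
Proof.
move=> gb Hf; have [s1 [s2 [r1 [D bb]]]] := branch_bounds_ex rho0 rho1 gb.
have [s10 s11 _ _] := branch_bounds_pos rho0 bb.
by apply: (holo_circcont s10 (branch_holo rho0 bb Hf)); rewrite s11 invf_gt1.
Qed.

Lemma opA_spec b f : good b -> H2 rho f -> exists s B : R, [/\ 0 < s, s < rho,
  gbound (fun k => ufactor eps k * pfc b f k) B s & opA b f = lsynth rho (fun k => ufactor eps k * pfc b f k)].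
Proof.
move=> gb Hf; have [s1 [s2 [r1 [D bb]]]] := branch_bounds_ex rho0 rho1 gb.
have [s10 s11 s20 _] := branch_bounds_pos rho0 bb.
have [E1 [B B0 hB] _] := PF_operatorE rho0 rho1 bb Hf.
have s2r : s2 ^+ 2 < rho by case: bb => [[]].
have s220 : 0 < s2 ^+ 2 by rewrite exprn_gt0.
exists (s2 ^+ 2), (2 * B); split=> //; first exact: ufactor_gbound.
by rewrite /opA E1 (U_lsynth rho0 s220 s2r eps hB).
Qed.

Lemma opA_H2 b f : good b -> H2 rho f -> H2 rho (opA b f).
Proof.
move=> gb Hf; have [s [B [s0 sr hB ->]]] := opA_spec gb Hf.
exact: (lsynth_H2 rho0 rho1 s0 sr hB).
Qed.

Lemma opA_cf b f k : good b -> H2 rho f -> cf (opA b f) k = ufactor eps k * pfc b f k.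
Proof.
move=> gb Hf; have [s [B [s0 sr hB ->]]] := opA_spec gb Hf.
exact: (lsynth_cf rho0 rho1 s0 sr k hB).
Qed.

Lemma opA_lin b (a : C) f g : good b -> H2 rho f -> H2 rho g ->
  opA b (fun z => a * f z + g z) = (fun z => a * opA b f z + opA b g z).
Proof.
move=> gb Hf Hg; have Hfg := H2_lin rho0 rho1 a Hf Hg.
have HA := opA_H2 gb Hf; have HB := opA_H2 gb Hg.
apply: (H2_ext rho0 rho1 (opA_H2 gb Hfg) (H2_lin rho0 rho1 a HA HB)) => n.
rewrite [LHS](opA_cf n gb Hfg) [RHS](cf_lin rho0 rho1 a n HA HB) (opA_cf n gb Hf) (opA_cf n gb Hg) /pfc.
have cf1 := branch_circcont gb Hf; have cg1 := branch_circcont gb Hg.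
have -> : branch b (fun z => a * f z + g z) = (fun u => a * branch b f u + branch b g u).
  by apply/funext => u; rewrite /branch mulrDl mulrA.
rewrite (lcD _ (circcontM (circcont_cst a 1) cf1) cg1) (lcZ _ _ cf1).
by rewrite mulrDr mulrCA.
Qed.

Lemma opA_mean b f : good b -> H2 rho f -> cf (opA b f) (-1) = cf f (-1).
Proof.
move=> gb Hf; rewrite opA_cf// ufactor_fix mul1r.
exact: (pfc_mean rho0 rho1 Hf (branch_circcont gb Hf)).
Qed.

Lemma opA_false f k : H2 rho f -> cf (opA false f) k = ufactor eps k * cf f (2 * k + 1).
Proof.
by move=> Hf; rewrite opA_cf//; congr (_ * _); apply: eq_lc => // u _; rewrite /branch mulr1.
Qed.

Lemma branch_pos b f u : circle_pos f -> normc u = 1 -> 0 <= u * branch b f u.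
Proof.
move=> pf u1; case: b; last by rewrite /branch mulr1; exact: pf.
have n1 := normc_moebius_inv u1.
have n0 : moebius_inv true u != 0 by rewrite -normc_gt0 n1.
rewrite (_ : u * _ = (moebius_inv true u * f (moebius_inv true u)) * (u * moebius_inv' true u / moebius_inv true u)).
  by rewrite mulr_ge0 ?moebius_weight_ge0// pf.
rewrite /branch; move: n0; move: (moebius_inv _ _) (moebius_inv' _ _) => m m' m0.
by move: (f m) => y; field.
Qed.

(** In terms of [z * f z] both factors form combinations with nonnegative weights: over the two
    preimages of a point, then over rotations of it. *)
Lemma opA_pos b f : good b -> H2 rho f -> circle_pos f -> circle_pos (opA b f).
Proof.
move=> gb Hf pf; have [s1 [s2 [r1 [D bb]]]] := branch_bounds_ex rho0 rho1 gb.
have [_ _ EP] := PF_operatorE rho0 rho1 bb Hf.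
have pg z : normc z = 1 -> 0 <= z * PF_operator rho (T_map b) f z.
  move=> z1; rewrite EP//; have [u uE] := csqrt_ex z.
  have u1 : normc u = 1 by apply/eqP; rewrite -(@eqrXn2 _ 2)// ?normc_ge0// -normcX uE z1 expr1n.
  have u0 : u != 0 by rewrite -normc_gt0 u1.
  rewrite -uE PF_sumE//.
  have h1 := branch_pos b pf u1; have h2 : 0 <= - u * branch b f (- u) by apply: branch_pos; rewrite ?normcN.
  have -> : u ^+ 2 * ((branch b f u - branch b f (- u)) / (2 * u)) = (u * branch b f u + - u * branch b f (- u)) / 2.
    by move: (branch _ _ _) (branch _ _ _) => x y; field.
  by rewrite divr_ge0// addr_ge0.
move=> z z1; rewrite /opA /U_operator mulrCA mulr_ge0 ?lecR ?invr_ge0//.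
have z0 : z != 0 by rewrite -normc_gt0 z1.
pose w t := expi (- (2 * pi * eps * t)) : C.
have zw t : normc (z * w t) = 1 by rewrite normcM z1 normc_expi mulr1.
have [s [B [s0 sr hB EPF]]] : exists s B : R, [/\ 0 < s, s < rho, gbound (pfc b f) B s &
    PF_operator rho (T_map b) f = lsynth rho (pfc b f)].
  have [E1 [B B0 hB] _] := PF_operatorE rho0 rho1 bb Hf; have [_ _ s20 _] := branch_bounds_pos rho0 bb.
  by exists (s2 ^+ 2), B; split=> //; [exact: exprn_gt0|case: bb => [[]]].
have HP : H2 rho (PF_operator rho (T_map b) f) by rewrite EPF; exact: (lsynth_H2 rho0 rho1 s0 sr hB).
have wE : w = fun t => expi (- (2 * pi * eps) * t) by apply/funext => t; rewrite mulNr.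
have pw t : pcont w t by rewrite wE; exact: pcont_expiM.
have pzw t : pcont (fun t => z * w t) t by apply: pcontM; [exact: pcont_cst|exact: pw].
have pP t : pcont (fun t => PF_operator rho (T_map b) f (z * w t)) t.
  have zA : annulus rho (z * w t) by rewrite annulusE zw rho1 invf_gt1.
  have [l hl] := H2_holo HP zA.
  exact: (pcont_comp (cdiff_cont hl) (pzw t)).
rewrite -[Cintegral _ _]/(Cint (-1) 1 (fun t => PF_operator rho (T_map b) f (z * w t) * w t)).
rewrite -CintZ; last by move=> t _; apply: pcontM; [exact: pP|exact: pw].
by apply: Cintegral_ge0 => t _; rewrite mulrCA mulrC pg.
Qed.

(** * A compact set of densities invariant under the cocycle *)

Lemma gbound_le (c : int -> C) (B B' q q' : R) : 0 <= q -> q <= q' -> B <= B' ->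
  gbound c B q -> gbound c B' q'.
Proof.
move=> q0 qq BB hc n; have B0 := gbound_ge0 hc.
by apply: le_trans (hc n) _; apply: ler_pM => //; [exact: exprn_ge0|exact: expn_le].
Qed.

(* Interpolation: small indices are controlled by the uniform bound [D], large ones by the decay. *)
Lemma gbound_split (c : int -> C) (B D q q' : R) K : 0 < q -> q < q' -> q' < 1 ->
  gbound c B q -> (forall n, normc (c n) <= D) ->
  gbound c (D * q'^-1 ^+ K + B * (q / q') ^+ K) q'.
Proof.
move=> q0 qq q1 hc hD n; have B0 := gbound_ge0 hc.
have q'0 : 0 < q' by apply: lt_trans qq.
have D0 : 0 <= D by apply: le_trans (hD 0); exact: normc_ge0.
have x0 : 0 <= q / q' by rewrite divr_ge0 ?ltW.
have x1 : q / q' <= 1 by rewrite ler_pdivrMr// mul1r ltW.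
have p0 (k : nat) : 0 <= q' ^+ k by rewrite exprn_ge0// ltW.
have [nK|nK] := leqP `|n| K.
  apply: le_trans (hD n) _; rewrite mulrDl; apply: (@le_trans _ _ (D * q'^-1 ^+ K * q' ^+ `|n|)).
    rewrite -mulrA ler_peMr// -(subnK nK) exprD exprVn -mulrA -exprMn mulVf ?gt_eqF// expr1n mulr1.
    by rewrite -exprVn exprn_ege1// invf_ge1// ltW.
  by rewrite lerDl mulr_ge0// mulr_ge0// exprn_ge0.
apply: le_trans (hc n) _; rewrite mulrDl.
have -> : q ^+ `|n| = (q / q') ^+ `|n| * q' ^+ `|n| by rewrite -exprMn divfK ?gt_eqF.
apply: (@le_trans _ _ (B * (q / q') ^+ K * q' ^+ `|n|)).
  rewrite mulrA ler_wpM2r// ler_wpM2l// ; apply: ler_wiXn2l => //; exact: ltnW.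
by rewrite lerDr mulr_ge0// mulr_ge0// exprn_ge0// invr_ge0 ltW.
Qed.

(** The gain in regularity: decay at a rate slightly above [rho] becomes decay at a rate below
    [rho]. The output rate [s] does not depend on the input rate [q]; only the constant [E] does. *)
Lemma opA_smooth b : exists r s : R, [/\ rho < r, r < 1, 0 < s, s < rho &
  forall q, rho < q -> q < r -> exists2 E : R, 0 <= E & forall f B, good b -> H2 rho f -> gbound (cf f) B q ->
    gbound (cf (opA b f)) (E * B) s].
Proof.
have [gb|ngb] := pselect (good b); last first.
  exists ((rho + 1) / 2), (rho / 2); have [h1 h2] := midf_lt rho1.
  split=> //; [by rewrite divr_gt0|by rewrite ltr_pdivrMr// ltr_pMr// ltr1n|].
  by move=> q _ _; exists 0.
have [s1 [s2 [r1 [D bb]]]] := branch_bounds_ex rho0 rho1 gb.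
have [s10 s11 s20 r10] := branch_bounds_pos rho0 bb.
have [[_ _ s21 s2r] rr1 r11 D0 _] := bb.
have s220 : 0 < s2 ^+ 2 by rewrite exprn_gt0.
exists r1, (s2 ^+ 2); split=> // q rq qr.
have d0 : 0 < 1 - q / r1 by rewrite subr_gt0 ltr_pdivrMr// mul1r.
exists (2 * (2 * (4 / (1 - q / r1) * D) / s2)).
  by rewrite mulr_ge0// divr_ge0 ?(ltW s20)// !mulr_ge0// ?(ltW D0)// invr_ge0 ltW.
move=> f B _ Hf hB n; rewrite opA_cf//.
have hp := pfc_gbound rho0 bb Hf (fun u uA => f_bound rho0 rho1 bb Hf rq qr hB uA).
apply: le_trans (ufactor_gbound eps hp n) _.
by rewrite le_eqVlt; apply/orP; left; apply/eqP; congr (_ * _); ring.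
Qed.

(** The strong norm is the constant in the decay at rate [q], the weak one the supremum [D] of the
    coefficients. Smoothing is available already from a larger rate [q'], with [rho < q < q' < r].
    Relaxing [q] to [q'] by [gbound_split] multiplies [B] by the small factor [(q / q') ^+ K] at the
    expense of a multiple of [D]. *)
Lemma lasota_yorke : exists q s E : R, [/\ rho < q, q < 1, 0 < s, s < rho & 0 <= E /\
  forall b f B D, good b -> H2 rho f -> gbound (cf f) B q -> (forall n, normc (cf f n) <= D) ->
    gbound (cf (opA b f)) (B / 2 + E * D) q /\ gbound (cf (opA b f)) (E * B) s].
Proof.
have [r1 [s1 [rr1 r11 s10 s1r h1]]] := opA_smooth true.
have [r2 [s2 [rr2 r21 s20 s2r h2]]] := opA_smooth false.
pose r := Num.min r1 r2; pose s := Num.max s1 s2.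
have rr : rho < r by rewrite lt_min rr1.
have s0 : 0 < s by rewrite lt_max s10.
have sr : s < rho by rewrite gt_max s1r.
have [q1 q2] := midf_lt rr; pose q' := (rho + r) / 2.
have [q3 q4] := midf_lt (q1 : rho < q'); pose q := (rho + q') / 2.
have qr1 : q' < r1 by apply: lt_le_trans q2 _; rewrite ge_min lexx.
have qr2 : q' < r2 by apply: lt_le_trans q2 _; rewrite ge_min lexx orbT.
have [E1 E10 {}h1] := h1 q' q1 qr1; have [E2 E20 {}h2] := h2 q' q1 qr2.
have q0 : 0 < q by apply: lt_trans q3.
have q'0 : 0 < q' by apply: lt_trans q1.
have q'1 : q' < 1 by apply: lt_trans qr1 _.
pose E := E1 + E2; have E0 : 0 <= E by rewrite addr_ge0.
have x01 : 0 <= q / q' < 1 by rewrite divr_ge0 ?ltW//= ltr_pdivrMr// mul1r.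
(* [K] makes the factor in front of [B] at most 1 / 2 after multiplication by the smoothing constant
   [E]. *)
have [K hK] := geo_small E x01 (divr_gt0 ltr01 (ltr0n _ 2)).
have hE b f B : good b -> H2 rho f -> gbound (cf f) B q' -> gbound (cf (opA b f)) (E * B) s.
  move=> gb Hf hB; have B0 := gbound_ge0 hB.
  case: b gb => gb; [apply: gbound_le (h1 f B gb Hf hB)|apply: gbound_le (h2 f B gb Hf hB)]; rewrite ?(ltW s10) ?(ltW s20) ?le_max ?lexx ?orbT//.
    by rewrite ler_wpM2r// lerDl.
  by rewrite ler_wpM2r// lerDr.
have qK1 : 1 <= q'^-1 ^+ K by rewrite exprn_ege1// invf_ge1// ltW.
exists q, s, (E * q'^-1 ^+ K); split=> //; first by apply: lt_trans q4 _.
split; first by rewrite mulr_ge0// (le_trans ler01).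
move=> b f B D gb Hf hB hD; have B0 := gbound_ge0 hB; split; last first.
  apply: (gbound_le (ltW s0) (lexx s) _ (hE b f B gb Hf _)).
    by rewrite ler_wpM2r// ler_peMr.
  exact: (gbound_le (ltW q0) (ltW q4) (lexx B) hB).
have hS := gbound_split K q0 q4 q'1 hB hD.
apply: (gbound_le (ltW s0) _ _ (hE b f _ gb Hf hS)); first by rewrite ltW// (lt_trans sr).
rewrite mulrDr addrC; apply: lerD; last by rewrite le_eqVlt; apply/orP; left; apply/eqP; ring.
rewrite mulrCA ler_wpM2l//.
have := hK K (leqnn K); rewrite div1r => /ltW; apply: le_trans.
by [].
Qed.

(** The function [1 / z] on the annulus: the uniform density, for which [z * f z = 1] on the
    circle. *)
Definition unit_density : C -> C := lsynth rho (fun n => (n == -1)%:R).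

Lemma unit_gbound (q : R) : 0 < q -> gbound (fun n => (n == -1)%:R : C) q^-1 q.
Proof.
move=> q0 n; case: eqP => [->|_]; first by rewrite normc1 expr1 mulVf ?gt_eqF.
by rewrite normc_0 mulr_ge0 ?invr_ge0 ?exprn_ge0 ?(ltW q0).
Qed.

Lemma half_rho : 0 < rho / 2 /\ rho / 2 < rho.
Proof. by rewrite divr_gt0// ltr_pdivrMr// ltr_pMr// ltr1n. Qed.

Lemma unit_H2 : H2 rho unit_density.
Proof. have [h0 hr] := half_rho; exact: (lsynth_H2 rho0 rho1 h0 hr (unit_gbound h0)). Qed.

Lemma unit_cf n : cf unit_density n = (n == -1)%:R.
Proof. have [h0 hr] := half_rho; exact: (lsynth_cf rho0 rho1 h0 hr n (unit_gbound h0)). Qed.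

Lemma unit_pos : circle_pos unit_density.
Proof.
move=> z z1; have [h0 hr] := half_rho.
have z0 : z != 0 by rewrite -normc_gt0 z1.
rewrite /unit_density /lsynth z1 one_in//.
suff -> : lsum (fun n => (n == -1)%:R) z = z^-1 by rewrite mulfV// ler01.
apply: (sconv_unique (lsum_conv h0 (unit_gbound h0) _)).
  by rewrite z1 (lt_trans hr rho1) invf_gt1// (lt_trans hr rho1).
apply: (sconv_shift (k := 1)); apply: (@sconv_geo _ _ _ 0 0); first by rewrite lexx ltr01.
move=> K; rewrite mul0r addn1 /lpart big_ord_recl /= mul0r add0r expr1 mul1r.
by rewrite big1 => [|i _]; rewrite ?addr0 ?subrr ?normc_0// !mul0r addr0.
Qed.

Lemma invariant_densities : exists (K : set (C -> C)) (s B : R), [/\ 0 < s, s < rho, K unit_density,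
  (forall b f, good b -> K f -> K (opA b f)) &
  forall f, K f -> [/\ H2 rho f, cf f (-1) = 1 & gbound (cf f) B s]].
Proof.
have [q [s [E [rq q1 s0 sr [E0 LY]]]]] := lasota_yorke.
have q0 : 0 < q by apply: lt_trans rq.
(* Chosen so that [B / 2 + E * 2 <= B], where 2 bounds the coefficients of a positive function of
   mean 1. The terms [q^-1] and [s^-1] make room for [unit_density]. *)
pose B := 4 * E + q^-1; pose B' := E * B + s^-1.
have B0 : 0 <= B by rewrite addr_ge0 ?mulr_ge0 ?invr_ge0 ?(ltW q0).
exists [set f | [/\ H2 rho f, circle_pos f, cf f (-1) = 1, gbound (cf f) B q & gbound (cf f) B' s]], s, B'.
have uE : cf unit_density = (fun n => (n == -1)%:R) by apply/funext => n; exact: unit_cf.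
split=> //; last by move=> f [].
- split; [exact: unit_H2|exact: unit_pos|by rewrite unit_cf| |].
    by rewrite uE; apply: (gbound_le (ltW q0) (lexx q) _ (unit_gbound q0)); rewrite lerDr mulr_ge0.
  by rewrite uE; apply: (gbound_le (ltW s0) (lexx s) _ (unit_gbound s0)); rewrite lerDr mulr_ge0.
move=> b f gb [Hf pf f1 fq fs].
have hD n : normc (cf f n) <= 2.
  by have := pos_cf_bound n (H2_circcont rho0 rho1 Hf) pf; rewrite f1 /= mulr1.
have [h1 h2] := LY b f B 2 gb Hf fq hD.
split; [exact: opA_H2|exact: opA_pos|by rewrite opA_mean| |].
  apply: (gbound_le (ltW q0) (lexx q) _ h1); rewrite /B.
  have : 0 <= q^-1 by rewrite invr_ge0 ltW.
  by move: (q^-1) => y y0; clear -E0 y0; lra.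
by apply: (gbound_le (ltW s0) (lexx s) _ h2); rewrite lerDl invr_ge0 ltW.
Qed.

(** * Collapse along a run of zeros *)

Lemma opA_iter_H2 (n : nat) f : H2 rho f -> H2 rho (iter n (opA false) f).
Proof. by move=> Hf; elim: n => //= n; exact: opA_H2. Qed.

(** Both sides are compared coefficient by coefficient; the trailing [+ 0] gives the right-hand side
    the shape handled by [H2_lin] and [cf_lin]. *)
Lemma collapse M f : eps = (2 * (2 ^ M)%N%:R)^-1 -> H2 rho f ->
  iter M.+1 (opA false) f = (fun z => cf f (-1) * unit_density z + 0).
Proof.
move=> epsE Hf; have HI := opA_iter_H2.
have fg : good false by [].
have cm (j : nat) : cf (iter j (opA false) f) (-1) = cf f (-1).
  by elim: j => //= j IH; rewrite opA_mean//; exact: HI.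
(* Each step back doubles [m = k + 1]; after [j] of them the index is killed if [m * 2 ^ j] is a
   multiple of [2 ^ M]. For [j = M] this holds for every [m]. *)
have kill (j : nat) (k m : int) : k + 1 = m -> m != 0 -> (exists m' : int, m * (2 ^ j)%N%:Z = m' * (2 ^ M)%N%:Z) ->
    cf (iter j.+1 (opA false) f) k = 0.
  elim: j k m => [|j IH] k m km m0 [m' E]; rewrite iterS opA_false; try exact: HI.
    rewrite epsE (@ufactor_kill R (2 ^ M) k m') ?mul0r// ?expn_gt0//.
      by apply: contra m0 => /eqP m'0; move: E; rewrite m'0 mul0r mulr1 => ->.
    by rewrite km -E mulr1.
  rewrite (IH (2 * k + 1) (m * 2)) ?mulr0//; first by lia.
    by rewrite mulf_neq0.
  by exists m'; rewrite -E expnS PoszM mulrA.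
have H0 : H2 rho (fun=> 0 : C).
  have := H2_lin rho0 rho1 (-1) Hf Hf; rewrite (_ : (fun z => _) = fun=> 0)//.
  by apply/funext => z; rewrite mulN1r addNr.
apply: (H2_ext rho0 rho1 (HI _ _ Hf) (H2_lin rho0 rho1 _ unit_H2 H0)) => n.
have c0 : cf (fun=> 0 : C) n = 0 by rewrite /cf lc_cst// mul0r.
rewrite (cf_lin rho0 rho1 _ _ unit_H2 H0) c0 addr0 unit_cf.
case: (eqVneq n (-1)) => [->|n1]; first by rewrite cm mulr1.
rewrite mulr0; apply: (kill M n (n + 1)) => //; first by rewrite addr_eq0.
by exists (n + 1).
Qed.
End Dynamics.

(** * Runs of zeros under the Bernoulli measure *)

Section Measure.
Variable R : realType.
Variables (p : R) (P : probability Omega R).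
Hypothesis hp : 0 < p <= 1.
Hypothesis hP : bernoulli_measure p P.

Definition zeros (s : seq int) : set Omega := [set w | {in s, forall i, w i = false}].

Lemma measurable_coord (i : int) b : measurable [set w : Omega | w i = b].
Proof. by apply: sub_sigma_algebra; exists i, b. Qed.

Lemma zeros_cat s t : zeros (s ++ t) = zeros s `&` zeros t.
Proof.
apply/seteqP; split=> w.
  by move=> h; split=> i si; apply: h; rewrite mem_cat si ?orbT.
by move=> [h1 h2] i; rewrite mem_cat => /orP[/h1|/h2].
Qed.

Lemma measurable_zeros s : measurable (zeros s).
Proof.
elim: s => [|i s IH].
  by rewrite (_ : zeros [::] = setT)//; apply/seteqP; split.
rewrite -cat1s zeros_cat; apply: measurableI => //.
rewrite (_ : zeros [:: i] = [set w | w i = false]); first exact: measurable_coord.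
apply/seteqP; split=> w; first by apply; rewrite inE.
by move=> h j; rewrite inE => /eqP ->.
Qed.

Lemma P_zeros s : uniq s -> P (zeros s) = (p ^+ size s)%:E.
Proof.
move=> us; have := @hP s (fun=> false) us; rewrite -/(zeros s) => ->; congr (_%:E).
by elim: s {us} => [|i s IH]; rewrite ?big_nil ?big_cons//= IH -exprS.
Qed.

Section Blocks.
Variables (m : nat) (S : nat -> seq int).
Hypothesis S_size : forall l, size (S l) = m.
Hypothesis S_uniq : forall l, uniq (S l).
Hypothesis S_disj : forall l k (i : int), (k < l)%N -> i \in S l -> i \notin S k.

Definition no_zero_block L : set Omega := [set w | forall l, (l < L)%N -> ~ zeros (S l) w].

Lemma no_zero_blockS L : no_zero_block L.+1 = no_zero_block L `\` zeros (S L).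
Proof.
apply/seteqP; split=> w.
  by move=> h; split; [move=> l lL; apply: h; exact: ltnW|exact: h].
by move=> [h1 h2] l; rewrite ltnS leq_eqVlt => /orP[/eqP ->//|/h1].
Qed.

Lemma measurable_no_zero_block L : measurable (no_zero_block L).
Proof.
elim: L => [|L IH]; first by rewrite (_ : no_zero_block 0 = setT)//; apply/seteqP; split.
by rewrite no_zero_blockS; apply: measurableD => //; exact: measurable_zeros.
Qed.

(** Independence extracted from the cylinder formula by induction on [L]. Excluding zeros on the
    last block is a difference of two events with one block fewer, in one of which that block has
    joined [T]; the induction therefore carries an arbitrary [T]. *)
Lemma P_no_zero_block L T : uniq T -> (forall l (i : int), (l < L)%N -> i \in T -> i \notin S l) ->
  P (no_zero_block L `&` zeros T) = ((1 - p ^+ m) ^+ L * p ^+ size T)%:E.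
Proof.
elim: L T => [|L IH] T uT dT.
  rewrite (_ : no_zero_block 0 = setT) ?setTI ?mul1r ?P_zeros//.
  by apply/seteqP; split.
have mA T' : measurable (no_zero_block L `&` zeros T').
  by apply: measurableI; [exact: measurable_no_zero_block|exact: measurable_zeros].
have -> : no_zero_block L.+1 `&` zeros T = (no_zero_block L `&` zeros T) `\` (no_zero_block L `&` zeros (S L ++ T)).
  rewrite no_zero_blockS zeros_cat; apply/seteqP; split=> w.
    by move=> [[h1 h2] h3]; split=> // -[_ []].
  by move=> [[h1 h3] h2]; split=> //; split=> // h4; apply: h2.
rewrite measureD//; last by rewrite (le_lt_trans (probability_le1 P (mA T)))// ltry.
have -> : no_zero_block L `&` zeros T `&` (no_zero_block L `&` zeros (S L ++ T)) = no_zero_block L `&` zeros (S L ++ T).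
  by rewrite zeros_cat; apply/seteqP; split=> w; [move=> [_]|move=> [h1 [h2 h3]]].
have dL l (i : int) : (l < L)%N -> i \in T -> i \notin S l by move=> lL; apply: dT; exact: ltnW.
have h1 : uniq (S L ++ T) by rewrite cat_uniq S_uniq uT andbT; apply/hasPn => i iT; exact: dT.
have h2 l (i : int) : (l < L)%N -> i \in S L ++ T -> i \notin S l.
  by move=> lL; rewrite mem_cat => /orP[iS|]; [exact: S_disj lL iS|exact: dL].
rewrite [X in (X - _)%E](IH T uT dL) [X in (_ - X)%E](IH _ h1 h2).
by rewrite size_cat S_size exprD -EFinB exprS; congr (_%:E); ring.
Qed.

(** The exceptional set has measure at most [(1 - p ^+ m) ^+ L] for every [L], which tends to 0
    because [p > 0]. *)
Lemma ae_zero_block : {ae P, forall w, exists l, zeros (S l) w}.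
Proof.
have /andP[p0 p1] := hp.
pose A := \bigcap_L no_zero_block L.
exists A; split.
- by apply: bigcapT_measurable => L; exact: measurable_no_zero_block.
- have mA : measurable A by apply: bigcapT_measurable => L; exact: measurable_no_zero_block.
  apply/eqP; rewrite eq_le measure_ge0 andbT; apply/lee_addgt0Pr => e e0; rewrite add0e.
  have x01 : 0 <= 1 - p ^+ m < 1.
    by rewrite subr_ge0 exprn_ile1 ?(ltW p0)//= ltrBlDr ltrDl exprn_gt0.
  have [L hL] := geo_small 1 x01 e0.
  have := @P_no_zero_block L [::] isT; move/(_ (fun l i _ (h : i \in [::]) => False_ind _ (Bool.diff_false_true h))).
  have -> : zeros [::] = setT by apply/seteqP; split.
  rewrite setIT mulr1 => EL.
  apply: le_trans (_ : P (no_zero_block L) <= _)%E.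
    by apply: le_measure; rewrite ?inE//; [exact: measurable_no_zero_block|move=> w; apply].
  by have := hL L (leqnn L); rewrite mul1r EL lee_fin => /ltW.
- move=> w /= h L _ l _ hl; apply: h; by exists l.
Qed.
End Blocks.

Lemma ae_zero_run (m : nat) (a : nat -> int) :
  (forall k l, (k < l)%N -> a k + m%:Z <= a l \/ a l + m%:Z <= a k) ->
  {ae P, forall w : Omega, exists l, forall j, (j < m)%N -> w (a l + j%:Z) = false}.
Proof.
move=> ha; pose S l := [seq a l + j%:Z | j <- iota 0 m].
apply: filterS (@ae_zero_block m S _ _ _).
- move=> w [l hl]; exists l => j jm; apply: hl; apply: map_f; by rewrite mem_iota.
- by move=> l; rewrite size_map size_iota.
- by move=> l; rewrite map_inj_uniq ?iota_uniq// => i j /addrI [].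
move=> l k i kl /mapP[j jm ->]; apply/mapP => -[j' jm']; move: jm jm'; rewrite !mem_iota.
by have := ha k l kl; lia.
Qed.

(** If the inequality for the second map fails at the point [rho], the essential supremum can stay
    below [rho] only if the symbol 1 is negligible. Then [p = 1], and almost every path consists of
    zeros. *)
Lemma ae_good (rho : R) : 0 < rho -> (cocycle_max_modulus P rho < rho%:E)%E ->
  {ae P, forall w : Omega, forall i, good rho (w i)}.
Proof.
move=> rho0 hr; have [gt|ngt] := pselect (good rho true).
  by apply: nearW => w i; case: (w i).
have key : P.-negligible [set w : Omega | w 0 = true].
  have := @ess_sup_ge _ _ _ P (fun w => max_modulus (T_map (w 0)) rho).
  rewrite /almost_everywhere /= => /negligibleS; apply=> w /= w0 h; apply: ngt => _.
  have := le_lt_trans h hr; rewrite w0 => h'.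
  have E : normc (T_map true rho%:C) = ((rho + 4^-1) / (1 + rho / 4)) ^+ 2.
    have -> : T_map true rho%:C = (((rho + 4^-1) / (1 + rho / 4)) ^+ 2)%:C.
      by rewrite /T_map rmorphXn rmorphM fmorphV !rmorphD !rmorphM !fmorphV !rmorph_nat.
    by rewrite normc_real ger0_norm ?exprn_ge0// divr_ge0// addr_ge0 ?divr_ge0 ?(ltW rho0).
  rewrite -lte_fin -E; apply: le_lt_trans h'; apply: ereal_sup_ubound.
  by exists rho%:C => //; rewrite /circle /mkset normc_real gtr0_norm.
have p1 : p = 1.
  have /negligibleP := key; move=> /(_ (measurable_coord 0 true)).
  have := @hP [:: 0] (fun=> true) isT; rewrite big_seq1.
  rewrite (_ : [set w | _] = [set w : Omega | w 0 = true]); last first.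
    apply/seteqP; split=> w; first by apply; rewrite inE.
    by move=> h j; rewrite inE => /eqP ->.
  by move=> /esym E0 E1; have [] := etrans E0 E1; move/eqP; rewrite subr_eq0 => /eqP.
have hi i : {ae P, forall w : Omega, good rho (w i)}.
  exists [set w : Omega | w i = true]; split; first exact: measurable_coord.
    have := @hP [:: i] (fun=> true) isT; rewrite big_seq1 p1 subrr => E0; apply: etrans E0; congr (P _).
    apply/seteqP; split=> w; last by apply; rewrite inE.
    by move=> h j; rewrite inE => /eqP ->.
  by move=> w /= h; case: (w i) h => // h; case: h.
have h1 := ae_foralln (fun n : nat => hi n%:Z).
have h2 := ae_foralln (fun n : nat => hi (Negz n)).
by apply: filterS2 h1 h2 => w h1 h2 [n|n].
Qed.
End Measure.

(** * Logarithmic rates of bounded and of eventually vanishing sequences *)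

Section LogRate.
Variable R : realType.
Implicit Types (x : nat -> \bar R).

Lemma cvg_invn : (n%:R^-1 : R) @[n --> \oo] --> (0 : R).
Proof.
apply/gtr0_cvgV0; last exact: cvgr_idn.
by near=> n; rewrite ltr0n; near: n; exists 1%N.
Unshelve. all: by end_near. Qed.

Lemma cvg_log_rate_bounded x (a b : R) N0 : 0 < a ->
  (forall n, (N0 <= n)%N -> (a%:E <= x n <= b%:E)%E) -> log_rate x @ \oo --> 0%E.
Proof.
move=> a0 hx; have hc (c : R) : ((n%:R^-1 * c)%:E)@[n --> \oo] --> (0%E : \bar R).
  apply: cvg_EFin; first by near=> n.
  by rewrite -[0](mul0r c); apply: cvgMl; exact: cvg_invn.
have b0 : 0 < b.
  have /andP[h1 h2] := hx N0 (leqnn _).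
  by apply: lt_le_trans a0 _; rewrite -lee_fin (le_trans h1).
apply: (squeeze_cvge _ (hc (ln a)) (hc (ln b))).
exists N0 => // n /= nN; have /andP[h1 h2] := hx n nN.
have xI : x n \in `[0%E, +oo%E] by rewrite in_itv /= leey andbT (le_trans _ h1)// lee_fin ltW.
rewrite /log_rate !EFinM -!lne_EFin//.
by apply/andP; split; apply: lee_wpmul2l; rewrite ?lee_fin ?invr_ge0// lee_lne// in_itv /= leey andbT lee_fin ltW.
Unshelve. all: by end_near. Qed.

Lemma cvg_log_rate_zero x N0 : (forall n, (N0 <= n)%N -> x n = 0%E) -> log_rate x @ \oo --> -oo%E.
Proof.
move=> hx; apply: (@cvg_trans _ (cst -oo%E @ \oo)); last exact: cvg_cst.
apply: near_eq_cvg; exists (maxn N0 1) => // n /=; rewrite geq_max => /andP[nN n1].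
by rewrite /log_rate hx// le0_lneNy// gt0_muleNy// lte_fin invr_gt0 ltr0n.
Qed.

Lemma limn_esup_log_rate_zero x N0 : (forall n, (N0 <= n)%N -> x n = 0%E) ->
  limn_esup (log_rate x) = -oo%E.
Proof.
move=> hx; have h := cvg_log_rate_zero hx.
by rewrite is_cvg_limn_esupE; [exact/cvg_lim|apply/cvg_ex; exists -oo%E].
Qed.
End LogRate.

(** * The cocycle along a path with runs of zeros *)

Section Assembly.
Variable R : realType.
Local Notation C := R[i].
Implicit Types (b : bool) (f g : C -> C) (w : Omega).
Variables rho eps : R.
Hypothesis rho0 : 0 < rho.
Hypothesis rho1 : rho < 1.
Variable M : nat.
Hypothesis epsE : eps = (2 * (2 ^ M)%N%:R)^-1.

Local Notation e := (unit_density rho).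
Local Notation A := (perturbed_cocycle rho eps).
Local Notation N := (@H2norm R rho).
Local Notation co := (cocycle left_shift A).

Definition good_path w := forall i, good rho (w i).
Definition zero_run w := forall j : nat, (j <= M)%N -> w j%:Z = false.
Definition back (n : nat) w : Omega := fun i => w (i - n%:Z).

Lemma iter_shift k w : iter k left_shift w = (fun i => w (i + k%:Z)) :> Omega.
Proof.
elim: k => [|k IH]; first by apply/funext => i; rewrite addr0.
by rewrite iterS IH; apply/funext => i; rewrite /left_shift -addrA (addrC 1) -PoszD addn1.
Qed.

Lemma good_path_iter k w : good_path w -> good_path (iter k left_shift w).
Proof. by move=> gw i; rewrite iter_shift. Qed.

Lemma good_path_back k w : good_path w -> good_path (back k w).
Proof. by move=> gw i; exact: gw. Qed.

Lemma coS n w f : co n.+1 w f = opA rho eps (w n%:Z) (co n w f).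
Proof. by rewrite /= /perturbed_cocycle /opA iter_shift add0r. Qed.

Lemma co_add n k w f : co (n + k) w f = co n (iter k left_shift w) (co k w f).
Proof.
elim: n => [|n IH]; first by rewrite add0n.
by rewrite addSn (coS (n + k)) (coS n) IH iter_shift PoszD.
Qed.

Lemma co_H2 n w f : good_path w -> H2 rho f -> H2 rho (co n w f).
Proof. by move=> gw Hf; elim: n => // n IH; rewrite coS; exact: opA_H2. Qed.

Lemma co_mean n w f : good_path w -> H2 rho f -> cf (co n w f) (-1) = cf f (-1).
Proof.
move=> gw Hf; elim: n => // n IH; rewrite coS opA_mean//; exact: co_H2.
Qed.

Lemma co_lin n w (a : C) f g : good_path w -> H2 rho f -> H2 rho g ->
  co n w (fun z => a * f z + g z) = (fun z => a * co n w f z + co n w g z).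
Proof.
move=> gw Hf Hg; elim: n => // n IH; rewrite !coS IH opA_lin//; exact: co_H2.
Qed.

Lemma H2_0 : H2 rho (fun=> 0 : C).
Proof.
have He := unit_H2 rho0 rho1; have := H2_lin rho0 rho1 (-1) He He.
rewrite (_ : (fun z => _) = fun=> 0)//.
by apply/funext => z; rewrite mulN1r addNr.
Qed.

Lemma H2_scale (a : C) f : H2 rho f -> H2 rho (fun z => a * f z).
Proof.
move=> Hf; have := H2_lin rho0 rho1 a Hf H2_0; congr (H2 rho _).
by apply/funext => z; rewrite addr0.
Qed.

Lemma co_0 n w : good_path w -> co n w (fun=> 0 : C) = (fun=> 0 : C).
Proof.
move=> gw; have := co_lin n (-1) gw H2_0 H2_0.
rewrite (_ : (fun z => -1 * 0 + 0) = (fun=> 0 : C)); last by apply/funext => z; rewrite mulr0 addr0.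
by move=> ->; apply/funext => z; rewrite mulN1r addNr.
Qed.

Lemma co_scale n w (a : C) f : good_path w -> H2 rho f ->
  co n w (fun z => a * f z) = (fun z => a * co n w f z).
Proof.
move=> gw Hf; have := co_lin n a gw Hf H2_0; rewrite co_0//.
rewrite (_ : (fun z => a * f z + 0) = (fun z => a * f z)); last by apply/funext => z; rewrite addr0.
by move=> ->; apply/funext => z; rewrite addr0.
Qed.

Lemma cf_scale (a : C) f n : H2 rho f -> cf (fun z => a * f z) n = a * cf f n.
Proof. by move=> Hf; rewrite /cf (lcZ _ _ (H2_circcont rho0 rho1 Hf)). Qed.

Lemma co_run w f : zero_run w -> co M.+1 w f = iter M.+1 (opA rho eps false) f.
Proof.
move=> zw; suff H n : (n <= M.+1)%N -> co n w f = iter n (opA rho eps false) f by exact: H.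
elim: n => [_|n IH nM]; first exact: erefl.
have E := IH (ltnW nM); have z := zw n nM.
by rewrite coS z E; exact: erefl.
Qed.

(** The run sends [f] to its mean times [e], and [e] to itself; after the run the cocycle acts
    linearly on both sides. *)
Lemma co_collapse n w f : good_path w -> zero_run w -> (M < n)%N -> H2 rho f ->
  co n w f = (fun z => cf f (-1) * co n w e z).
Proof.
move=> gw zw nM Hf; have He := unit_H2 rho0 rho1.
rewrite -(subnK nM) !co_add !co_run// !(collapse rho0 rho1 epsE)//.
rewrite (unit_cf rho0 rho1) eqxx.
rewrite (_ : (fun z => 1 * e z + 0) = e); last by apply/funext => z; rewrite mul1r addr0.
rewrite (_ : (fun z => cf f (-1) * e z + 0) = (fun z => cf f (-1) * e z)); last by apply/funext => z; rewrite addr0.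
by apply: co_scale => //; exact: good_path_iter.
Qed.

(* The invariant density, obtained by pushing forward from a run of zeros in the past. *)
Definition density w v := exists n : nat, [/\ (M < n)%N, zero_run (back n w) & v = co n (back n w) e].

Lemma iter_back n d w : iter d left_shift (back (d + n) w) = back n w.
Proof.
by rewrite iter_shift; apply/funext => i; rewrite /back PoszD opprD addrA addrK.
Qed.

(** The push-forward from the earlier run passes through the later one, where every function of mean
    1 becomes [e]. From there on both constructions coincide. *)
Lemma density_unique w v v' : good_path w -> density w v -> density w v' -> v = v'.
Proof.
move=> gw [n [nM zn ->]] [n' [nM' zn' ->]].
wlog nn : n n' nM nM' zn zn' / (n <= n')%N.
  by move=> h; case: (leqP n n') => [|/ltnW] nn; [exact: h|apply/esym; exact: h].
have He := unit_H2 rho0 rho1.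
rewrite -(subnK nn) addnC co_add addnC iter_back.
have gb : good_path (back (n' - n + n) w) by exact: good_path_back.
have gn : good_path (back n w) by exact: good_path_back.
rewrite (co_collapse gn zn nM (co_H2 _ gb He)) co_mean// (unit_cf rho0 rho1) eqxx.
by apply/funext => z; rewrite mul1r.
Qed.

Lemma density_shift w v : density w v -> density (left_shift w) (A w v).
Proof.
move=> [n [nM zn ->]]; have E : back n.+1 (left_shift w) = back n w.
  by apply/funext => i; rewrite /back /left_shift; congr w; lia.
exists n.+1; split; [exact: ltnW|by rewrite E|].
by rewrite E coS /back subrr.
Qed.

Variables (K : set (C -> C)) (s B : R).
Hypothesis s0 : 0 < s.
Hypothesis srho : s < rho.
Hypothesis Ke : K e.
Hypothesis KA : forall b f, good rho b -> K f -> K (opA rho eps b f).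
Hypothesis KP : forall f, K f -> [/\ H2 rho f, cf f (-1) = 1 & gbound (cf f) B s].

Lemma co_K n w f : good_path w -> K f -> K (co n w f).
Proof. by move=> gw Kf; elim: n => // n IH; rewrite coS; exact: KA. Qed.

Lemma density_K w v : good_path w -> density w v -> K v.
Proof. by move=> gw [n [_ _ ->]]; apply: co_K => //; exact: good_path_back. Qed.

Lemma cf_le_norm f : H2 rho f -> normc (cf f (-1)) <= 2 * N f.
Proof.
move=> Hf; have [rq q1] := midf_lt rho1.
apply: le_trans (H2_gbound rho0 rho1 Hf rq q1 (-1)) _.
by rewrite expr1 ler_piMr ?(ltW q1)// mulr_ge0// sqrtr_ge0.
Qed.

Lemma norm_le f D : H2 rho f -> gbound (cf f) D s -> N f <= 2 * (lsum_cst rho s * D).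
Proof.
move=> Hf hD; have -> : f = lsynth rho (cf f); last exact: (lsynth_norm rho0 rho1 s0 srho hD).
apply: (H2_ext rho0 rho1 Hf (lsynth_H2 rho0 rho1 s0 srho hD)) => n.
by rewrite (lsynth_cf rho0 rho1 s0 srho n hD).
Qed.

Definition norm_cst : R := 2 * (lsum_cst rho s * B).

Lemma norm_scale_le (a : C) f : K f -> N (fun z => a * f z) <= normc a * norm_cst.
Proof.
move=> Kf; have [Hf _ fB] := KP Kf.
apply: le_trans (norm_le (D := normc a * B) (H2_scale a Hf) _) _ => [n|].
  by rewrite cf_scale// normcM -mulrA ler_wpM2l ?normc_ge0.
by rewrite le_eqVlt; apply/orP; left; apply/eqP; rewrite /norm_cst; ring.
Qed.

(** The coefficient of index -1 is at most twice the norm and equals 1 on [K]. Its conservation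
    keeps the growth rate from being negative. *)
Lemma norm_scale_ge (a : C) f : K f -> normc a / 2 <= N (fun z => a * f z).
Proof.
move=> Kf; have [Hf f1 _] := KP Kf; rewrite ler_pdivrMr// mulrC.
by have := cf_le_norm (H2_scale a Hf); rewrite cf_scale// f1 mulr1.
Qed.

Lemma norm_cst_gt0 : 0 < norm_cst.
Proof.
have := norm_scale_ge 1 Ke; have := norm_scale_le 1 Ke; rewrite normc1 mul1r div1r => h1 h2.
by apply: lt_le_trans (le_trans h2 h1); rewrite invr_gt0.
Qed.

(** [H2norm] is computed from a chosen boundary extension, so even this value needs an argument: the
    upper bound on multiples of [e], with multiplier 0. *)
Lemma norm_0 : N (fun=> 0 : C) = 0.
Proof.
have := norm_scale_le 0 Ke; rewrite (_ : (fun z => 0 * e z) = fun=> 0); last first.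
  by apply/funext => z; rewrite mul0r.
by rewrite normc_0 mul0r => h; apply/eqP; rewrite eq_le h sqrtr_ge0.
Qed.

Definition typical w := [/\ good_path w, exists k : nat, zero_run (iter k left_shift w) &
  exists v, density w v].

Lemma co_future w k n f : good_path w -> zero_run (iter k left_shift w) -> (k + M < n)%N -> H2 rho f ->
  exists2 v, K v & co n w f = (fun z => cf f (-1) * v z).
Proof.
move=> gw zk kn Hf; have kn' : (k <= n)%N by apply: leq_trans (ltnW kn); exact: leq_addr.
have gk : good_path (iter k left_shift w) by exact: good_path_iter.
rewrite -(subnK kn') co_add; exists (co (n - k) (iter k left_shift w) e); first exact: co_K.
rewrite (co_collapse gk zk _ (co_H2 _ gw Hf)) ?co_mean//; lia.
Qed.

Lemma log_rate_operator_norm w : typical w ->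
  log_rate (fun n => operator_norm (H2 rho) N (co n w)) @ \oo --> 0%E.
Proof.
move=> [gw [k zk] _]; have c0 := norm_cst_gt0.
(* Scales [e] into the unit ball, which gives the lower bound on the operator norm. *)
pose d := norm_cst^-1; have d0 : 0 < d by rewrite invr_gt0.
have nd : normc d%:C = d by rewrite normc_real gtr0_norm.
have He := unit_H2 rho0 rho1; have Hd := H2_scale d%:C He.
apply: (@cvg_log_rate_bounded _ _ (d / 2) (2 * norm_cst) (k + M).+1); first by rewrite divr_gt0.
move=> n kn; apply/andP; split.
  apply: le_trans (_ : (N (co n w (fun z => d%:C * e z)))%:E <= _)%E.
    rewrite lee_fin co_scale//; apply: le_trans (norm_scale_ge d%:C (co_K n gw Ke)).
    by rewrite nd.
  apply: ereal_sup_ubound; exists (fun z => d%:C * e z) => //; split=> //.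
  by apply: le_trans (norm_scale_le _ Ke) _; rewrite nd mulVf ?gt_eqF.
apply: ge_ereal_sup => _ [f [Hf f1] <-]; rewrite lee_fin.
have [v Kv ->] := co_future gw zk kn Hf.
apply: le_trans (norm_scale_le _ Kv) _; rewrite ler_wpM2r ?(ltW c0)//.
by apply: le_trans (cf_le_norm Hf) _; rewrite ler_piMr.
Qed.

Lemma log_rate_density w v (a : C) : good_path w -> density w v -> a != 0 ->
  log_rate (fun n => (N (co n w (fun z => (a * v z)%R)))%:E) @ \oo --> 0%E.
Proof.
move=> gw dv a0; have Kv := density_K gw dv; have [Hv _ _] := KP Kv.
apply: (@cvg_log_rate_bounded _ _ (normc a / 2) (normc a * norm_cst) 0).
  by rewrite divr_gt0// normc_gt0.
move=> n _; rewrite co_scale// !lee_fin; have Kn := co_K n gw Kv.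
by rewrite norm_scale_ge// norm_scale_le.
Qed.

(** Past the first run in the future the image is exactly 0, and the logarithm of 0 is [-oo]. *)
Lemma limn_esup_mean0 w f : typical w -> H2 rho f -> cf f (-1) = 0 ->
  limn_esup (log_rate (fun n => (N (co n w f))%:E)) = -oo%E.
Proof.
move=> [gw [k zk] _] Hf f0; apply: (@limn_esup_log_rate_zero _ _ (k + M).+1) => n kn.
have [v _ ->] := co_future gw zk kn Hf.
rewrite f0 (_ : (fun z => 0 * v z) = fun=> 0) ?norm_0//.
by apply/funext => z; rewrite mul0r.
Qed.

(** The coefficient of index -1 is a linear functional bounded in the norm by [cf_le_norm], so its
    kernel is closed. *)
Lemma closed_mean0 : closed_subspace (H2 rho) N [set f : C -> C | H2 rho f /\ cf f (-1) = 0].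
Proof.
split.
- by move=> f [].
- by split; [exact: H2_0|rewrite /cf lc_cst// mul0r].
- move=> a f g [Hf f0] [Hg g0].
  have -> : a *: f + g = (fun z => a * f z + g z) by [].
  by split; [exact: H2_lin|rewrite (cf_lin rho0 rho1 _ _ Hf Hg) f0 g0 mulr0 addr0].
move=> u f Fu Hf cu; split=> //; apply/eqP; rewrite -normc_eq0 eq_le normc_ge0 andbT.
apply/ler_addgt0Pr => d d0; rewrite add0r.
have d2 : 0 < d / 2 by rewrite divr_gt0.
move/cvgrPdist_lt : cu => /(_ _ d2)[n _ /(_ n (leqnn n))].
have [Hu u0] := Fu n.
have E : (fun z => -1 * f z + u n z) = u n - f by apply/funext => z; rewrite mulN1r addrC.
have := cf_le_norm (H2_lin rho0 rho1 (-1) Hf Hu).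
rewrite (cf_lin rho0 rho1 _ _ Hf Hu) u0 addr0 mulN1r normcN E.
rewrite sub0r normrN ger0_norm ?sqrtr_ge0// => h1 h2.
apply: le_trans h1 _; rewrite mulrC -ler_pdivlMr//; exact: ltW.
Qed.
End Assembly.

(** * Almost every path is typical *)

Section Typical.
Variable R : realType.
Variables (p : R) (P : probability Omega R) (rho eps : R) (M : nat).
Hypothesis hp : 0 < p <= 1.
Hypothesis hP : bernoulli_measure p P.
Hypothesis rho0 : 0 < rho.
Hypothesis hr : (cocycle_max_modulus P rho < rho%:E)%E.

Lemma ae_typical : {ae P, forall w, typical rho eps M w}.
Proof.
have gap k l : (k < l)%N -> (k * M.+1)%N%:Z + M.+1%:Z <= (l * M.+1)%N%:Z.
  by move=> kl; rewrite -PoszD lez_nat -mulSnr leq_mul2r kl orbT.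
have h1 := @ae_zero_run R p P hp hP M.+1 (fun l => (l * M.+1)%N%:Z) (fun k l kl => or_introl (gap k l kl)).
(* Starting from [l.+1] rather than [l] keeps each window of length M + 1 entirely at negative
   times. *)
have h2 := @ae_zero_run R p P hp hP M.+1 (fun l => - (l.+1 * M.+1)%N%:Z).
have {}h2 : {ae P, forall w : Omega, exists l, forall j, (j < M.+1)%N -> w (- (l.+1 * M.+1)%N%:Z + j%:Z) = false}.
  apply: h2 => k l kl; right; have := gap k.+1 l.+1 kl; lia.
have h3 := ae_good hP rho0 hr.
move: h1 h2 h3; apply: filterS3 => w [k hk] [l hl] gw; split=> //.
  by exists (k * M.+1)%N => j jM; rewrite iter_shift addrC hk.
eexists; exists (l.+1 * M.+1)%N; split; last exact: erefl.
  by rewrite mulSn addSn ltnS leq_addr.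
by move=> j jM; rewrite /back addrC hl.
Qed.
End Typical.

(** * The Oseledets line, its complement and the Lyapunov spectrum *)

Section Spectrum.
Variable R : realType.
Local Notation C := R[i].
Implicit Types (f g : C -> C) (w : Omega).
Variables rho eps : R.
Hypothesis rho0 : 0 < rho.
Hypothesis rho1 : rho < 1.
Variable M : nat.
Hypothesis epsE : eps = (2 * (2 ^ M)%N%:R)^-1.
Local Notation A := (perturbed_cocycle rho eps).
Local Notation N := (@H2norm R rho).

(** Stated through any density at [w], so that no choice is made; by [density_unique] this is a line
    once a density exists along a good path. *)
Definition oseledets w : set (C -> C) := [set f | exists a v, density rho eps M w v /\ f = (fun z => a * v z)].

Definition mean0 : set (C -> C) := [set f | H2 rho f /\ cf f (-1) = 0].

Lemma opA1_scale w (a : C) f : good_path rho w -> H2 rho f -> A w (fun z => a * f z) = (fun z => a * A w f z).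
Proof. exact: (@co_scale R rho eps rho0 rho1 1). Qed.

Lemma good_path_shift w : good_path rho w -> good_path rho (left_shift w).
Proof. by move=> gw i; exact: gw. Qed.

Lemma density_H2 w v : good_path rho w -> density rho eps M w v -> H2 rho v /\ cf v (-1) = 1.
Proof.
move=> gw [n [_ _ ->]]; have gb : good_path rho (back n w) by exact: good_path_back.
have He := unit_H2 rho0 rho1; split; first exact: co_H2.
by rewrite co_mean// (unit_cf rho0 rho1) eqxx.
Qed.

Lemma oseledets_H2 w : good_path rho w -> oseledets w `<=` H2 rho.
Proof. by move=> gw f [a [v [/(density_H2 gw)[Hv _] ->]]]; exact: H2_scale. Qed.

Lemma oseledets_dim w : typical rho eps M w -> has_dim (oseledets w : set _) 1.
Proof.
move=> [gw _ [v dv]]; have [Hv v1] := density_H2 gw dv.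
exists (fun=> v); split=> [c|f].
  rewrite big_ord1 => E i; rewrite ord1.
  have {}E : (fun z => c ord0 * v z) = (fun=> 0) := E.
  by rewrite -[LHS]mulr1 -v1 -(cf_scale rho0 rho1 _ _ Hv) E /cf lc_cst// mul0r.
split=> [[a [v' [dv' ->]]]|[c ->]].
  by exists (fun=> a); rewrite big_ord1 (density_unique rho0 rho1 epsE gw dv dv').
by exists (c ord0), v; rewrite big_ord1.
Qed.

Lemma oseledets_shift w : typical rho eps M w -> A w @` oseledets w = oseledets (left_shift w).
Proof.
move=> [gw _ [v dv]]; have [Hv _] := density_H2 gw dv.
have gs := good_path_shift gw; have ds := density_shift rho0 rho1 dv.
apply/seteqP; split=> [_ [_ [a [v' [dv' ->]] <-]]|_ [a [v' [dv' ->]]]].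
  exists a, (A w v'); split; first exact: density_shift.
  by apply: opA1_scale => //; have [] := density_H2 gw dv'.
exists (fun z => a * v z); first by exists a, v.
by rewrite (density_unique rho0 rho1 epsE gs dv' ds) opA1_scale.
Qed.

Lemma mean0_shift w : good_path rho w -> A w @` mean0 `<=` mean0.
Proof.
move=> gw _ [f [Hf f0] <-]; split; first exact: (@co_H2 R rho eps rho0 rho1 1).
by have := @co_mean R rho eps rho0 rho1 1 w f gw Hf; rewrite f0.
Qed.

(** A density [v] has mean 1, so [f] projects to [cf f (-1)] times [v]. Taking coefficients of index
    -1 in any decomposition gives back this multiple. *)
Lemma oseledets_splitting w f : typical rho eps M w -> H2 rho f ->
  exists! vg : ('I_1 -> (C -> C)) * (C -> C),
    [/\ forall i : 'I_1, oseledets w (vg.1 i), mean0 vg.2 & f = \sum_i vg.1 i + vg.2].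
Proof.
move=> [gw _ [v dv]] Hf; have [Hv v1] := density_H2 gw dv.
exists ((fun=> (fun z => cf f (-1) * v z)), (fun z => - cf f (-1) * v z + f z)); split.
  split=> /=.
  - by move=> _; exists (cf f (-1)), v.
  - by split; [exact: H2_lin|rewrite (cf_lin rho0 rho1 _ _ Hv Hf) v1 mulr1 addNr].
  - rewrite big_ord1; apply/funext => z.
    change (f z = cf f (-1) * v z + (- cf f (-1) * v z + f z)).
    by rewrite mulNr addrA subrr add0r.
move=> [V g] /= [hV [Hg g0] E].
have [a [v' [dv' VE]]] := hV ord0.
rewrite (density_unique rho0 rho1 epsE gw dv' dv) in VE.
have {}E : f = (fun z => a * v z + g z) by rewrite E big_ord1 VE.
have fa : cf f (-1) = a by rewrite E (cf_lin rho0 rho1 _ _ Hv Hg) v1 g0 mulr1 addr0.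
congr pair; first by apply/funext => i; rewrite ord1 VE fa.
by apply/funext => z; rewrite fa E mulNr addrA addNr add0r.
Qed.
End Spectrum.

Local Close Scope complex_scope.
Theorem corollary4 (R : realType) (p : R) (P : probability Omega R) (rho : R)
  (hp : 0 < p <= 1) (hP : bernoulli_measure p P)
  (hrho : 0 < rho < 1)
  (hr : (cocycle_max_modulus P rho < rho%:E)%E) :
  forall delta : R, 0 < delta ->
  exists eps : R, 0 < eps < delta /\
  exists (lam : nat -> \bar R) (m : nat -> nat),
    [/\ lyapunov_spectrum P left_shift (H2 rho) (H2norm rho)
          (perturbed_cocycle rho eps) lam m,
        lam 0%N = 0%E, m 0%N = 1%N &
        forall j : nat, (0 < j)%N -> lam j = -oo%E].
Proof.
move=> delta delta0; have /andP[rho0 rho1] := hrho.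
have x01 : 0 <= (2^-1 : R) < 1 by rewrite invr_ge0 ler0n invf_lt1 ?ltr1n.
have [M hM] := geo_small 2^-1 x01 delta0.
(* This equals [2^-1 * 2^-1 ^+ M], which the choice of [M] made smaller than [delta]. *)
pose eps : R := (2 * (2 ^ M)%N%:R)^-1.
exists eps; split.
  rewrite invr_gt0 mulr_gt0 ?ltr0n ?expn_gt0//=.
  by have := hM M (leqnn M); rewrite /eps natrX invfM exprVn.
exists (fun j => if j == 0%N then 0%E else -oo%E), (fun=> 1%N); split=> //; last by case.
have fin0 j : (if j == 0%N then 0%E else -oo%E : \bar R) \is a fin_num -> j = 0%N.
  by case: j.
split; [by []|by move=> j /fin0 -> /=; rewrite ltNyr|by case|by []|].
(* The complement is the same subspace for every path, since both operators preserve the coefficient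
   of index -1. *)
exists (fun _ => oseledets rho eps M), (fun _ _ => mean0 rho).
have [K [s [B [s0 sr Ke KA KP]]]] := invariant_densities eps rho0 rho1.
have epsE : eps = (2 * (2 ^ M)%N%:R)^-1 by [].
apply: filterS (ae_typical eps M hp hP rho0 hr) => w tw; have [gw _ [v dv]] := tw.
split.
- exact: (log_rate_operator_norm rho0 rho1 epsE s0 sr Ke KA KP tw).
- move=> _ /fin0 ->; split.
  + exact: oseledets_H2.
  + exact: oseledets_dim.
  + exact: oseledets_shift.
  move=> f [a [v' [dv' ->]]] f0.
  apply: (log_rate_density rho0 rho1 s0 sr Ke KA KP gw dv'); apply/eqP => a0; apply: f0.
  by apply/funext => z; rewrite a0 mul0r.
move=> _ /fin0 ->; split.
- exact: closed_mean0.
- exact: mean0_shift.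
- by move=> f Hf; exact: oseledets_splitting.
by move=> f [Hf f0]; rewrite (limn_esup_mean0 rho0 rho1 epsE s0 sr Ke KA KP tw Hf f0).
Qed.
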